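(* Let $q$ be an odd prime, let $\zeta=\zeta_q=e^{2\pi i/q}$, $K=\mathbb{Q}(\zeta)$, and let $G=(\mathbb{Z}/q\mathbb{Z})^*/\{\pm1\}$, identified with a fixed set of representatives in $(\mathbb{Z}/q\mathbb{Z})^*$ containing $1$. For $j\in G$ let $\sigma_j:K\to\mathbb{C}$ be the embedding with $\sigma_j(\zeta)=\zeta^j$, and define $\operatorname{Log}:K^*\to\mathbb{R}^{G}$ by $\operatorname{Log}(a)=(\log|\sigma_j(a)|)_{j\in G}$. For $j\in G\setminus\{1\}$ let $b_j=\frac{\zeta^j-1}{\zeta-1}$ and $\mathbf{b}_j=\operatorname{Log}(b_j)\in\mathbb{R}^{G}$; these vectors are linearly independent and form a basis of the log-cyclotomic-unit lattice. Let $\{\mathbf{b}_j^\vee\}_{j\in G\setminus\{1\}}$ be the dual basis, i.e. the vectors in the real span of $\{\mathbf{b}_j\}_{j\in G\setminus\{1\}}$ satisfying $\langle\mathbf{b}_j^\vee,\mathbf{b}_{j'}\rangle=\delta_{j,j'}$ for all $j,j'\in G\setminus\{1\}$. Then all the norms $\lVert\mathbf{b}_j^\vee\rVert$ are equal, and moreover, assuming the Generalized Riemann Hypothesis, for every $\varepsilon>0$, \[\lVert\mathbf{b}_j^\vee\rVert^2=\frac{4\zeta(2)}{\zeta(4)}\cdot\frac{1}{q}\left(1+O\!\left(q^{-1+\varepsilon}\right)\right)\quad\text{as } q\to\infty \text{ through primes},\] where $\zeta(s)$ denotes the Riemann zeta function.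
   Context: $\langle\cdot,\cdot\rangle$ is the standard inner product on $\mathbb{R}^G$ and $\lVert\cdot\rVert$ the Euclidean norm. The Generalized Riemann Hypothesis (GRH) asserts that every nontrivial zero of every Dirichlet $L$-function $L(s,\chi)$ has real part $1/2$. The implied constant in the $O$-term may depend on $\varepsilon$. *)

(* Defs.v *)
From HB Require Import structures.
From mathcomp Require Import all_boot all_order all_algebra.
From mathcomp Require Import all_classical all_reals all_analysis.
From mathcomp Require Import complex.
Set Implicit Arguments. Unset Strict Implicit. Unset Printing Implicit Defensive.
Import Order.TTheory GRing.Theory Num.Theory.
Import numFieldNormedType.Exports.
Local Open Scope ring_scope.
Local Open Scope classical_set_scope.
Local Open Scope ring_scope.
Local Open Scope complex_scope.

Section Defs.
Variable R : realType.

Definition cabs (z : R[i]) : R := Num.sqrt (complex.Re z ^+ 2 + complex.Im z ^+ 2).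

Definition zetaq (q : nat) : R[i] :=
  Complex (cos (2 * pi / q%:R)) (sin (2 * pi / q%:R)).

(* sigma_k(b_j) where b_j = (zeta^j - 1)/(zeta - 1) and sigma_k(zeta) = zeta^k *)
Definition sigma_b (q k j : nat) : R[i] :=
  (zetaq q ^+ (k * j) - 1) / (zetaq q ^+ k - 1).

(* bold b_j = Log(b_j), as a vector indexed by 'I_q (only the coordinates
   in the representative set G are meaningful) *)
Definition logb (q : nat) (j : 'I_q) : 'I_q -> R :=
  fun k => ln (cabs (sigma_b q k j)).

(* G is a set of representatives of (Z/qZ)^* / {+-1} inside (Z/qZ)^*
   (represented by 'I_q), containing 1. *)
Definition rep_set (q : nat) (G : {set 'I_q}) : Prop :=
  [/\ (forall k : 'I_q, k \in G -> (0 < k)%N),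
      (forall k l : 'I_q, k \in G -> l \in G -> (k + l != q)%N),
      (forall k : 'I_q, (0 < k)%N -> k \in G \/ exists2 l : 'I_q, l \in G & (k + l)%N = q)
    & exists2 one : 'I_q, one \in G & val one = 1%N].

Definition Gm1 (q : nat) (G : {set 'I_q}) : {set 'I_q} :=
  [set j in G | val j != 1%N].

Definition dotG (q : nat) (G : {set 'I_q}) (v w : 'I_q -> R) : R :=
  \sum_(i in G) v i * w i.
Definition normG (q : nat) (G : {set 'I_q}) (v : 'I_q -> R) : R :=
  Num.sqrt (dotG G v v).

Definition dual_basis (q : nat) (G : {set 'I_q}) (bv : 'I_q -> 'I_q -> R) : Prop :=
  forall j, j \in Gm1 G ->
    (exists c : 'I_q -> R, forall i, i \in G ->
        bv j i = \sum_(j' in Gm1 G) c j' * logb j' i) /\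
    (forall j', j' \in Gm1 G -> dotG G (bv j) (logb j') = (j == j')%:R).

Definition zeta_nat (k : nat) : R :=
  limn (fun N => \sum_(0 <= n < N) ((n.+1)%:R ^- k : R)).

Definition cpow_neg (n : nat) (s : R[i]) : R[i] :=
  let L := ln (n%:R : R) in
  let e := expR (- complex.Re s * L) in
  Complex (e * cos (complex.Im s * L)) (- (e * sin (complex.Im s * L))).

Definition cvgC (u : nat -> R[i]) (l : R[i]) : Prop :=
  (fun N => complex.Re (u N)) @ \oo --> complex.Re l /\
  (fun N => complex.Im (u N)) @ \oo --> complex.Im l.

Definition dirichlet_char (m : nat) (chi : nat -> R[i]) : Prop :=
  [/\ (0 < m)%N,
      (forall a b, chi (a * b)%N = chi a * chi b),
      (forall n, chi (n + m)%N = chi n)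
    & (forall n, chi n != 0 <-> coprime n m)].

Definition principal_char (m : nat) (chi : nat -> R[i]) : Prop :=
  forall n, coprime n m -> chi n = 1.

(* GRH: no nontrivial zero off the critical line.  By the functional equation
   it suffices (and is equivalent) to forbid zeros with 1/2 < Re s < 1.
   For non-principal chi, L(s,chi) is given on Re s > 0 by its (convergent)
   Dirichlet series; for principal characters the nontrivial zeros are those of
   the Riemann zeta function, which on Re s > 0 (away from Re s = 1) are the
   zeros of the alternating series eta(s) = (1 - 2^{1-s}) zeta(s). *)
Definition GRH : Prop :=
  (forall (m : nat) (chi : nat -> R[i]), dirichlet_char m chi -> ~ principal_char m chi ->
     forall s : R[i], 2^-1 < complex.Re s < 1 ->
     forall l, cvgC (fun N => \sum_(1 <= n < N.+1) chi n * cpow_neg n s) l -> l != 0)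
  /\
  (forall s : R[i], 2^-1 < complex.Re s < 1 ->
     forall l, cvgC (fun N => \sum_(1 <= n < N.+1) (- 1) ^+ n.+1 * cpow_neg n s) l -> l != 0).

End Defs.

(* Main.v *)
(** Expanding the dual vectors along the even characters chi mod q diagonalises the problem:
    the coefficient of b_j^vee at chi <> 1 has absolute value 1 / |Lambda(chi)| with
    Lambda(chi) = sum_(k in G) chi(k) ln |1 - zeta^k|, independently of j, and it vanishes at
    chi = 1. Hence all norms agree, and since 4 |Lambda(chi)|^2 = q |L(1, chi)|^2 (Fourier series
    of ln |1 - zeta^k| and Gauss sums) the squared norm is 4 / q times the mean of
    |L(1, chi)|^(-2).

    That mean is computed with a mollifier. Let S be the partial sum of L(1, chi) up to X = q^3,
    M that of sum mu(n) chi(n) / n, and D = 1 - M S, which has coefficients in (X, X^2].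
    Then 1/S = M + D/S, and orthogonality of the characters evaluates the mean of |M|^2 as
    sum mu(n)^2 / n^2 = zeta(2) / zeta(4) while the contributions of D are O(q^(-1 + eps)),
    provided |S| >= c q^(- eps) for every chi. For non-real chi this bound follows from the
    inequality zeta(s)^3 |L(s, chi)|^4 |L(s, chi^2)| >= c slightly to the right of s = 1.
    For real chi it follows from the positivity of the coefficients of zeta(s) L(s, chi) slightly
    to the left of s = 1, where L(s, chi) >= 0 by GRH: this is the only use of GRH. *)
From mathcomp Require Import all_boot all_order all_algebra.
From mathcomp Require Import all_fingroup all_solvable.
From mathcomp Require Import all_classical all_reals all_analysis.
From mathcomp Require Import complex.
From mathcomp Require Import zify ring lra.
Require Import Defs.
Import Order.TTheory GRing.Theory Num.Theory.
Import numFieldNormedType.Exports.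
Local Open Scope ring_scope.
Set Implicit Arguments.
Unset Strict Implicit.
Local Notation "x ^*" := (@conjc _ x) : ring_scope.

(** GRH enters only as non-vanishing, and deducing from it an approximation of 1 / L(1, chi) by a
    short Dirichlet polynomial would require complex analysis. The mollifier avoids this: 1 / S is
    expanded by exact algebra, and as the mean of |D|^2 gains almost a full factor q, the pointwise
    bound for 1 / S may lose a small power of q. Long polynomials are cheap: with weights 1 / n, the
    pairs m <> n with n = +-m mod q contribute only O(log^2 / q), so the length enters through
    logarithms alone. Hence X can be so large that the trivial bound q for character sums, without
    Polya-Vinogradov, makes the tail of L(1, chi) beyond X = q^3 an O(q^(-2)).

    Real characters need their own argument because chi^2 is then principal and its L-function has a
    pole at 1; what GRH has to exclude is a real zero just to the left of 1. Non-vanishing at 1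
    itself comes from the lattice: a dual vector could not exist if some Lambda(chi) vanished.
    Infinite sums and products are mostly replaced by finite ones with explicit errors. *)

Section CabsTheory.
Local Open Scope complex_scope.
Variable R : realType.
Implicit Types (z w : R[i]) (x y : R).

Lemma cabsE z : (cabs z)%:C = `|z|.
Proof. by rewrite normc_def. Qed.

(** Transfer principle: the norm of [R[i]] takes values in [R[i]], and its rules reach the
    real-valued [cabs] through the injectivity of the embedding of [R]. *)
Lemma cabsP x z : x%:C = `|z| -> cabs z = x.
Proof. by rewrite -cabsE => /complexI. Qed.

Lemma cabs_ge0 z : 0 <= cabs z.
Proof. exact: sqrtr_ge0. Qed.

Lemma cabs0 : cabs (0 : R[i]) = 0.
Proof. by apply: cabsP; rewrite normr0. Qed.

Lemma cabs1 : cabs (1 : R[i]) = 1.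
Proof. by apply: cabsP; rewrite normr1. Qed.

Lemma cabsM z w : cabs (z * w) = cabs z * cabs w.
Proof. by apply: cabsP; rewrite rmorphM /= !cabsE normrM. Qed.

Lemma cabsX z n : cabs (z ^+ n) = cabs z ^+ n.
Proof. by elim: n => [|n IH]; rewrite ?expr0 ?cabs1// !exprS cabsM IH. Qed.

Lemma cabsV z : cabs z^-1 = (cabs z)^-1.
Proof. by apply: cabsP; rewrite fmorphV /= cabsE normfV. Qed.

Lemma cabsN z : cabs (- z) = cabs z.
Proof. by apply: cabsP; rewrite cabsE normrN. Qed.

Lemma cabsB z w : cabs (z - w) = cabs (w - z).
Proof. by rewrite -cabsN opprB. Qed.

Lemma cabs_real x : cabs x%:C = `|x|.
Proof. by rewrite /cabs /= expr0n /= addr0 sqrtr_sqr. Qed.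

Lemma cabs_eq0 z : (cabs z == 0) = (z == 0).
Proof. by rewrite -(inj_eq (@complexI R)) cabsE normr_eq0. Qed.

Lemma cabs_gt0 z : (0 < cabs z) = (z != 0).
Proof. by rewrite lt_def cabs_eq0 cabs_ge0 andbT. Qed.

Lemma cabsD z w : cabs (z + w) <= cabs z + cabs w.
Proof. by rewrite -lecR rmorphD /= !cabsE ler_normD. Qed.

Lemma cabsBD z w : cabs (z - w) <= cabs z + cabs w.
Proof. by rewrite -(cabsN w) cabsD. Qed.

Lemma cabs_dist z w : `|cabs z - cabs w| <= cabs (z - w).
Proof.
rewrite ler_norml; apply/andP; split.
  by have := cabsD (w - z) z; rewrite subrK cabsB; lra.
by have := cabsD (z - w) w; rewrite subrK; lra.
Qed.

Lemma cabs_sum (I : Type) (r : seq I) (P : pred I) (F : I -> R[i]) :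
  cabs (\sum_(i <- r | P i) F i) <= \sum_(i <- r | P i) cabs (F i).
Proof.
elim/big_rec2: _ => [|i y z _ le]; first by rewrite cabs0.
exact: (le_trans (cabsD _ _) (lerD _ le)).
Qed.

Lemma cabs_conj z : cabs z^* = cabs z.
Proof. by case: z => a b; rewrite /cabs /= sqrrN. Qed.

Lemma sqr_cabs z : (cabs z ^+ 2)%:C = z * z^*.
Proof.
case: z => a b; rewrite /cabs /= sqr_sqrtr ?addr_ge0 ?sqr_ge0//.
by apply/eqP; rewrite eq_complex /=; apply/andP; split; apply/eqP; ring.
Qed.

Lemma cabs_sqr z : cabs z ^+ 2 = complex.Re z ^+ 2 + complex.Im z ^+ 2.
Proof. by rewrite sqr_sqrtr// addr_ge0 ?sqr_ge0. Qed.

Lemma Re_le_cabs z : `|complex.Re z| <= cabs z.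
Proof.
rewrite -sqrtr_sqr /cabs ler_sqrt ?addr_ge0 ?sqr_ge0//.
by rewrite lerDl sqr_ge0.
Qed.

Lemma ReD z w : complex.Re (z + w) = complex.Re z + complex.Re w.
Proof. by case: z; case: w. Qed.

Lemma Re_sum (I : Type) (r : seq I) (P : pred I) (F : I -> R[i]) :
  complex.Re (\sum_(i <- r | P i) F i) = \sum_(i <- r | P i) complex.Re (F i).
Proof. by elim/big_rec2: _ => [//|i y z _ <-]; rewrite ReD. Qed.

Lemma conjM z w : (z * w)^* = z^* * w^*.
Proof. exact: rmorphM. Qed.

Lemma conj_sum (I : Type) (r : seq I) (P : pred I) (F : I -> R[i]) :
  (\sum_(i <- r | P i) F i)^* = \sum_(i <- r | P i) (F i)^*.
Proof. exact: rmorph_sum. Qed.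

End CabsTheory.

(** * Roots of unity *)

Section RootsOfUnity.
Local Open Scope complex_scope.
Variable R : realType.

Definition expi (t : R) : R[i] := Complex (cos t) (sin t).

Lemma expiD t u : expi (t + u) = expi t * expi u.
Proof.
rewrite /expi cosD sinD; apply/eqP; rewrite eq_complex /=.
by apply/andP; split; apply/eqP; ring.
Qed.

Lemma expi0 : expi 0 = 1.
Proof. by rewrite /expi cos0 sin0. Qed.

Lemma expiX t n : expi t ^+ n = expi (n%:R * t).
Proof.
elim: n => [|n IH]; first by rewrite mul0r expi0.
by rewrite exprS IH -expiD -natr1 mulrDl mul1r addrC.
Qed.

Lemma cabs_expi t : cabs (expi t) = 1.
Proof. by rewrite /cabs /= cos2Dsin2 sqrtr1. Qed.

Lemma zetaqX q k : zetaq R q ^+ k = expi (k%:R * (2 * pi / q%:R)).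
Proof. exact: expiX. Qed.

Lemma cabs_zetaqX q k : cabs (zetaq R q ^+ k) = 1.
Proof. by rewrite zetaqX cabs_expi. Qed.

Lemma zetaqXq q : (0 < q)%N -> zetaq R q ^+ q = 1.
Proof.
move=> q0; rewrite zetaqX mulrCA divff ?pnatr_eq0 -?lt0n// mulr1.
by rewrite mulr_natl /expi cos2pi sin2pi.
Qed.

Lemma cos_lt1 (t : R) : 0 < t < 2 * pi -> cos t < 1.
Proof.
move=> /andP[t0 t2].
have -> : t = (t / 2) *+ 2 by lra.
rewrite cos_mulr2n cos2sin2.
have : 0 < sin (t / 2) by apply: sin_gt0_pi; apply/andP; split; lra.
by nra.
Qed.

Lemma zetaqX_modn q k : (0 < q)%N -> zetaq R q ^+ k = zetaq R q ^+ (k %% q).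
Proof.
move=> q0; rewrite [in LHS](divn_eq k q) exprD mulnC exprM zetaqXq//.
by rewrite expr1n mul1r.
Qed.

Lemma cos_zetaq_lt1 q k : (0 < k < q)%N ->
  cos (k%:R * (2 * pi / q%:R)) < 1 :> R.
Proof.
move=> /andP[k0 kq]; have q0 : 0 < q%:R :> R by rewrite ltr0n (leq_trans _ kq).
have ppi := @pi_gt0 R.
have kq' : k%:R < q%:R :> R by rewrite ltr_nat.
have k0' : 0 < k%:R :> R by rewrite ltr0n.
apply: cos_lt1; apply/andP; split.
  by rewrite mulr_gt0// divr_gt0// mulr_gt0.
rewrite mulrCA gtr_pMr ?mulr_gt0// -ltr_pdivlMr ?invr_gt0// invrK mul1r.
exact: kq'.
Qed.

Lemma zetaqX_eq1 q k : (0 < q)%N -> (zetaq R q ^+ k == 1) = (q %| k)%N.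
Proof.
move=> q0; rewrite zetaqX_modn// /dvdn.
have [->|km] := posnP (k %% q)%N; first by rewrite expr0 eqxx.
apply/negbTE/eqP => e.
have : cos ((k %% q)%N%:R * (2 * pi / q%:R)) < 1 :> R.
  by apply: cos_zetaq_lt1; rewrite km ltn_mod.
by rewrite zetaqX in e; case: e => -> _; rewrite ltxx.
Qed.

Lemma sum_zetaqX q k : (0 < q)%N ->
  \sum_(0 <= n < q) zetaq R q ^+ (k * n) = if (q %| k)%N then q%:R else 0.
Proof.
move=> q0; case: ifPn => [dk|ndk].
  transitivity (\sum_(0 <= n < q) (1 : R[i])); last first.
    by rewrite sumr_const_nat subn0.
  apply: eq_bigr => n _.
  by apply/eqP; rewrite zetaqX_eq1// dvdn_mulr.
under eq_bigr => n _ do rewrite exprM.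
rewrite big_mkord; set z := _ ^+ k.
have z1 : z - 1 != 0 by rewrite subr_eq0 zetaqX_eq1.
apply: (mulfI z1); rewrite mulr0 -subrX1 /z -exprM mulnC exprM zetaqXq//.
by rewrite expr1n subrr.
Qed.

(** Keeps conjugates among the natural powers, so that products with conjugates are again summed by
    [sum_zetaqX]. *)
Lemma zetaq_conjX q k : (0 < q)%N -> (k <= q)%N ->
  (zetaq R q ^+ k)^* = zetaq R q ^+ (q - k).
Proof.
move=> q0 kq; have q1 := zetaqXq q0.
have z0 : zetaq R q ^+ k != 0 by rewrite -cabs_eq0 cabs_zetaqX oner_eq0.
apply: (mulfI z0); rewrite -exprD subnKC// q1 -sqr_cabs cabs_zetaqX.
by rewrite expr1n.
Qed.

Lemma cabs_zetaqX_sub1 q k :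
  cabs (zetaq R q ^+ k - 1) ^+ 2 = 2 - 2 * cos (k%:R * (2 * pi / q%:R)).
Proof.
rewrite zetaqX cabs_sqr /=; set t := (_ * _).
by rewrite oppr0 addr0; have := cos2Dsin2 t; lra.
Qed.

End RootsOfUnity.

Lemma is_derive_pow (R : realType) (n : nat) (t : R) :
  is_derive t 1 (fun x : R => x ^+ n.+1) (n.+1%:R * t ^+ n).
Proof.
have -> : (fun x : R => x ^+ n.+1) = id ^+ n.+1.
  by apply/funext => x; elim: n.+1 => [//|m IH]; rewrite !exprS IH.
have := @is_deriveX R _ id n.+1 t 1 1 (is_derive_id _ _).
by rewrite /GRing.scale/= mulr1.
Qed.

(** * The cosine series of ln |1 - e^(i th)| with explicit remainder *)

Section LogSeries.
Local Open Scope classical_set_scope.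
Local Open Scope ring_scope.
Variables (R : realType) (th : R).
Hypothesis cth : cos th < 1.
Let c := cos th.

(** This is |1 - t e^(i th)|^2; the hypothesis [cos th < 1] keeps it away from 0 up to the endpoint
    t = 1. *)
Let A (t : R) := 1 - 2 * t * c + t ^+ 2.

Let cge : -1 <= c. Proof. exact: cos_geN1. Qed.

(** Write [A t] as (1 - t)^2 + 2 t (1 - c). For t <= 1/2 the square is at least 1/4, which is at
    least (1 - c) / 8 because c >= -1; for t >= 1/2 the second term is at least 1 - c. *)
Let A_ge (t : R) : 0 <= t <= 1 -> (1 - c) / 8 <= A t.
Proof.
move=> /andP[t0 t1]; rewrite /A.
have c1 : c < 1 by [].
have cg := cge.
have -> : 1 - 2 * t * c + t ^+ 2 = (1 - t) ^+ 2 + 2 * t * (1 - c) by ring.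
case: (lerP t (2^-1)) => ht; nra.
Qed.

Let A_gt0 (t : R) : 0 <= t <= 1 -> 0 < A t.
Proof.
move=> /A_ge; apply: lt_le_trans; rewrite divr_gt0// subr_gt0; exact: cth.
Qed.

Let P N (t : R) := \sum_(1 <= n < N.+1) t ^+ n * cos (n%:R * th) / n%:R.
Let dP N (t : R) := \sum_(1 <= n < N.+1) t ^+ n.-1 * cos (n%:R * th).

(** Real part of the closed form of a finite geometric sum of ratio t e^(i th), with the denominator
    cleared; the induction is the recurrence for cos (n th). *)
Let geoP N t : A t * dP N t =
  c - t - t ^+ N * cos (N.+1%:R * th) + t ^+ N.+1 * cos (N%:R * th).
Proof.
elim: N => [|N IH].
  by rewrite /dP big_geq// mulr0 expr0 mul1r mul0r cos0 expr1 mul1r /c; ring.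
rewrite /dP big_nat_recr//= mulrDr -/(dP N t) IH /A.
have e : cos (N.+2%:R * th) = 2 * c * cos (N.+1%:R * th) - cos (N%:R * th).
  have -> : N.+2%:R * th = N.+1%:R * th + th by rewrite -natr1 mulrDl mul1r.
  have -> : N%:R * th = N.+1%:R * th - th by rewrite -natr1 mulrDl mul1r addrK.
  by rewrite cosD cosB /c; ring.
by rewrite e !exprS; ring.
Qed.

Let is_derive_P N (t : R) : is_derive t 1 (P N) (dP N t).
Proof.
rewrite /P /dP; elim: N => [|N IH].
  rewrite (_ : (fun _ => _) = cst 0); last by apply/funext => x; rewrite big_geq.
  by rewrite big_geq//; exact: is_derive_cst.
rewrite big_nat_recr//=.
rewrite (_ : (fun _ => _) = (fun t => \sum_(1 <= n < N.+1) t ^+ n * cos (n%:R * th) / n%:R)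
   + (fun t => (cos (N.+1%:R * th) / N.+1%:R) *: t ^+ N.+1)); last first.
  apply/funext => x; rewrite big_nat_recr//= /GRing.add/=; congr (_ + _).
  by rewrite /GRing.scale/=; ring.
apply: is_deriveD.
have e : t ^+ N * cos (N.+1%:R * th) =
   (cos (N.+1%:R * th) / N.+1%:R) *: (N.+1%:R * t ^+ N).
  by rewrite /GRing.scale/= mulrACA mulrA mulrC; field; rewrite ?natr1 ?nat1r pnatr_eq0.
rewrite e; apply: is_deriveZ.
exact: is_derive_pow.
Qed.

(* Up to sign, the remainder of the series of [- ln |1 - t e^(i th)|]. Its derivative is
   the remainder of a geometric series, [O(t ^ N)] uniformly on [[0, 1]], which gives
   [O(1 / N)] at [t = 1] directly. *)
Let G N (t : R) := 2^-1 * ln (A t) + P N t.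

Let is_derive_G N (t : R) : 0 <= t <= 1 ->
  is_derive t 1 (G N) ((- t ^+ N * cos (N.+1%:R * th) + t ^+ N.+1 * cos (N%:R * th)) / A t).
Proof.
move=> t01; have A0 := A_gt0 t01.
have dA : is_derive t 1 A (2 * t - 2 * c).
  have := is_deriveD (is_deriveB (is_derive_cst (1 : R) t 1)
    (is_deriveZ (2 * c) (is_derive_id t 1))) (is_derive_pow 1 t).
  have -> : cst 1 - (2 * c) *: id + (fun x => x ^+ 2) = A.
    apply/funext => x; rewrite /A.
    by change (1 - (2 * c) * x + x ^+ 2 = 1 - 2 * x * c + x ^+ 2); ring.
  by move=> /is_derive_eq; apply; rewrite /GRing.scale/= expr1; ring.
have dl : is_derive t 1 (@ln R \o A) ((A t)^-1 * (2 * t - 2 * c)).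
  exact: (@is_derive1_comp _ _ _ _ _ _ (is_derive1_ln A0) dA).
have := is_deriveD (is_deriveZ (2^-1) dl) (is_derive_P N t).
have -> : 2^-1 *: (@ln R \o A) + P N = G N.
  by apply/funext => x; rewrite /G.
move=> /is_derive_eq; apply; rewrite /GRing.scale/=.
apply: (mulfI (lt0r_neq0 A0)); rewrite mulrDr geoP.
by field; rewrite lt0r_neq0.
Qed.

Let K := 16 / (1 - c).

Let dG_le N (t : R) : 0 <= t <= 1 ->
  `|(- t ^+ N * cos (N.+1%:R * th) + t ^+ N.+1 * cos (N%:R * th)) / A t| <= K * t ^+ N.
Proof.
move=> t01; have A0 := A_gt0 t01; have Ag := A_ge t01.
move: (t01) => /andP[t0 t1].
have c1 : 0 < 1 - c by rewrite subr_gt0; exact: cth.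
have tN : 0 <= t ^+ N by rewrite exprn_ge0.
rewrite normrM normfV (gtr0_norm A0) ler_pdivrMr//.
apply: (@le_trans _ _ (2 * t ^+ N)).
  have := cos_le1 (N.+1%:R * th); have := cos_geN1 (N.+1%:R * th).
  have := cos_le1 (N%:R * th); have := cos_geN1 (N%:R * th).
  rewrite exprS; set a := cos _; set b := cos _ => *.
  have tt : t * t ^+ N <= t ^+ N by rewrite ler_piMl.
  have tt0 : 0 <= t * t ^+ N by rewrite mulr_ge0.
  rewrite ler_norml; apply/andP; split; nra.
rewrite -mulrA [t ^+ N * _]mulrC mulrA ler_wpM2r//.
rewrite /K -[leLHS](_ : 16 / (1 - c) * ((1 - c) / 8) = 2).
  by rewrite ler_wpM2l// divr_ge0// ltW.
by field; rewrite lt0r_neq0.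
Qed.

Lemma log_series_le N :
  `|2^-1 * ln (2 - 2 * cos th) + \sum_(1 <= n < N.+1) cos (n%:R * th) / n%:R|
   <= 16 / (1 - cos th) / N.+1%:R.
Proof.
(* Comparison of antiderivatives instead of an integral: K t^(N+1) / (N+1) - s G vanishes at 0 and
   has nonnegative derivative. The signs s = 1 and s = -1 give the two halves of the absolute
   value. *)
have sg (s : R) : s ^+ 2 = 1 -> s * G N 1 <= K / N.+1%:R.
  move=> s1.
  pose H (t : R) : R := (K / N.+1%:R) *: t ^+ N.+1 - s *: G N t.
  pose dH t := K * t ^+ N - s * ((- t ^+ N * cos (N.+1%:R * th) + t ^+ N.+1 * cos (N%:R * th)) / A t).
  have dHP (t : R) : 0 <= t <= 1 -> is_derive t 1 H (dH t).
    move=> t01; rewrite /H /dH.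
    have -> : K * t ^+ N = (K / N.+1%:R) *: (N.+1%:R * t ^+ N).
      by rewrite /GRing.scale/=; field; rewrite ?natr1 ?nat1r pnatr_eq0.
    apply: is_deriveB.
      apply: is_deriveZ.
      exact: is_derive_pow.
    exact: (is_deriveZ s (is_derive_G N t01)).
  have dH01 (t : R) : t \in `]0, 1[ -> is_derive t 1 H (dH t).
    rewrite in_itv/= => /andP[t0 t1]; apply: dHP.
    by apply/andP; split; exact: ltW.
  have cH : {within `[(0 : R), 1], continuous H}.
    apply: (@derivable_within_continuous R R^o H) => t; rewrite in_itv/= => t01.
    by have [] := dHP _ t01.
  have [t t01] := @MVT_segment R H dH 0 1 ler01 dH01 cH.
  rewrite subr0 mulr1 => e; move: t01; rewrite in_itv/= => t01.
  have : 0 <= dH t.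
    rewrite /dH subr_ge0; apply: le_trans (dG_le N t01).
    apply: le_trans (ler_norm _) _; rewrite normrM.
    have -> : `|s| = 1.
      by apply/eqP; rewrite -(@eqrXn2 _ 2)// -normrX s1 normr1 expr1n.
    by rewrite mul1r.
  rewrite -e /H /GRing.scale/= expr1n expr0n/= mulr0 mulr1.
  have -> : G N 0 = 0.
    rewrite /G /A /P; rewrite !(mulr0, mul0r) expr0n/= subr0 addr0 ln1 mulr0 add0r.
    rewrite big_nat big1// => n /andP[n0 _].
    by rewrite expr0n (gtn_eqF n0) !mul0r.
  by rewrite mulr0 subrr subr0 subr_ge0.
have e : G N 1 = 2^-1 * ln (2 - 2 * cos th) + \sum_(1 <= n < N.+1) cos (n%:R * th) / n%:R.
  rewrite /G /A /P mulr1 expr1n; congr (_ * ln _ + _); first by rewrite /c; ring.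
  by apply: eq_bigr => n _; rewrite expr1n mul1r.
rewrite -e ler_norml; apply/andP; split.
  by have := sg (-1) (etrans (sqrrN 1) (expr1n _ _)); rewrite mulN1r lerNl.
by have := sg 1 (expr1n _ _); rewrite mul1r.
Qed.

End LogSeries.

Lemma modn_mul_inj (q a : nat) : coprime a q ->
  {in [pred n | (n < q)%N] &, injective (fun n => a * n %% q)%N}.
Proof.
move=> co x y; rewrite !inE => xq yq /eqP.
wlog le : x y xq yq / (x <= y)%N.
  by move=> h e; case/orP: (leq_total x y) => ?; [|apply: esym]; apply: h => //; rewrite eq_sym.
rewrite eq_sym eqn_mod_dvd ?leq_mul// -mulnBr Gauss_dvdr; last by rewrite coprime_sym.
move=> d; have [e|p] := posnP (y - x)%N; first by lia.
by have := dvdn_leq p d; lia.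
Qed.

Lemma sum_residues_mul (V : zmodType) (q a : nat) (F : nat -> V) :
  (0 < q)%N -> coprime a q ->
  \sum_(0 <= n < q) F (a * n %% q)%N = \sum_(0 <= n < q) F n.
Proof.
move=> q0 co; rewrite !big_mkord.
pose h (i : 'I_q) : 'I_q := Ordinal (ltn_pmod (a * i) q0).
have hi : injective h.
  move=> i j [] e; apply: val_inj; apply: (modn_mul_inj co _ _ e); rewrite inE; exact: ltn_ord.
by rewrite [RHS](reindex_inj hi).
Qed.

(** * Summation by parts *)

Section Abel.
Local Open Scope complex_scope.
Variable R : realType.

Lemma summation_by_parts (a : nat -> R[i]) (w : nat -> R) (m k : nat) : (m <= k)%N ->
  \sum_(m <= n < k.+1) a n * (w n)%:C =
  (\sum_(m <= n < k.+1) a n) * (w k)%:C +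
  \sum_(m <= n < k) (\sum_(m <= i < n.+1) a i) * (w n - w n.+1)%:C.
Proof.
move=> mk; rewrite -(subnKC mk); elim: (k - m)%N => [|d IH].
  by rewrite addn0 !big_nat1 big_geq// addr0.
have md : (m <= m + d)%N by rewrite leq_addr.
rewrite addnS big_nat_recr//=; last by rewrite leqW.
rewrite IH [X in _ = X * _ + _]big_nat_recr//=; last by rewrite leqW.
rewrite [X in _ = _ + X]big_nat_recr//= rmorphB/=.
by ring.
Qed.

Lemma abel_bound (a : nat -> R[i]) (w : nat -> R) (B : R) (m k : nat) :
  (forall k, (m <= k)%N -> cabs (\sum_(m <= n < k) a n) <= B) ->
  (forall n, (m <= n)%N -> w n.+1 <= w n) -> (forall n, (m <= n)%N -> 0 <= w n) ->
  cabs (\sum_(m <= n < k) a n * (w n)%:C) <= B * w m.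
Proof.
move=> aB wd w0; have B0 : 0 <= B.
  by have := aB m (leqnn m); rewrite big_geq// cabs0.
have [km|mk] := leqP k m.
  by rewrite big_geq// cabs0 mulr_ge0// w0.
case: k mk => // k; rewrite ltnS => mk.
rewrite summation_by_parts//; apply: le_trans (cabsD _ _) _.
have -> : B * w m = B * w k + \sum_(m <= n < k) B * (w n - w n.+1).
  rewrite -mulr_sumr -mulrDr; congr (_ * _).
  under eq_bigr do rewrite -opprB.
  by rewrite sumrN telescope_sumr//; ring.
apply: lerD.
  by rewrite cabsM cabs_real ger0_norm ?w0// ler_wpM2r ?w0// aB// leqW.
apply: le_trans (cabs_sum _ _ _) _.
rewrite big_nat [leRHS]big_nat; apply: ler_sum => n /andP[mn nk].
rewrite cabsM cabs_real ger0_norm ?subr_ge0 ?wd// ler_wpM2r ?subr_ge0 ?wd//.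
by rewrite aB// leqW.
Qed.

(** Stands in for a passage to the limit: an error K / N is discarded without naming the limit of
    the sequence. *)
Lemma le_add_inv_nat (a b K : R) (X : nat) :
  (forall N, (X <= N)%N -> a <= b + K / N.+1%:R) -> a <= b.
Proof.
move=> h; rewrite leNgt; apply/negP => ba.
have d0 : 0 < a - b by rewrite subr_gt0.
pose N := maxn X (Num.truncn (`|K| / (a - b))).+1.
have := h N (leq_maxl _ _).
have N0 : 0 < N.+1%:R :> R by rewrite ltr0n.
have : `|K| / (a - b) < N.+1%:R.
  apply: lt_le_trans (truncnS_gt _) _; rewrite ler_nat.
  exact: leq_trans (leq_maxr X _) (leqnSn _).
rewrite ltr_pdivrMr// => h1 h2.
have : a - b <= K / N.+1%:R by rewrite lerBlDl.
rewrite ler_pdivlMr// => h3; move: h1; rewrite mulrC => h1.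
by have := lt_le_trans h1 h3; rewrite ltNge ler_norm.
Qed.

End Abel.

(** * Dirichlet characters and their incomplete sums *)

Section DirichletCharacters.
Local Open Scope complex_scope.
Variables (R : realType) (q : nat) (chi : nat -> R[i]).
Hypothesis chiP : dirichlet_char q chi.

Let q0 : (0 < q)%N. Proof. by case: chiP. Qed.

Lemma chiM a b : chi (a * b)%N = chi a * chi b.
Proof. by case: chiP. Qed.

Lemma chi_ncoprime n : ~~ coprime n q -> chi n = 0.
Proof.
move=> nc; case: chiP => _ _ _ /(_ n)[h _].
by apply/eqP; apply: contraNT nc.
Qed.

Lemma chi_neq0 n : coprime n q -> chi n != 0.
Proof. by case: chiP => _ _ _ /(_ n)[]. Qed.

Lemma chi1 : chi 1%N = 1.
Proof.
have c1 := chi_neq0 (coprime1n q).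
by apply: (mulfI c1); rewrite -chiM mulr1.
Qed.

Lemma chi_modn n : chi (n %% q)%N = chi n.
Proof.
rewrite [in RHS](divn_eq n q) addnC; elim: (n %/ q)%N => [|k IH].
  by rewrite mul0n addn0.
by rewrite mulSnr addnA; case: chiP => _ _ -> _.
Qed.

Lemma chiX n k : chi (n ^ k)%N = chi n ^+ k.
Proof. by elim: k => [|k IH]; rewrite ?expn0 ?chi1// expnS chiM IH exprS. Qed.

Lemma cabs_chi n : coprime n q -> cabs (chi n) = 1.
Proof.
move=> co; have t0 : (0 < totient q)%N by rewrite totient_gt0.
apply/eqP; rewrite -(pexpr_eq1 t0) ?cabs_ge0// -cabsX -chiX -chi_modn.
by rewrite Euler_exp_totient// chi_modn chi1 cabs1.
Qed.

Lemma cabs_chi_le1 n : cabs (chi n) <= 1.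
Proof.
have [/cabs_chi->//|/chi_ncoprime->] := boolP (coprime n q).
by rewrite cabs0.
Qed.

Lemma chi_mul_conj n : coprime n q -> chi n * (chi n)^* = 1.
Proof. by move=> /cabs_chi c; rewrite -sqr_cabs c expr1n. Qed.

Hypothesis chiN : ~ principal_char q chi.

Lemma sum_chi_period : \sum_(0 <= n < q) chi n = 0.
Proof.
have [a [co ca]] : exists a, coprime a q /\ chi a != 1.
  apply: contrapT => h; apply: chiN => n co; apply: contrapT => /eqP nz.
  by apply: h; exists n.
have e : \sum_(0 <= n < q) chi n = chi a * \sum_(0 <= n < q) chi n.
  rewrite -[LHS](sum_residues_mul chi q0 co) mulr_sumr.
  by apply: eq_bigr => n _; rewrite chi_modn chiM.
have : (1 - chi a) * \sum_(0 <= n < q) chi n = 0 by rewrite mulrBl mul1r -e subrr.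
by move/eqP; rewrite mulf_eq0 subr_eq0 eq_sym (negbTE ca) => /eqP.
Qed.

Lemma sum_chi_shift m : \sum_(m <= n < m + q) chi n = 0.
Proof.
elim: m => [|m IH]; first by rewrite add0n sum_chi_period.
have : \sum_(m <= n < (m + q).+1) chi n = chi (m + q)%N.
  by rewrite big_nat_recr/= ?IH ?add0r// leq_addr.
rewrite big_nat_recl ?leq_addr// addSn big_add1/= => h.
have e : chi (m + q)%N = chi m by case: chiP.
by move: h; rewrite e -[RHS]addr0 => /addrI.
Qed.

(** Full periods cancel and what remains has at most q terms. This trivial bound suffices because
    the sums it is applied to can be taken as long as a power of q. *)
Lemma sum_chi_le m k : cabs (\sum_(m <= n < k) chi n) <= q%:R.
Proof.
have [d] := ubnP (k - m)%N; elim: d m => // d IH m; rewrite ltnS => le.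
have [mk|km] := leqP (m + q) k.
  rewrite (@big_cat_nat _ _ _ (m + q))//= ?leq_addr// sum_chi_shift add0r.
  by apply: IH; lia.
apply: le_trans (cabs_sum _ _ _) _.
apply: (@le_trans _ _ (\sum_(m <= n < k) 1)).
  by apply: ler_sum => n _; exact: cabs_chi_le1.
by rewrite sumr_const_nat ler_nat; lia.
Qed.

Lemma chi_tail (w : nat -> R) m k :
  (forall n, (m <= n)%N -> w n.+1 <= w n) -> (forall n, (m <= n)%N -> 0 <= w n) ->
  cabs (\sum_(m <= n < k) chi n * (w n)%:C) <= q%:R * w m.
Proof. by move=> *; apply: abel_bound => // ? _; exact: sum_chi_le. Qed.

End DirichletCharacters.

(** * Gauss sums and the link between logarithmic sums and L(1, chi) *)

Section GaussSum.
Local Open Scope complex_scope.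
Variables (R : realType) (q : nat) (chi : nat -> R[i]).
Hypotheses (q_prime : prime q) (chiP : dirichlet_char q chi).
Hypothesis chiN : ~ principal_char q chi.

Let q0 : (0 < q)%N. Proof. exact: prime_gt0. Qed.
Notation z := (zetaq R q).

Definition gauss_sum := \sum_(0 <= k < q) chi k * z ^+ k.

Let T n := \sum_(0 <= k < q) chi k * z ^+ (k * n).

Let TE n : T n = (chi n)^* * gauss_sum.
Proof.
have [co|nc] := boolP (coprime n q).
  have -> : gauss_sum = chi n * T n.
    rewrite /gauss_sum -(sum_residues_mul (fun k => chi k * z ^+ k) q0 co) mulr_sumr.
    apply: eq_bigr => k _.
    by rewrite (chi_modn chiP) -zetaqX_modn// (chiM chiP) mulrA mulnC.
  by rewrite mulrA [_^* * _]mulrC (chi_mul_conj chiP co) mul1r.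
rewrite (chi_ncoprime chiP nc) conjc0 mul0r.
have dn : (q %| n)%N by move: nc; rewrite coprime_sym prime_coprime// negbK.
rewrite -(sum_chi_period chiP chiN); apply: eq_bigr => k _.
have /eqP -> : z ^+ (k * n) == 1 by rewrite zetaqX_eq1// dvdn_mull.
by rewrite mulr1.
Qed.

Lemma sum_chi_zetaq n :
  \sum_(0 <= k < q) chi k * z ^+ (k * n) = (chi n)^* * gauss_sum.
Proof. exact: TE. Qed.

(** Parseval mod q: the sum of |T n|^2 equals V |gauss_sum|^2 by [TE], and q V by orthogonality of
    the additive characters. Since V cancels, it only has to be nonzero. *)
Lemma cabs_gauss_sum : cabs gauss_sum ^+ 2 = q%:R.
Proof.
pose V : R := \sum_(0 <= k < q) cabs (chi k) ^+ 2.
have V0 : V != 0.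
  rewrite gt_eqF// /V (@big_cat_nat _ _ _ 1)//= (@big_cat_nat _ _ _ 2 1)//=; last exact: prime_gt1.
  rewrite !big_nat1 (chi1 chiP) cabs1 expr1n.
  have h m k : 0 <= \sum_(m <= i < k) cabs (chi i) ^+ 2.
    by apply: sumr_ge0 => i _; rewrite sqr_ge0.
  by have := h 2%N q; have := sqr_ge0 (cabs (chi 0%N)); lra.
apply: (mulfI V0); apply: (@complexI R).
have -> : (V * cabs gauss_sum ^+ 2)%:C = \sum_(0 <= n < q) T n * (T n)^*.
  rewrite rmorphM /= /V rmorph_sum/= mulr_suml; apply: eq_bigr => n _.
  by rewrite TE !sqr_cabs conjM conjcK; ring.
transitivity (\sum_(0 <= n < q) \sum_(0 <= k < q) \sum_(0 <= l < q)
   (chi k * (chi l)^*) * z ^+ ((k + (q - l)) * n)).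
  apply: eq_bigr => n _; rewrite /T conj_sum mulr_suml; apply: eq_bigr => k _.
  rewrite mulr_sumr; apply: eq_big_nat => l /andP[_ lq].
  rewrite conjM rmorphXn/=.
  have -> : (z^*) ^+ (l * n) = z ^+ ((q - l) * n).
    by rewrite exprM -rmorphXn/= zetaq_conjX ?(ltnW lq)// exprM.
  by rewrite mulnDl exprD; ring.
rewrite exchange_big_nat/= /V mulr_suml rmorph_sum/=.
apply: eq_big_nat => k /andP[_ kq].
rewrite exchange_big_nat/=.
rewrite (bigD1_seq k)/= ?mem_index_iota ?kq ?iota_uniq//.
rewrite -mulr_sumr sum_zetaqX// subnKC ?(ltnW kq)// dvdnn.
rewrite big1_seq ?addr0 => [|l /andP[lk]].
  by rewrite [RHS]rmorphM/= sqr_cabs rmorph_nat.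
rewrite mem_index_iota /= => lq.
rewrite -mulr_sumr sum_zetaqX// ifF ?mulr0//.
apply/negbTE/negP => /dvdnP[c e].
have : c = 1%N by nia.
by move=> c1; move: lk; rewrite eqE/= => /eqP; lia.
Qed.

Lemma cabs_gauss_sumE : cabs gauss_sum = Num.sqrt q%:R.
Proof. by rewrite -cabs_gauss_sum sqrtr_sqr ger0_norm ?cabs_ge0. Qed.

Hypothesis chi_even : forall k, (k <= q)%N -> chi (q - k)%N = chi k.

Let chi0 : chi 0%N = 0.
Proof.
apply: (chi_ncoprime chiP); rewrite /coprime gcd0n; apply/eqP => h.
by move: q_prime; rewrite h.
Qed.

(** For even [chi] the reflection k -> q - k conjugates the exponential, so the sine part drops out
    of the Gauss sum. *)
Lemma sum_chi_cos n :
  \sum_(1 <= k < q) chi k * (cos (n%:R * (k%:R * (2 * pi / q%:R))))%:C =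
  (chi n)^* * gauss_sum.
Proof.
have sh (F : nat -> R[i]) : \sum_(1 <= k < q) chi k * F k = \sum_(0 <= k < q) chi k * F k.
  by rewrite [RHS]big_ltn// chi0 mul0r add0r.
have e1 : \sum_(1 <= k < q) chi k * z ^+ (k * n) = (chi n)^* * gauss_sum.
  by rewrite sh sum_chi_zetaq.
have e2 : \sum_(1 <= k < q) chi k * (z ^+ (k * n))^* = (chi n)^* * gauss_sum.
  rewrite -e1 [RHS]big_nat_rev/=; apply: eq_big_nat => k /andP[k0 kq].
  rewrite add1n subSS chi_even ?(ltnW kq)//; congr (_ * _).
  by rewrite exprM rmorphXn/= zetaq_conjX ?(ltnW kq)// exprM.
have -> : (chi n)^* * gauss_sum = 2^-1 * ((chi n)^* * gauss_sum + (chi n)^* * gauss_sum).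
  by field.
rewrite -{1}e1 -e2 -big_split/= mulr_sumr; apply: eq_bigr => k _.
have e : z ^+ (k * n) + (z ^+ (k * n))^* = 2 * (cos (n%:R * (k%:R * (2 * pi / q%:R))))%:C.
  rewrite zetaqX addcJ natrM; congr (2 * (cos _)%:C).
  by ring.
by rewrite -mulrDr e; field.
Qed.

(* Twice the sum over the representatives of [(Z/q)^* / {+-1}] when [chi] is even. *)
Definition log_sum := \sum_(1 <= k < q) chi k * (ln (cabs (z ^+ k - 1)))%:C.

(** Exchanging the sum over k with the cosine series turns each frequency n into a Gauss sum. The
    constant depends on q, which is harmless since N will go to infinity with q fixed. *)
Lemma log_sum_approx : exists K : R, forall N,
  cabs (log_sum + gauss_sum * (\sum_(1 <= n < N.+1) chi n * (n%:R^-1)%:C)^*) <= K / N.+1%:R.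
Proof.
pose th k : R := k%:R * (2 * pi / q%:R).
exists (\sum_(1 <= k < q) 16 / (1 - cos (th k))) => N.
have -> : log_sum + gauss_sum * (\sum_(1 <= n < N.+1) chi n * (n%:R^-1)%:C)^* =
  \sum_(1 <= k < q) chi k *
    (2^-1 * ln (2 - 2 * cos (th k)) + \sum_(1 <= n < N.+1) cos (n%:R * th k) / n%:R)%:C.
  rewrite /log_sum; under [RHS]eq_bigr do rewrite rmorphD/= mulrDr rmorph_sum/= mulr_sumr.
  rewrite big_split/=; congr (_ + _).
    apply: eq_big_nat => k /andP[k0 kq]; congr (_ * _%:C).
    have c1 : cos (th k) < 1 by apply: cos_zetaq_lt1; rewrite k0.
    rewrite -cabs_zetaqX_sub1 lnXn; first by field.
    by rewrite lt_def cabs_ge0 andbT -sqrf_eq0 cabs_zetaqX_sub1 gt_eqF//; move: c1; rewrite /th; lra.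
  rewrite exchange_big_nat/= conj_sum mulr_sumr; apply: eq_bigr => n _.
  under eq_bigr do rewrite rmorphM/= mulrA.
  by rewrite -mulr_suml sum_chi_cos conjM conjc_real; ring.
apply: le_trans (cabs_sum _ _ _) _; rewrite mulr_suml big_nat [leRHS]big_nat.
apply: ler_sum => k /andP[k0 kq]; rewrite cabsM cabs_real.
have c1 : cos (th k) < 1 by apply: cos_zetaq_lt1; rewrite k0.
apply: le_trans (log_series_le c1 N).
by rewrite ler_piMl ?(cabs_chi_le1 chiP).
Qed.

(** Finite form of |log_sum| = sqrt(q) |L(1, chi)|. A longer partial sum, up to N >= X, is the
    intermediary: the constant of [log_sum_approx] disappears as N grows, and the error left is the
    character tail beyond X. *)
Lemma log_sum_cabs_approx X :
  `|cabs (\sum_(1 <= n < X.+1) chi n * (n%:R^-1)%:C) - cabs log_sum / Num.sqrt q%:R|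
   <= q%:R / X.+1%:R.
Proof.
have [K HK] := log_sum_approx.
have s0 : 0 < Num.sqrt q%:R :> R by rewrite sqrtr_gt0 ltr0n.
apply: (@le_add_inv_nat _ _ _ (K / Num.sqrt q%:R) X) => N XN.
pose S N := \sum_(1 <= n < N.+1) chi n * (n%:R^-1)%:C.
rewrite -/(S X).
have h1 : `|cabs (S X) - cabs (S N)| <= q%:R / X.+1%:R.
  apply: le_trans (cabs_dist _ _) _; rewrite cabsB /S.
  rewrite (@big_cat_nat _ _ _ X.+1)//= addrAC subrr add0r.
  apply: (chi_tail chiP chiN (w := fun n => n%:R^-1)) => n nX.
    have n0 : (0 < n)%N by apply: leq_trans nX.
    by rewrite lef_pV2 ?posrE ?ltr0n// ler_nat.
  by rewrite invr_ge0.
have h2 : `|cabs (S N) - cabs log_sum / Num.sqrt q%:R| <= K / Num.sqrt q%:R / N.+1%:R.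
  have -> : K / Num.sqrt q%:R / N.+1%:R = (K / N.+1%:R) / Num.sqrt q%:R by rewrite mulrAC.
  rewrite ler_pdivlMr//.
  have -> : `|cabs (S N) - cabs log_sum / Num.sqrt q%:R| * Num.sqrt q%:R =
      `|cabs (S N) * Num.sqrt q%:R - cabs log_sum|.
    by rewrite -[X in _ * X = _](gtr0_norm s0) -normrM mulrBl divfK ?gt_eqF.
  apply: le_trans (HK N); rewrite -/(S N).
  have -> : cabs (S N) * Num.sqrt q%:R = cabs (- (gauss_sum * (S N)^*)).
    by rewrite cabsN cabsM cabs_conj cabs_gauss_sumE mulrC.
  by rewrite distrC; apply: le_trans (cabs_dist _ _) _; rewrite opprK.
have -> : cabs (S X) - cabs log_sum / Num.sqrt q%:R =
  (cabs (S X) - cabs (S N)) + (cabs (S N) - cabs log_sum / Num.sqrt q%:R) by ring.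
exact: le_trans (ler_normD _ _) (lerD h1 h2).
Qed.

End GaussSum.

(** Cyclicity of the units of F_q, expressed by congruences between natural numbers. The last clause
    provides a primitive root, which tells the characters built from [dl] apart from the principal
    one. *)
Lemma discrete_log (q : nat) : prime q -> exists dl : nat -> nat,
  [/\ forall m n, coprime m q -> coprime n q -> dl (m * n)%N = dl m + dl n %[mod q.-1],
      forall m n, coprime m q -> coprime n q ->
        (m == n %[mod q])%N = (dl m == dl n %[mod q.-1])
    & exists n, coprime n q /\ dl n = 1 %[mod q.-1]].
Proof.
move=> q_prime; pose U := {unit 'F_q}.
have /cyclicP[g gE] := field_unit_group_cyclic [set: U]%G.
have og : #[g]%g = q.-1 by rewrite orderE -gE card_finField_unit card_Fp.
have mo a b : ((g ^+ a)%g == (g ^+ b)%g) = (a == b %[mod q.-1]).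
  by rewrite -og; exact: eq_expg_mod_order.
have [cl clP] : exists cl : nat -> U, forall n, coprime n q -> val (cl n) = n%:R.
  exists (fun n => insubd (1%g : U) (n%:R : 'F_q)) => n co; apply: insubdK.
  by rewrite -[_ \in _]/(_ \is a GRing.unit) unitFpE// coprime_sym.
have [dl dlP] : exists dl : nat -> nat, forall n, cl n = (g ^+ dl n)%g.
  have h n : exists k, cl n == (g ^+ k)%g.
    have : cl n \in <[g]>%g by rewrite -gE inE.
    by move/cycleP => [k ->]; exists k.
  by exists (fun n => xchoose (h n)) => n; exact/eqP/(xchooseP (h n)).
have clM m n : coprime m q -> coprime n q -> cl (m * n)%N = (cl m * cl n)%g.
  move=> cm cn; apply: val_inj; rewrite clP ?coprimeMl ?cm//.
  by rewrite FinRing.val_unitM !clP// natrM.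
exists dl; split.
- move=> m n cm cn; apply/eqP; rewrite -mo expgD -!dlP; exact/eqP/clM.
- move=> m n cm cn; rewrite -mo -!dlP; apply/eqP/eqP => [e|e].
    by apply: val_inj; rewrite !clP// -(Fp_nat_mod q_prime m) e Fp_nat_mod.
  have := congr1 val e; rewrite !clP// => /(congr1 (@nat_of_ord _)).
  by rewrite !val_Fp_nat.
- have nE : (val (val g) : nat)%:R = val g :> 'F_q by exact: natr_Zp.
  have cn : coprime (val (val g)) q.
    by rewrite coprime_sym -unitFpE// nE; exact: (valP g).
  exists (val (val g)); split => //; apply/eqP; rewrite -mo -dlP expg1.
  by apply/eqP/val_inj; rewrite clP.
Qed.

(** * The even characters of a prime modulus *)

Section EvenCharacters.
Local Open Scope complex_scope.
Variables (R : realType) (q : nat).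
Hypotheses (q_prime : prime q) (q_gt2 : (2 < q)%N).

Let q_odd : odd q. Proof. by case: (even_prime q_prime) q_gt2 => [->|]. Qed.
Let h := q./2.
Let q_half : q = (2 * h + 1)%N.
Proof. by have := odd_double_half q; rewrite q_odd /h -mul2n addnC. Qed.
Let h_gt0 : (0 < h)%N. Proof. by move: q_gt2; rewrite q_half; lia. Qed.
Let q1E : q.-1 = (2 * h)%N. Proof. by rewrite [in LHS]q_half addn1. Qed.

Variable dl : nat -> nat.
Hypothesis dlM : forall m n, coprime m q -> coprime n q ->
  dl (m * n)%N = dl m + dl n %[mod q.-1].
Hypothesis dl_eq : forall m n, coprime m q -> coprime n q ->
  (m == n %[mod q])%N = (dl m == dl n %[mod q.-1]).
Hypothesis dl_gen : exists n, coprime n q /\ dl n = 1 %[mod q.-1].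

Let z := zetaq R h.

Let zX_eq a b : a = b %[mod q.-1] -> z ^+ a = z ^+ b.
Proof.
move=> e; rewrite /z (zetaqX_modn R a h_gt0) (zetaqX_modn R b h_gt0).
have d : (h %| q.-1)%N by rewrite q1E dvdn_mull.
by rewrite -(modn_dvdm a d) -(modn_dvdm b d) e.
Qed.

(** Taking a root of unity of order h = (q - 1) / 2, instead of q - 1, singles out the even
    characters. *)
Let chi (b n : nat) : R[i] := if coprime n q then z ^+ (b * dl n) else 0.

Let chiP b : dirichlet_char q (chi b).
Proof.
split.
- exact: prime_gt0.
- move=> m n; rewrite /chi coprimeMl.
  have [cm|_] := boolP (coprime m q); last by rewrite mul0r.
  have [cn|_] := boolP (coprime n q); last by rewrite mulr0.
  rewrite /= -exprD -mulnDr; apply: zX_eq.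
  by rewrite -[LHS]modnMmr dlM// modnMmr.
- move=> n; rewrite /chi.
  have -> : coprime (n + q) q = coprime n q by rewrite -coprime_modl modnDr coprime_modl.
  case: ifP => // cn; apply: zX_eq.
  have e : dl (n + q)%N = dl n %[mod q.-1].
    apply/eqP; rewrite -dl_eq ?modnDr//.
    by rewrite -coprime_modl modnDr coprime_modl.
  by rewrite -modnMmr e modnMmr.
- move=> n; rewrite /chi; case: ifP => cn; last by rewrite eqxx; split.
  by rewrite -cabs_eq0 /z cabs_zetaqX oner_eq0; split.
Qed.

Let co_q1 : coprime q.-1 q.
Proof. by rewrite coprime_sym coprimenP// ltnW// ltnW. Qed.

(** As (q - 1)^2 = 1 mod q, twice the discrete logarithm of q - 1 is divisible by 2 h, hence the
    logarithm itself by h. *)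
Let chi_m1 b : chi b q.-1 = 1.
Proof.
rewrite /chi co_q1; apply/eqP; rewrite /z zetaqX_eq1// dvdn_mull//.
have : (q.-1 * q.-1 = 1 * 1 %[mod q])%N.
  have -> : (q.-1 * q.-1 = q.-2 * q + 1)%N by move: q_gt2; case: (q) => [//|[//|k]] _ /=; nia.
  by rewrite modnMDl.
move=> /eqP; rewrite dl_eq ?coprimeMl ?co_q1 ?coprime1n//.
have -> : (dl (q.-1 * q.-1)%N = dl q.-1 + dl q.-1 %[mod q.-1])%N by exact: dlM.
have d1 : dl 1%N = 0 %[mod q.-1].
  have := dlM (coprime1n q) (coprime1n q); rewrite muln1 => /eqP.
  by rewrite -[X in X == _ %[mod _]]addn0 eqn_modDl => /eqP.
rewrite muln1 d1 mod0n addnn -mul2n q1E.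
by rewrite -[_ == 0%N]/(2 * h %| _)%N dvdn_pmul2l.
Qed.

Let chi_even b k : (k <= q)%N -> chi b (q - k)%N = chi b k.
Proof.
move=> kq.
have cq (j : nat) : chi b (j * q)%N = chi b 0%N.
  elim: j => [//|j <-]; rewrite mulSnr; by case: (chiP b).
have sh (m j : nat) : chi b (m + j * q)%N = chi b m.
  elim: j => [|j <-]; first by rewrite addn0.
  by rewrite mulSnr addnA; case: (chiP b).
have -> : chi b k = chi b (q.-1 * k)%N.
  by case: (chiP b) => _ -> _ _; rewrite chi_m1 mul1r.
case: k kq => [|k] kq; first by rewrite subn0 muln0 -[q]mul1n cq.
rewrite -(sh (q - k.+1)%N k); congr (chi b _).
by move: kq; case: (q) => [//|m] /=; nia.
Qed.

Let chi0 n : coprime n q -> chi 0 n = 1.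
Proof. by rewrite /chi => ->; rewrite mul0n expr0. Qed.

Let chi_nonprincipal b : (0 < b < h)%N -> ~ principal_char q (chi b).
Proof.
move=> /andP[b0 bh] P; have [n [cn d1]] := dl_gen.
move: (P n cn); rewrite /chi cn => /eqP; rewrite /z zetaqX_eq1//.
have hh : (h %| q.-1)%N by rewrite q1E dvdn_mull.
have -> : (h %| b * dl n)%N = (h %| b)%N.
  by rewrite /dvdn -modnMmr -(modn_dvdm (dl n) hh) d1 modn_dvdm// modnMmr muln1.
by rewrite gtnNdvd.
Qed.

(** If the sum did not vanish, [dl m] and [dl n] would agree mod h, so m^2 = n^2 mod q and m = n or
    m = -n mod q. The number [r] is the difference of the logarithms mod h, kept nonnegative. *)
Let chi_orth m n : coprime m q -> coprime n q ->
  (m != n %[mod q])%N -> ~~ (q %| m + n)%N ->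
  \sum_(0 <= b < h) chi b m * (chi b n)^* = 0.
Proof.
move=> cm cn ne nd.
pose r := (dl m + (h - dl n %% h))%N.
have e b : chi b m * (chi b n)^* = z ^+ (r * b).
  rewrite /chi cm cn /r mulnDl exprD mulnC; congr (_ * _).
  have -> : z ^+ (b * dl n) = (z ^+ (dl n %% h)) ^+ b.
    by rewrite -zetaqX_modn// -exprM mulnC.
  by rewrite rmorphXn/= /z zetaq_conjX// ?exprM// ltnW// ltn_mod.
under eq_bigr do rewrite e.
rewrite /z sum_zetaqX//; case: ifPn => // hr; exfalso.
have dmn : (2 * dl m = 2 * dl n %[mod q.-1])%N.
  have lt : (dl n %% h < h)%N by rewrite ltn_mod.
  have : (dl m = dl n %[mod h])%N.
    have : (dl m + (h - dl n %% h) = 0 %[mod h])%N.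
      by apply/eqP; rewrite mod0n.
    move=> /(congr1 (fun x => (x + dl n %% h) %% h)%N).
    by rewrite !modnDml add0n modn_mod -addnA subnK ?(ltnW lt)// modnDr.
  by rewrite q1E -!muln_modr => ->.
have : (m * m == n * n %[mod q])%N.
  rewrite dl_eq ?coprimeMl ?cm ?cn// !dlM// !addnn -!mul2n; exact/eqP.
wlog le : m n cm cn ne nd {r e hr dmn} / (n <= m)%N.
  move=> W E; case/orP: (leq_total m n) => l.
    by apply: (W n m cn cm _ _ l); rewrite 1?eq_sym// addnC.
  exact: (W m n).
rewrite eqn_mod_dvd ?leq_mul//.
have -> : (m * m - n * n = (m - n) * (m + n))%N by nia.
by rewrite Euclid_dvdM// (negbTE nd) orbF -eqn_mod_dvd// (negbTE ne).
Qed.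

Lemma even_characters_of_dlog : exists chi : nat -> nat -> R[i],
  [/\ forall b, dirichlet_char q (chi b),
      forall b k, (k <= q)%N -> chi b (q - k)%N = chi b k,
      forall n, coprime n q -> chi 0 n = 1,
      forall b, (0 < b < q./2)%N -> ~ principal_char q (chi b)
    & forall m n, coprime m q -> coprime n q ->
        (m != n %[mod q])%N -> ~~ (q %| m + n)%N ->
        \sum_(0 <= b < q./2) chi b m * (chi b n)^* = 0].
Proof. by exists chi; split. Qed.

End EvenCharacters.

Lemma even_characters (R : realType) (q : nat) (q_prime : prime q) (q_gt2 : (2 < q)%N) :
  exists chi : nat -> nat -> R[i],
  [/\ forall b, dirichlet_char q (chi b),
      forall b k, (k <= q)%N -> chi b (q - k)%N = chi b k,
      forall n, coprime n q -> chi 0 n = 1,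
      forall b, (0 < b < q./2)%N -> ~ principal_char q (chi b)
    & forall m n, coprime m q -> coprime n q ->
        (m != n %[mod q])%N -> ~~ (q %| m + n)%N ->
        \sum_(0 <= b < q./2) chi b m * (chi b n)^* = 0].
Proof.
have [dl [dlM dl_eq dl_gen]] := discrete_log q_prime.
exact: (even_characters_of_dlog R q_prime q_gt2 dlM dl_eq dl_gen).
Qed.

(** * Sums over divisors and Dirichlet convolution *)

Section DivisorSums.

(** Each step splits off the whole power of the smallest prime factor, the form needed for
    multiplicative functions. *)
Lemma pfactor_ind (P : nat -> Prop) : P 1%N ->
  (forall p k m, prime p -> ~~ (p %| m)%N -> (0 < m)%N -> P m -> P (p ^ k.+1 * m)%N) ->
  forall n, (0 < n)%N -> P n.
Proof.
move=> P1 IH n; have [d] := ubnP n; elim: d n => // d IHd n; rewrite ltnS => nd n0.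
have [->//|n1] := eqVneq n 1%N.
have n2 : (1 < n)%N by lia.
have pp := pdiv_prime n2.
have [m co e] := pfactor_coprime pp n0.
have k0 : (0 < logn (pdiv n) n)%N by rewrite logn_gt0 mem_primes pp n0 pdiv_dvd.
have m0 : (0 < m)%N by move: n0; rewrite [in X in X -> _]e muln_gt0 => /andP[].
rewrite e mulnC -(prednK k0); apply: IH => //.
  by rewrite -prime_coprime.
apply: IHd => //; apply: leq_trans nd; rewrite [X in (_ < X)%N]e.
rewrite ltn_Pmulr// -[X in (X < _)%N](exp1n (logn (pdiv n) n)) ltn_exp2r//.
exact: prime_gt1.
Qed.

Lemma perm_divisors_pfactor (p k m : nat) : prime p -> ~~ (p %| m)%N -> (0 < m)%N ->
  perm_eq (divisors (p ^ k.+1 * m)) (divisors (p ^ k * m) ++ map (muln (p ^ k.+1)) (divisors m)).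
Proof.
move=> pp pm m0; have p0 := prime_gt0 pp.
have pk i : (0 < p ^ i)%N by rewrite expn_gt0 p0.
have pkm i : (0 < p ^ i * m)%N by rewrite muln_gt0 pk.
apply: uniq_perm.
- exact: divisors_uniq.
- rewrite cat_uniq divisors_uniq map_inj_uniq ?divisors_uniq ?andbT/=; last first.
    by move=> x y /eqP; rewrite eqn_pmul2l// => /eqP.
  apply/hasPn => d /mapP[e _ ->] /=; rewrite -dvdn_divisors//.
  apply: contra pm => /(dvdn_trans (dvdn_mulr e (dvdnn _))).
  by rewrite expnSr dvdn_pmul2l.
move=> d; rewrite mem_cat -!dvdn_divisors//; apply/idP/orP.
  move=> dd; have d0 := dvdn_gt0 (pkm k.+1) dd.
  have [e co de] := pfactor_coprime pp d0; set a := logn p d in de.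
  have em : (e %| m)%N.
    have : (e %| p ^ k.+1 * m)%N by apply: dvdn_trans dd; rewrite de dvdn_mulr.
    by rewrite Gauss_dvdr// coprime_sym coprimeXl.
  have ak : (a <= k.+1)%N.
    have : (p ^ a %| p ^ k.+1 * m)%N by apply: dvdn_trans dd; rewrite de dvdn_mull.
    rewrite Gauss_dvdl ?coprimeXl ?prime_coprime//.
    by rewrite dvdn_Pexp2l// prime_gt1.
  have [ak'|ak'] := leqP a k.
    left; rewrite de mulnC dvdn_mul// dvdn_exp2l//.
  right; have e1 : a = k.+1 by lia.
  by apply/mapP; exists e; rewrite -?dvdn_divisors// de e1 mulnC.
move=> [dd|/mapP[e]]; first by apply: dvdn_trans dd _; rewrite expnS -mulnA dvdn_mull.
by rewrite -dvdn_divisors// => em ->; rewrite dvdn_mul.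
Qed.

Lemma sum_divisors_pfactor (V : zmodType) (F : nat -> V) (p k m : nat) :
  prime p -> ~~ (p %| m)%N -> (0 < m)%N ->
  \sum_(d <- divisors (p ^ k * m)) F d =
  \sum_(0 <= i < k.+1) \sum_(d <- divisors m) F (p ^ i * d)%N.
Proof.
move=> pp pm m0; elim: k => [|k IH].
  by rewrite big_nat1 mul1n; apply: eq_bigr => d _; rewrite mul1n.
rewrite (perm_big _ (perm_divisors_pfactor k pp pm m0)) big_cat/= IH.
by rewrite [RHS]big_nat_recr//= big_map.
Qed.

Lemma sum_divisors (V : zmodType) (F : nat -> V) (n : nat) : (0 < n)%N ->
  \sum_(d <- divisors n) F d = \sum_(1 <= d < n.+1 | (d %| n)%N) F d.
Proof.
move=> n0; rewrite -[RHS]big_filter; apply: perm_big; apply: uniq_perm.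
- exact: divisors_uniq.
- by rewrite filter_uniq// iota_uniq.
move=> d; rewrite -dvdn_divisors// mem_filter mem_index_iota ltnS.
apply/idP/andP => [dn|[]//]; split=> //.
by rewrite (dvdn_gt0 n0 dn) dvdn_leq.
Qed.

(** By induction on K: the quotient K / d increases exactly when the new integer is a multiple of
    d. *)
Lemma sum_sum_divisors (V : zmodType) (F : nat -> nat -> V) (K : nat) :
  \sum_(1 <= n < K.+1) \sum_(d <- divisors n) F d (n %/ d)%N =
  \sum_(1 <= d < K.+1) \sum_(1 <= e < (K %/ d).+1) F d e.
Proof.
elim: K => [|K IH]; first by rewrite !big_geq.
rewrite big_nat_recr//= IH sum_divisors// [in RHS]big_nat_recr//= divnn/= big_nat1.
rewrite (_ : \sum_(1 <= d < K.+1) \sum_(1 <= e < (K.+1 %/ d).+1) F d e =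
  \sum_(1 <= d < K.+1) \sum_(1 <= e < (K %/ d).+1) F d e +
  \sum_(1 <= d < K.+1 | (d %| K.+1)%N) F d (K.+1 %/ d)%N); last first.
  rewrite [X in _ = _ + X]big_mkcond -big_split/=; apply: eq_big_nat => d /andP[d0 _].
  rewrite divnS//; case: (d %| K.+1)%N; last by rewrite addr0 add0n.
  by rewrite add1n big_nat_recr.
rewrite -addrA; congr (_ + _).
by rewrite big_mkcond big_nat_recr//= dvdnn divnn -big_mkcond.
Qed.

End DivisorSums.

Section Convolution.
Variable R : comNzRingType.
Implicit Types f g : nat -> R.

Definition dconv f g n := \sum_(d <- divisors n) f d * g (n %/ d)%N.

(** The supports put all relevant pairs (d, e) in the rectangle d <= N, e <= M, which lies below the
    hyperbola d e = N M; hence nothing is cut off. *)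
Lemma sum_dconv f g (h : nat -> R) N M : (forall a b, h (a * b)%N = h a * h b) ->
  (forall n, (N < n)%N -> f n = 0) -> (forall n, (M < n)%N -> g n = 0) ->
  \sum_(1 <= n < (N * M).+1) dconv f g n * h n =
  (\sum_(1 <= n < N.+1) f n * h n) * (\sum_(1 <= n < M.+1) g n * h n).
Proof.
move=> hM fN gM.
have [->|M0] := posnP M.
  by rewrite muln0 big_geq// [X in _ * X]big_geq// mulr0.
transitivity (\sum_(1 <= n < (N * M).+1) \sum_(d <- divisors n)
   (fun d e => (f d * h d) * (g e * h e)) d (n %/ d)%N).
  apply: eq_big_nat => n /andP[n0 _]; rewrite /dconv mulr_suml.
  rewrite big_seq [RHS]big_seq; apply: eq_bigr => d; rewrite -dvdn_divisors// => dn.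
  by rewrite -[in h n](divnK dn) mulnC hM; ring.
rewrite (sum_sum_divisors (fun d e => (f d * h d) * (g e * h e))).
have NM : (N.+1 <= (N * M).+1)%N by rewrite ltnS leq_pmulr.
rewrite (big_cat_nat _ NM)//= [X in _ + X]big1_seq ?addr0; last first.
  move=> d /= ; rewrite mem_index_iota => /andP[Nd _].
  by rewrite big1// => e _; rewrite fN// !mul0r.
rewrite mulr_suml; apply: eq_big_nat => d /andP[d0 dN].
rewrite -mulr_sumr; congr (_ * _).
have Md : (M.+1 <= (N * M %/ d).+1)%N.
  by rewrite ltnS leq_divRL// mulnC leq_mul2r -ltnS dN orbT.
rewrite (big_cat_nat _ Md)//= [X in _ + X]big1_seq ?addr0// => e /=.
by rewrite mem_index_iota => /andP[Me _]; rewrite gM// !mul0r.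
Qed.

End Convolution.

(** * The divisor bound *)

Section DivisorBound.
Variable R : realType.

Lemma divisors_bound (e : R) : 0 < e ->
  exists C : R, 0 < C /\ forall n, (0 < n)%N -> (size (divisors n))%:R <= C * n%:R `^ e.
Proof.
move=> e0.
have szE p k m : prime p -> ~~ (p %| m)%N -> (0 < m)%N ->
    (size (divisors (p ^ k * m)))%:R = k.+1%:R * (size (divisors m))%:R :> R.
  move=> pp pm m0.
  have h (s : seq nat) : (size s)%:R = \sum_(d <- s) 1 :> R by rewrite big_const_seq count_predT iter_addr_0.
  by rewrite !h (sum_divisors_pfactor (fun=> 1 : R) k pp pm m0) sumr_const_nat subn0 mulr_natl.
have pM (a b : nat) : (a * b)%N%:R `^ e = a%:R `^ e * b%:R `^ e :> R.
  by rewrite natrM powRM.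
have pX (a k : nat) : (a ^ k)%N%:R `^ e = (a%:R `^ e) ^+ k :> R.
  by elim: k => [|k IH]; rewrite ?expn0 ?powR1// expnS pM IH exprS.
have ppos (a : nat) : (0 < a)%N -> 0 < a%:R `^ e :> R.
  by move=> a0; rewrite powR_gt0// ltr0n.
have pmon (a b : nat) : (a <= b)%N -> a%:R `^ e <= b%:R `^ e :> R.
  by move=> ab; apply: ge0_ler_powR; rewrite ?nnegrE ?ler_nat// ltW.
have l2 : 0 < ln 2 :> R by rewrite ln_gt0// ltr1n.
(* Chosen so that k + 1 <= K (1 + k e ln 2) <= K 2^(k e): the price of a small prime, uniform in its
   exponent. *)
pose K : R := 1 + (e * ln 2)^-1.
have K1 : 1 <= K by rewrite lerDl invr_ge0 mulr_ge0// ltW.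
have smallp p k : (1 < p)%N -> k.+1%:R <= K * (p%:R `^ e) ^+ k.
  move=> p1; apply: (@le_trans _ _ (K * (2%:R `^ e) ^+ k)); last first.
    rewrite ler_wpM2l ?(le_trans ler01)//.
    by rewrite lerXn2r ?nnegrE ?powR_ge0// pmon.
  have -> : (2%:R `^ e : R) ^+ k = expR (k%:R * (e * ln 2)).
    by rewrite /powR pnatr_eq0/= -expRM_natl.
  apply: (@le_trans _ _ (K * (1 + k%:R * (e * ln 2)))); last first.
    by rewrite ler_wpM2l ?(le_trans ler01)// expR_ge1Dx.
  have x0 : 0 < e * ln 2 by rewrite mulr_gt0.
  have -> : K * (1 + k%:R * (e * ln 2)) = K + k%:R * (e * ln 2) + k%:R.
    by rewrite /K; field; rewrite !gt_eqF.
  rewrite -natr1 addrC lerD2r (le_trans K1)// lerDl mulr_ge0// ltW//.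
(* From this prime on p^e >= 2, so k + 1 <= 2^k <= p^(e k) and large primes cost nothing. *)
pose P0 := (Num.truncn (2 `^ e^-1 : R)).+1.
have P0e : 2 <= P0%:R `^ e.
  have h : 2 `^ e^-1 <= P0%:R by apply/ltW/truncnS_gt.
  have := @ge0_ler_powR _ e (ltW e0) (2 `^ e^-1) P0%:R.
  rewrite !nnegrE powR_ge0 ler0n h => /(_ isT isT isT).
  by rewrite -powRrM mulVf ?gt_eqF// powRr1.
have big n : (0 < n)%N -> (forall p, prime p -> (p %| n)%N -> (P0 <= p)%N) ->
    (size (divisors n))%:R <= n%:R `^ e.
  move: n; apply: pfactor_ind => [_|p k m pp pm m0 IH H]; first by rewrite powR1.
  rewrite szE// pM pX ler_pM ?IH//; last first.
    by move=> r rp rm; apply: H => //; rewrite dvdn_mull.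
  have P0p : (P0 <= p)%N by apply: H => //; rewrite expnS -mulnA dvdn_mulr.
  apply: (@le_trans _ _ (2 ^+ k.+1)); first by rewrite -natrX ler_nat ltn_expl.
  rewrite lerXn2r ?nnegrE ?powR_ge0//; exact: le_trans P0e (pmon _ _ P0p).
(* Here [m] is [n] freed of its prime factors below [P], each removed at the cost of one factor [K];
   the inequality compares tau(n) / n^e with tau(m) / m^e, denominators cleared. *)
have red P n : (0 < n)%N -> exists m, [/\ (0 < m)%N,
    (forall p, prime p -> (p %| m)%N -> (P <= p)%N) &
    (size (divisors n))%:R * m%:R `^ e <= K ^+ P * n%:R `^ e * (size (divisors m))%:R].
  move=> n0; elim: P => [|P [m [m0 Hm IH]]].
    by exists n; rewrite expr0 mul1r mulrC.
  have [/andP[Pp Pm]|h] := boolP (prime P && (P %| m)%N); last first.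
    exists m; split => //.
      move=> p pp pm; rewrite ltn_neqAle Hm// andbT.
      by apply: contra h => /eqP->; rewrite pp.
    apply: (le_trans IH); rewrite exprS -!mulrA ler_peMl// !mulr_ge0 ?powR_ge0//.
    by rewrite exprn_ge0// (le_trans ler01).
  have [m' co e'] := pfactor_coprime Pp m0; set k := logn P m in e'.
  have m'0 : (0 < m')%N by move: m0; rewrite e' muln_gt0 => /andP[].
  have Pm' : ~~ (P %| m')%N by rewrite -prime_coprime.
  exists m'; split => //.
    move=> p pp pm; rewrite ltn_neqAle Hm// ?andbT; last by rewrite e' dvdn_mulr.
    by apply: contra Pm' => /eqP->.
  move: IH; rewrite e' mulnC szE// pM pX => IH.
  have Pk : 0 < (P%:R `^ e) ^+ k :> R by rewrite exprn_gt0// ppos// prime_gt0.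
  rewrite -(ler_pM2l Pk) mulrCA; apply: (le_trans IH).
  have := smallp P k (prime_gt1 Pp).
  set A := k.+1%:R; set B := _ ^+ k; set s := (size _)%:R => AB.
  rewrite mulrA exprS.
  have -> : B * (K * K ^+ P * n%:R `^ e * s) = (K ^+ P * n%:R `^ e) * (K * B) * s by ring.
  rewrite ler_wpM2r// ler_wpM2l// mulr_ge0 ?powR_ge0// exprn_ge0// (le_trans ler01)//.
exists (K ^+ P0); split; first by rewrite exprn_gt0// (lt_le_trans ltr01).
move=> n n0; have [m [m0 Hm H]] := red P0 n n0.
have me := ppos m m0.
rewrite -(ler_pM2r me); apply: (le_trans H).
by rewrite ler_wpM2l ?big// mulr_ge0 ?powR_ge0// exprn_ge0// (le_trans ler01).
Qed.

End DivisorBound.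

(** * The Moebius function *)

Section Moebius.
Variable R : realType.

Definition mu (n : nat) : R := \prod_(p <- primes n) (if logn p n == 1%N then -1 else 0).

Lemma norm_mu_le1 n : `|mu n| <= 1.
Proof.
rewrite /mu; elim/big_rec: _ => [|p x _ xl]; first by rewrite normr1.
rewrite normrM; case: ifP => _; last by rewrite normr0 mul0r.
by rewrite normrN1 mul1r.
Qed.

Definition squarefree n := all (fun p => logn p n == 1%N) (primes n).

Lemma sqr_mu n : mu n ^+ 2 = (squarefree n)%:R.
Proof.
rewrite /mu -prodrXl /squarefree; elim: (primes n) => [|p s IH]; first by rewrite big_nil.
rewrite big_cons IH /=; case: ifP => _; last by rewrite expr0n mul0r.
by rewrite sqrrN expr1n mul1r.
Qed.

Lemma mu1 : mu 1 = 1. Proof. by rewrite /mu big_nil. Qed.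

Lemma perm_primes_pfactor p k m : prime p -> ~~ (p %| m)%N -> (0 < m)%N ->
  perm_eq (primes (p ^ k.+1 * m)) (p :: primes m).
Proof.
move=> pp pm m0; apply: uniq_perm; first exact: primes_uniq.
  by rewrite /= primes_uniq andbT mem_primes (negbTE pm) !andbF.
move=> r; have p0 : (0 < p ^ k.+1)%N by rewrite expn_gt0 prime_gt0.
by rewrite primesM// primesX// primes_prime// !inE.
Qed.

Lemma mu_pfactor p k m : prime p -> ~~ (p %| m)%N -> (0 < m)%N ->
  mu (p ^ k.+1 * m) = (if k == 0%N then -1 else 0) * mu m.
Proof.
move=> pp pm m0; rewrite /mu (perm_big _ (perm_primes_pfactor k pp pm m0)) big_cons.
have pk : (0 < p ^ k.+1)%N by rewrite expn_gt0 prime_gt0.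
have lm : logn p m = 0%N by apply/eqP; rewrite -leqn0 leqNgt logn_gt0 mem_primes (negbTE pm) !andbF.
rewrite lognM// pfactorK// lm addn0 eqSS; congr (_ * _).
rewrite big_seq [RHS]big_seq; apply: eq_bigr => r; rewrite mem_primes => /and3P[rp _ rm].
have rp' : (r == p) = false by apply/negbTE; apply: contraNneq pm => <-.
by rewrite lognM// lognX logn_prime// rp' muln0.
Qed.

Lemma sum_mu_divisors n : (0 < n)%N -> \sum_(d <- divisors n) mu d = (n == 1%N)%:R.
Proof.
move: n; apply: pfactor_ind => [|p k m pp pm m0 _].
  by rewrite (_ : divisors 1 = [:: 1%N])// big_seq1 mu1.
rewrite (sum_divisors_pfactor mu k.+1 pp pm m0).
have -> : (p ^ k.+1 * m == 1)%N = false.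
  apply/negbTE; rewrite muln_eq1 negb_and gtn_eqF//.
  by rewrite (leq_trans (prime_gt1 pp))// expnS leq_pmulr// expn_gt0 prime_gt0.
rewrite big_nat_recl// big_nat_recl//= addrA -big_split/= big1_seq ?add0r; last first.
  move=> d /=; rewrite -dvdn_divisors// => dm.
  have pd : ~~ (p %| d)%N by apply: contra pm => /dvdn_trans; apply.
  by rewrite mul1n (mu_pfactor 0 pp pd (dvdn_gt0 m0 dm)) eqxx mulN1r subrr.
apply: big1_seq => i _; apply: big1_seq => d; rewrite -dvdn_divisors// => dm.
have pd : ~~ (p %| d)%N by apply: contra pm => /dvdn_trans; apply.
by rewrite (mu_pfactor i.+1 pp pd (dvdn_gt0 m0 dm)) mul0r.
Qed.

End Moebius.

(** The convolution 1 * a is multiplicative, and at a prime power it is a sum 1 + x + ... + x^k with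
    x in [-1, 1], which is nonnegative. This is the positivity behind the bound for real
    characters. *)
Lemma sum_divisors_ge0 (R : realType) (a : nat -> R) :
  (forall m n, a (m * n)%N = a m * a n) -> a 1%N = 1 -> (forall n, `|a n| <= 1) ->
  forall n, (0 < n)%N -> 0 <= \sum_(d <- divisors n) a d.
Proof.
move=> aM a1 al; apply: pfactor_ind => [|p k m pp pm m0 IH].
  by rewrite (_ : divisors 1 = [:: 1%N])// big_seq1 a1.
rewrite (sum_divisors_pfactor a k.+1 pp pm m0).
have aX i : a (p ^ i)%N = a p ^+ i.
  by elim: i => [|i IHi]; rewrite ?expn0 ?a1// expnS aM IHi exprS.
under eq_bigr do (under eq_bigr do rewrite aM; rewrite -mulr_sumr aX).
rewrite -mulr_suml mulr_ge0//.
have := al p; set x := a p; rewrite ler_norml => /andP[x1 x2].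
have [->|xn] := eqVneq x 1.
  by apply: sumr_ge0 => i _; rewrite expr1n.
have x3 : 0 < 1 - x by rewrite subr_gt0 lt_neqAle xn.
rewrite -(pmulr_rge0 _ x3) big_mkord.
have := subrX1 x k.+2 => e.
have -> : (1 - x) * \sum_(i < k.+2) x ^+ i = 1 - x ^+ k.+2.
  by rewrite -[1 - x]opprB mulNr -e opprB.
rewrite subr_ge0; apply: le_trans (ler_norm _) _.
by rewrite normrX exprn_ile1// ler_norml x1.
Qed.

Lemma sum_multiples (V : zmodType) (F : nat -> V) (q N : nat) : (0 < q)%N ->
  \sum_(1 <= j < N.+1 | (q %| j)%N) F j = \sum_(1 <= k < (N %/ q).+1) F (k * q)%N.
Proof.
move=> q0; elim: N => [|N IH]; first by rewrite div0n !big_geq.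
rewrite big_mkcond big_nat_recr//= -big_mkcond IH divnS//.
have [d|_] := boolP (q %| N.+1)%N; last by rewrite addr0 add0n.
rewrite add1n [RHS]big_nat_recr//=; congr (_ + F _).
by rewrite -[LHS](divnK d) divnS// d add1n.
Qed.

(** * Harmonic sums *)

Section HarmonicSums.
Variable R : realType.

Definition harm (N : nat) : R := \sum_(1 <= n < N.+1) n%:R^-1.

Lemma harm_ge0 N : 0 <= harm N.
Proof. by apply: sumr_ge0 => n _; rewrite invr_ge0. Qed.

Lemma harmS N : harm N.+1 = harm N + N.+1%:R^-1.
Proof. by rewrite /harm big_nat_recr. Qed.

Lemma harm_le M N : (M <= N)%N -> harm M <= harm N.
Proof.
move=> MN; rewrite /harm (@big_cat_nat _ _ _ M.+1 1 N.+1)//= lerDl.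
by apply: sumr_ge0 => n _; rewrite invr_ge0.
Qed.

Lemma harm_ln N : (0 < N)%N -> harm N <= 1 + ln N%:R.
Proof.
case: N => // N _; elim: N => [|N IH].
  by rewrite /harm big_nat1 invr1 ln1 addr0.
rewrite harmS; apply: (le_trans (lerD IH (lexx _))); rewrite -addrA lerD2l.
have n0 : 0 < N.+1%:R :> R by rewrite ltr0n.
have n1 : 0 < N.+2%:R :> R by rewrite ltr0n.
have i0 : 0 < N.+2%:R^-1 :> R by rewrite invr_gt0.
have i1 : N.+2%:R^-1 < 1 :> R by rewrite invf_lt1// ltr1n.
have := @le_ln1Dx R (- N.+2%:R^-1); rewrite ltrN2 => /(_ i1).
have -> : 1 + - N.+2%:R^-1 = N.+1%:R / N.+2%:R :> R.
  rewrite -[N.+2%:R]natr1; move: n0; set x := N.+1%:R => n0.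
  by field; rewrite gt_eqF//; lra.
rewrite ln_div ?posrE//.
by move: (ln N.+1%:R) (ln N.+2%:R) (N.+2%:R^-1) => a b i; lra.
Qed.

Lemma sum_multiples_inv (q N : nat) : (0 < q)%N ->
  \sum_(1 <= j < N.+1 | (q %| j)%N) j%:R^-1 <= harm N / q%:R.
Proof.
move=> q0; rewrite sum_multiples// mulr_suml.
apply: (@le_trans _ _ (harm (N %/ q) / q%:R)).
  by rewrite /harm mulr_suml ler_sum// => k _; rewrite natrM invfM.
by rewrite -mulr_suml ler_wpM2r ?invr_ge0// harm_le// leq_div.
Qed.

Lemma sum_inv_sqr_tail m k : (0 < m)%N ->
  \sum_(m.+1 <= n < k) (n%:R ^- 2 : R) <= m%:R^-1.
Proof.
move=> m0; have [km|mk] := leqP k m.+1.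
  by rewrite big_geq// invr_ge0.
apply: (@le_trans _ _ (m%:R^-1 - (k.-1)%:R^-1)); last first.
  by rewrite gerBl invr_ge0.
case: k mk => // k; rewrite ltnS => mk; rewrite -(subnKC (ltnW mk)) /=.
elim: (k - m)%N => [|d IH].
  by rewrite addn0 big_geq// subrr.
rewrite addnS big_nat_recr/=; last by rewrite ltnS leq_addr.
apply: (le_trans (lerD IH (lexx _))).
set n := (m + d)%N.
have n1 : 1 <= n%:R :> R by rewrite ler1n addn_gt0 m0.
rewrite -addrA lerD2l -[n.+1%:R]natr1 -subr_ge0.
have -> : - (n%:R + 1)^-1 - (- n%:R^-1 + (n%:R + 1) ^- 2) = (n%:R * (n%:R + 1) ^+ 2)^-1 :> R.
  by field; rewrite !gt_eqF//; lra.
by rewrite invr_ge0; nra.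
Qed.

End HarmonicSums.

(** * Mean values of Dirichlet polynomials over the even characters *)

Section MeanValue.
Local Open Scope complex_scope.
Variables (R : realType) (q : nat) (chi : nat -> nat -> R[i]).
Hypotheses (q0 : (0 < q)%N).
Let h := q./2.
Hypothesis chi_le1 : forall b n, cabs (chi b n) <= 1.
Hypothesis chi_ncop : forall b n, ~~ coprime n q -> chi b n = 0.
Hypothesis chi_unit : forall b n, coprime n q -> cabs (chi b n) = 1.
Hypothesis chi_orth : forall m n, coprime m q -> coprime n q ->
  (m != n %[mod q])%N -> ~~ (q %| m + n)%N ->
  \sum_(0 <= b < h) chi b m * (chi b n)^* = 0.

Definition dpoly (f : nat -> R) (N b : nat) : R[i] :=
  \sum_(1 <= n < N.+1) (f n)%:C * (chi b n * (n%:R^-1)%:C).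

Let c m n := \sum_(0 <= b < h) chi b m * (chi b n)^*.

Let c_diag n : c n n = (h%:R * (coprime n q)%:R)%:C.
Proof.
rewrite /c; have [cn|nc] := boolP (coprime n q).
  rewrite (eq_bigr (fun=> 1)) => [|b _]; last by rewrite -sqr_cabs chi_unit// expr1n.
  by rewrite sumr_const_nat subn0 mulr1 rmorph_nat.
by rewrite big1 ?mulr0// => b _; rewrite chi_ncop// mul0r.
Qed.

Let c_le m n : cabs (c m n) <= h%:R.
Proof.
apply: le_trans (cabs_sum _ _ _) _.
rewrite -[leRHS]mulr1 mulr_natl -[X in _ *+ X]subn0 -sumr_const_nat.
apply: ler_sum => b _; rewrite cabsM cabs_conj.
by rewrite -[leRHS]mulr1 ler_pM ?cabs_ge0.
Qed.

(** One-sided majorant of the off-diagonal terms: for m < n, orthogonality leaves only n = m and n =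
    -m mod q. The case m > n is restored by symmetry. *)
Let e m n : R :=
  if (m < n)%N && ((q %| n - m)%N || (q %| m + n)%N) then (m%:R * n%:R)^-1 else 0.

Let e_ge0 m n : 0 <= e m n.
Proof. by rewrite /e; case: ifP => // _; rewrite invr_ge0 mulr_ge0. Qed.

Let c_offdiag_lt m n : (m < n)%N -> cabs (c m n) / (m%:R * n%:R) <= h%:R * e m n.
Proof.
move=> mn; rewrite /e mn /=; case: ifPn => [_|].
  by rewrite ler_wpM2r ?c_le// invr_ge0 mulr_ge0.
rewrite negb_or => /andP[d1 d2]; rewrite mulr0.
suff -> : c m n = 0 by rewrite cabs0 mul0r.
have [cm|cm] := boolP (coprime m q); last first.
  by rewrite /c big1// => b _; rewrite chi_ncop// mul0r.
have [cn|cn] := boolP (coprime n q); last first.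
  by rewrite /c big1// => b _; rewrite (chi_ncop b cn) conjc0 mulr0.
by apply: chi_orth => //; rewrite eq_sym eqn_mod_dvd// ltnW.
Qed.

Let c_sym m n : cabs (c m n) = cabs (c n m).
Proof.
rewrite -[RHS]cabs_conj /c conj_sum; congr (cabs _); apply: eq_bigr => b _.
by rewrite conjM conjcK mulrC.
Qed.

Let c_offdiag m n : m != n -> cabs (c m n) / (m%:R * n%:R) <= h%:R * (e m n + e n m).
Proof.
rewrite neq_ltn => /orP[mn|nm].
  apply: le_trans (c_offdiag_lt mn) _.
  by rewrite ler_wpM2l// lerDl.
rewrite c_sym [_ * n%:R]mulrC; apply: le_trans (c_offdiag_lt nm) _.
by rewrite ler_wpM2l// lerDr.
Qed.

(** The 3 is 1 + 2. If n - m = j is a multiple of q, then 1 / n <= 1 / j; if n + m = j is one, then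
    j < 2 n and 1 / n <= 2 / j. In both cases j <= 2 N. *)
Let e_row m N : (m <= N)%N ->
  \sum_(1 <= n < N.+1) e m n <= m%:R^-1 * (3 * harm R (2 * N) / q%:R).
Proof.
move=> mN.
have [->|m0] := posnP m.
  rewrite invr0 mul0r big1// => n _; rewrite /e mul0r invr0; by case: ifP.
have t1 : \sum_(1 <= n < N.+1) (if (m < n)%N && (q %| n - m)%N then n%:R^-1 else 0 : R)
    <= harm R (2 * N) / q%:R.
  rewrite (@big_cat_nat _ _ _ m.+1)//= [X in X + _]big_nat [X in X + _]big1 => [|n /andP[_ nm]]; last first.
    by rewrite ltnS in nm; rewrite ltnNge nm.
  rewrite add0r -[m.+1]add1n big_addn.
  apply: (@le_trans _ _ (\sum_(1 <= j < (N.+1 - m)) (if (q %| j)%N then j%:R^-1 else 0 : R))).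
    rewrite big_nat [leRHS]big_nat; apply: ler_sum => j /andP[j0 _].
    rewrite addnK; case: (q %| j)%N; rewrite ?andbF// andbT.
    case: ifP => _; last by rewrite invr_ge0.
    by rewrite lef_pV2 ?posrE ?ltr0n ?addn_gt0 ?j0// ler_nat leq_addr.
  rewrite -big_mkcond subSn//; apply: le_trans (sum_multiples_inv R _ q0) _.
  by rewrite ler_wpM2r ?invr_ge0// harm_le//; lia.
have t2 : \sum_(1 <= n < N.+1) (if (m < n)%N && (q %| m + n)%N then n%:R^-1 else 0 : R)
    <= 2 * (harm R (2 * N) / q%:R).
  apply: (@le_trans _ _ (\sum_(1 <= n < N.+1) 2 * (if (q %| n + m)%N then (n + m)%:R^-1 else 0 : R))).
    rewrite big_nat [leRHS]big_nat; apply: ler_sum => n /andP[n0 _].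
    rewrite addnC; case: (q %| n + m)%N; rewrite ?andbF ?mulr0// andbT.
    case: ifP => mn; last by rewrite mulr_ge0// invr_ge0.
    have p0 : 0 < n%:R :> R by rewrite ltr0n.
    have p1 : 0 < (n + m)%:R :> R by rewrite ltr0n addn_gt0 n0.
    rewrite ler_pdivlMr// mulrC ler_pdivrMr//.
    by rewrite -natrM ler_nat; lia.
  rewrite -mulr_sumr ler_wpM2l//.
  apply: (@le_trans _ _ (\sum_(1 <= j < (2 * N).+1) (if (q %| j)%N then j%:R^-1 else 0 : R))); last first.
    by rewrite -big_mkcond; apply: sum_multiples_inv.
  have -> : \sum_(1 <= n < N.+1) (if (q %| n + m)%N then (n + m)%:R^-1 else 0 : R) =
     \sum_(1 + m <= j < N.+1 + m) (if (q %| j)%N then j%:R^-1 else 0 : R).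
    by rewrite big_addn addnK.
  rewrite [leRHS](@big_cat_nat _ _ _ (1 + m))//=; last by lia.
  rewrite [X in _ <= _ + X](@big_cat_nat _ _ _ (N.+1 + m))//=; [|lia|lia].
  have g i j : 0 <= \sum_(i <= n < j) (if (q %| n)%N then n%:R^-1 else 0 : R).
    by apply: sumr_ge0 => n _; case: ifP => // _; rewrite invr_ge0.
  by rewrite addrCA lerDl addr_ge0.
have -> : 3 * harm R (2 * N) / q%:R = harm R (2 * N) / q%:R + 2 * (harm R (2 * N) / q%:R) by ring.
apply: le_trans (ler_wpM2l _ (lerD t1 t2)); last by rewrite invr_ge0.
rewrite -big_split/= mulr_sumr; apply: ler_sum => n _.
rewrite /e; case: (m < n)%N => /=; last by rewrite addr0 mulr0.
have i0 : 0 <= n%:R^-1 :> R by rewrite invr_ge0.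
have i1 : 0 <= m%:R^-1 :> R by rewrite invr_ge0.
case: (q %| n - m)%N; case: (q %| m + n)%N; rewrite /= ?invfM ?addr0 ?add0r ?mulr0//.
by rewrite mulrDr lerDl mulr_ge0.
Qed.

(** The weights 1 / (m n) make the error logarithmic in N, so polynomials whose length is a fixed
    power of q are admissible. The 6 is twice the 3 of [e_row], for m < n and m > n. *)
Lemma mean_value (f g : nat -> R) (Bf Bg : R) (N : nat) :
  (forall n, (0 < n <= N)%N -> `|f n| <= Bf) -> (forall n, (0 < n <= N)%N -> `|g n| <= Bg) ->
  0 <= Bf -> 0 <= Bg ->
  cabs (\sum_(0 <= b < h) dpoly f N b * (dpoly g N b)^* -
    (h%:R * \sum_(1 <= n < N.+1 | coprime n q) f n * g n / n%:R ^+ 2)%:C)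
  <= h%:R * (Bf * Bg * (6 * harm R (2 * N) ^+ 2 / q%:R)).
Proof.
move=> fB gB B0 B1.
pose t m n := (f m * g n / (m%:R * n%:R))%:C * c m n.
have e1 : \sum_(0 <= b < h) dpoly f N b * (dpoly g N b)^* =
    \sum_(1 <= m < N.+1) \sum_(1 <= n < N.+1) t m n.
  under eq_bigr do rewrite /dpoly conj_sum mulr_suml.
  rewrite exchange_big_nat/=; apply: eq_bigr => m _.
  under eq_bigr do rewrite mulr_sumr.
  rewrite exchange_big_nat/=; apply: eq_bigr => n _.
  rewrite /t /c mulr_sumr; apply: eq_bigr => b _.
  rewrite !conjM !conjc_real invfM !rmorphM/=; ring.
have e2 : \sum_(1 <= m < N.+1) t m m =
   (h%:R * \sum_(1 <= n < N.+1 | coprime n q) f n * g n / n%:R ^+ 2)%:C.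
  rewrite [in RHS]big_mkcond mulr_sumr rmorph_sum/=; apply: eq_bigr => n _.
  rewrite /t c_diag -rmorphM/= -expr2; congr (_ %:C).
  by case: (coprime n q); rewrite ?mulr1 ?mulr0 ?mulr1//= mulrC.
rewrite e1 -e2 -sumrB.
apply: le_trans (cabs_sum _ _ _) _.
pose S m := \sum_(1 <= n < N.+1) (e m n + e n m).
apply: (@le_trans _ _ (\sum_(1 <= m < N.+1) (Bf * Bg * h%:R) * S m)).
  rewrite big_nat [leRHS]big_nat; apply: ler_sum => m /andP[m0 mN].
  have mi : m \in index_iota 1 N.+1 by rewrite mem_index_iota m0.
  rewrite [X in X - _](bigD1_seq m mi (iota_uniq _ _))/= addrAC subrr add0r.
  apply: le_trans (cabs_sum _ _ _) _.
  rewrite /S mulr_sumr (bigD1_seq m mi (iota_uniq _ _))/=.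
  apply: ler_wpDl.
    by rewrite !mulr_ge0// addr_ge0.
  rewrite big_seq_cond [leRHS]big_seq_cond; apply: ler_sum => n.
  rewrite mem_index_iota => /andP[/andP[n0 nN] nm].
  rewrite /t cabsM cabs_real normrM normrM normfV [`|m%:R * _|]ger0_norm ?mulr_ge0//.
  have fm : `|f m| <= Bf by apply: fB; rewrite m0.
  have gn : `|g n| <= Bg by apply: gB; rewrite n0.
  have := c_offdiag (_ : m != n); rewrite eq_sym nm => /(_ isT) cc.
  have l1 : `|f m| * `|g n| <= Bf * Bg by rewrite ler_pM.
  have L : (`|f m| * `|g n|) * (cabs (c m n) / (m%:R * n%:R)) <= (Bf * Bg) * (h%:R * (e m n + e n m)).
    by apply: ler_pM => //; rewrite ?mulr_ge0 ?cabs_ge0 ?invr_ge0 ?mulr_ge0.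
  rewrite -[leRHS]mulrA; apply: le_trans L.
  by rewrite le_eqVlt; apply/orP; left; apply/eqP; ring.
rewrite -mulr_sumr.
have -> : h%:R * (Bf * Bg * (6 * harm R (2 * N) ^+ 2 / q%:R)) =
  (Bf * Bg * h%:R) * (6 * harm R (2 * N) ^+ 2 / q%:R) by ring.
apply: ler_wpM2l; first by rewrite !mulr_ge0.
under eq_bigr do rewrite /S big_split/=.
rewrite big_split/= [X in _ + X]exchange_big_nat/=.
have : \sum_(1 <= m < N.+1) \sum_(1 <= n < N.+1) e m n <=
   harm R N * (3 * harm R (2 * N) / q%:R).
  rewrite /harm mulr_suml big_nat [leRHS]big_nat; apply: ler_sum => m /andP[_ mN].
  exact: e_row.
have HN : harm R N * (3 * harm R (2 * N) / q%:R) <= harm R (2 * N) * (3 * harm R (2 * N) / q%:R).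
  rewrite ler_wpM2r ?harm_le//; last by lia.
  by rewrite divr_ge0// mulr_ge0// harm_ge0.
set E := \sum_(1 <= m < N.+1) _ => HE.
have -> : 6 * harm R (2 * N) ^+ 2 / q%:R = (harm R (2 * N) * (3 * harm R (2 * N) / q%:R)) *+ 2.
  by rewrite mulr2n; field; rewrite gt_eqF// ltr0n.
by rewrite -mulr2n lerMn2r /= (le_trans HE).
Qed.

End MeanValue.

(** * Real powers and comparison of sums with integrals *)

Section Powers.
Variable R : realType.
Implicit Types (s e d : R) (m n : nat).

(* [n ^ (- s)], with the junk value [pw s 0 = 1] coming from [ln 0 = 0] *)
Definition pw s n : R := expR (- s * ln n%:R).

Lemma pw_gt0 s n : 0 < pw s n. Proof. exact: expR_gt0. Qed.
Lemma pw_ge0 s n : 0 <= pw s n. Proof. exact/ltW/pw_gt0. Qed.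

Lemma pwM s m n : (0 < m)%N -> (0 < n)%N -> pw s (m * n) = pw s m * pw s n.
Proof. by move=> m0 n0; rewrite /pw natrM lnM ?posrE ?ltr0n// mulrDr expRD. Qed.

Lemma pwD s e n : pw (s + e) n = pw s n * pw e n.
Proof. by rewrite /pw opprD mulrDl expRD. Qed.

Lemma pw_1 n : (0 < n)%N -> pw 1 n = n%:R^-1.
Proof. by move=> n0; rewrite /pw mulN1r expRN lnK// posrE ltr0n. Qed.

Lemma pw_n1 s : pw s 1 = 1.
Proof. by rewrite /pw ln1 mulr0 expR0. Qed.

Lemma pw_le s m n : 0 <= s -> (0 < m)%N -> (m <= n)%N -> pw s n <= pw s m.
Proof.
move=> s0 m0 mn; rewrite /pw ler_expR !mulNr lerN2 ler_wpM2l//.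
have n0 : (0 < n)%N by apply: leq_trans mn.
by rewrite ler_ln ?posrE ?ltr0n// ler_nat.
Qed.

Lemma pw_le1 s n : 0 <= s -> (0 < n)%N -> pw s n <= 1.
Proof. by move=> s0 n0; rewrite -(pw_n1 s); apply: pw_le. Qed.

Lemma pwN s n : pw (- s) n = (pw s n)^-1.
Proof. by rewrite /pw opprK -expRN mulNr opprK. Qed.

(* concavity of [x ^ e] in the form needed to compare sums with integrals *)
Lemma pw_tangent e m n : 0 <= e <= 1 -> (0 < m)%N -> (0 < n)%N ->
  pw (- e) n <= pw (- e) m * (1 + e * (n%:R / m%:R - 1)).
Proof.
move=> /andP[e0 e1] m0 n0.
pose L : R := ln n%:R - ln m%:R.
have mp : 0 < m%:R :> R by rewrite ltr0n.
have np : 0 < n%:R :> R by rewrite ltr0n.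
have -> : pw (- e) n = pw (- e) m * expR (e * L).
  by rewrite /pw -expRD; congr expR; rewrite /L; ring.
have -> : n%:R / m%:R = expR L :> R by rewrite /L expRB !lnK.
rewrite ler_wpM2l ?pw_ge0//.
have h1 := expR_ge1Dx ((1 - e) * L).
have h2 := expR_ge1Dx (- e * L).
have h3 : 1 <= e * expR ((1 - e) * L) + (1 - e) * expR (- e * L) by nra.
have h4 : expR (e * L) * expR ((1 - e) * L) = expR L by rewrite -expRD; congr expR; ring.
have h5 : expR (e * L) * expR (- e * L) = 1 by rewrite -expRD mulNr subrr expR0.
have := ler_wpM2l (expR_ge0 (e * L)) h3.
have -> : expR (e * L) * (e * expR ((1 - e) * L) + (1 - e) * expR (- e * L)) =
  e * (expR (e * L) * expR ((1 - e) * L)) + (1 - e) * (expR (e * L) * expR (- e * L)) by ring.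
by rewrite h4 h5; lra.
Qed.

(** The tangent bound taken at [n] and at [n.+1]; it replaces the integral of x^(e - 1) over one
    unit interval. *)
Lemma pw_incr e n : 0 < e < 1 -> (0 < n)%N ->
  e * pw (1 - e) n.+1 <= pw (- e) n.+1 - pw (- e) n <= e * pw (1 - e) n.
Proof.
move=> /andP[e0 e1] n0.
have e01 : 0 <= e <= 1 by apply/andP; split; exact: ltW.
have np : 0 < n%:R :> R by rewrite ltr0n.
have n1p : 0 < n.+1%:R :> R by rewrite ltr0n.
have h1 := pw_tangent e01 n0 (ltn0Sn n).
have h2 := pw_tangent e01 (ltn0Sn n) n0.
rewrite [1 - e]addrC !pwD !pw_1//.
have e1' : n.+1%:R / n%:R - 1 = n%:R^-1 :> R by rewrite -natr1; field; rewrite gt_eqF.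
have e2' : n%:R / n.+1%:R - 1 = - n.+1%:R^-1 :> R.
  by rewrite -[n.+1%:R]natr1; field; rewrite natr1 gt_eqF.
rewrite e1' in h1; rewrite e2' in h2.
move: h1 h2; move: (pw (- e) n) (pw (- e) n.+1) (n%:R^-1) (n.+1%:R^-1) => a b i j h1 h2.
by apply/andP; split; nra.
Qed.

Lemma pw_sum_le e N : 0 < e < 1 -> (0 < N)%N ->
  \sum_(1 <= n < N.+1) pw (1 - e) n <= pw (- e) N / e.
Proof.
move=> /andP[e0 e1]; case: N => // N _; elim: N => [|N IH].
  by rewrite big_nat1 !pw_n1 ler_pdivlMr// mul1r ltW.
rewrite big_nat_recr//=; apply: le_trans (lerD IH (lexx _)) _.
have e01 : 0 < e < 1 by rewrite e0.
have /andP[h _] := pw_incr e01 (ltn0Sn N).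
rewrite -(ler_pM2l e0) mulrDr ![e * (_ / e)]mulrC !divfK ?gt_eqF//.
by rewrite -lerBrDl.
Qed.

Lemma pw_tail d m k : 0 < d -> (0 < m)%N ->
  \sum_(m.+1 <= n < k) pw (1 + d) n <= pw d m / d.
Proof.
move=> d0 m0; have [km|mk] := leqP k m.+1.
  by rewrite big_geq// divr_ge0 ?pw_ge0// ltW.
apply: (@le_trans _ _ (pw d m / d - pw d k.-1 / d)); last first.
  by rewrite gerBl divr_ge0 ?pw_ge0// ltW.
case: k mk => // k; rewrite ltnS => mk; rewrite -(subnKC (ltnW mk)) /=.
elim: (k - m)%N => [|j IH]; first by rewrite addn0 big_geq// subrr.
rewrite addnS big_nat_recr/=; last by rewrite ltnS leq_addr.
apply: (le_trans (lerD IH (lexx _))).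
set n := (m + j)%N; have n0 : (0 < n)%N by rewrite addn_gt0 m0.
rewrite -addrA lerD2l.
have np : 0 < n%:R :> R by rewrite ltr0n.
have n1p : 0 < n.+1%:R :> R by rewrite ltr0n.
suff h : d * pw (1 + d) n.+1 <= pw d n - pw d n.+1.
  have h' : pw (1 + d) n.+1 <= (pw d n - pw d n.+1) / d by rewrite ler_pdivlMr// mulrC.
  by rewrite mulrBl in h'; move: h'; move: (pw d n / d) (pw d n.+1 / d) => x y; lra.
rewrite pwD pw_1//.
have i0 : 0 < n.+1%:R^-1 :> R by rewrite invr_gt0.
have i1 : n.+1%:R^-1 < 1 :> R by rewrite invf_lt1// ltr1n ltnS.
have hl : ln n%:R - ln n.+1%:R <= - n.+1%:R^-1 :> R.
  have := @le_ln1Dx R (- n.+1%:R^-1); rewrite ltrN2 => /(_ i1).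
  have -> : 1 + - n.+1%:R^-1 = n%:R / n.+1%:R :> R.
    by rewrite -[n.+1%:R]natr1; field; rewrite natr1 gt_eqF.
  by rewrite ln_div ?posrE.
have -> : pw d n = pw d n.+1 * expR (d * (ln n.+1%:R - ln n%:R)).
  by rewrite /pw -expRD; congr expR; ring.
have h1 := expR_ge1Dx (d * (ln n.+1%:R - ln n%:R)).
have h2 : d * n.+1%:R^-1 <= d * (ln n.+1%:R - ln n%:R).
  by rewrite ler_pM2l//; move: hl; rewrite lerNr opprB.
have h3 := ler_wpM2l (pw_ge0 d n.+1) (le_trans (lerD (lexx 1) h2) h1).
by rewrite mulrDr mulr1 in h3; rewrite lerBrDl mulrA [_ * pw d _]mulrC.
Qed.

Lemma pw_small d x : 0 < d -> 0 < x -> exists Y0, (0 < Y0)%N /\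
  forall Y, (Y0 <= Y)%N -> pw d Y <= x.
Proof.
move=> d0 x0; pose T : R := expR (- ln x / d).
exists (Num.truncn T).+1; split => // Y HY.
have TY : T <= Y%:R.
  by apply: (le_trans (ltW (truncnS_gt T))); rewrite ler_nat.
have T0 : 0 < T by exact: expR_gt0.
have lT : - ln x / d <= ln Y%:R.
  by rewrite -[leLHS]expRK ler_ln ?posrE// (lt_le_trans T0).
rewrite -[leRHS]lnK ?posrE// /pw ler_expR mulNr lerNl -lerNl.
by move: lT; rewrite ler_pdivrMr// mulrC lerNl.
Qed.

End Powers.

(** * Euler products by finite sieving *)

Section EulerProduct.
Local Open Scope complex_scope.
Variables (R : realType) (f : nat -> R[i]) (d : R).
Hypotheses (d0 : 0 < d) (f1 : f 1%N = 1).
Hypothesis fM : forall a b, (0 < a)%N -> (0 < b)%N -> f (a * b)%N = f a * f b.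
Hypothesis fw : forall n, (0 < n)%N -> cabs (f n) <= pw (1 + d) n.

(* The sum over the [n <= X] without prime factors [<= N]. Passing from [p - 1] to a
   prime [p] removes the multiples of [p], hence multiplies the sum by [1 - f p] up to
   a tail of the series, and for large [N] only the term [n = 1] matters. *)
Let T N X := \sum_(1 <= n < X.+1 | coprime n N`!) f n.
Definition euler_prod N := \prod_(1 <= p < N.+1 | prime p) (1 - f p).

Let T_tail N X Y : (0 < Y)%N -> (Y <= X)%N -> cabs (T N X - T N Y) <= pw d Y / d.
Proof.
move=> Y0 YX; rewrite /T big_mkcond [X in _ - X]big_mkcond.
rewrite (@big_cat_nat _ _ _ Y.+1)//= addrAC subrr add0r.
apply: le_trans (cabs_sum _ _ _) _; apply: le_trans (pw_tail X.+1 d0 Y0).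
rewrite big_nat [leRHS]big_nat; apply: ler_sum => n /andP[Yn _].
have n0 : (0 < n)%N by apply: leq_trans Yn.
by case: ifP => _; rewrite ?fw// cabs0 pw_ge0.
Qed.

Let TS_comp N X : ~~ prime N.+1 -> T N.+1 X = T N X.
Proof.
move=> np; rewrite /T; apply: eq_bigl => n.
rewrite factS coprimeMr; have [co|] := boolP (coprime n N`!); rewrite ?andbF// andbT.
case: N np co => [|N] np co; first exact: coprimen1.
apply: contraT => nc.
have g1 : (1 < gcdn n N.+2)%N.
  by rewrite ltn_neqAle eq_sym -/(coprime _ _) nc gcdn_gt0 orbT.
have pp := pdiv_prime g1; set p := pdiv _ in pp.
have pg : (p %| gcdn n N.+2)%N by exact: pdiv_dvd.
have [pn pN] : (p %| n)%N /\ (p %| N.+2)%N by split; apply: (dvdn_trans pg); rewrite ?dvdn_gcdl ?dvdn_gcdr.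
have pl : (p <= N.+1)%N.
  have : (p <= N.+2)%N by exact: dvdn_leq.
  by rewrite leq_eqVlt => /orP[/eqP e|//]; move: np; rewrite -e pp.
have pf : (p %| (N.+1)`!)%N by rewrite dvdn_fact// prime_gt0.
by move: (coprime_dvdl pn (coprime_dvdr pf co)); rewrite prime_coprime// dvdnn.
Qed.

Let TS_prime N X : prime N.+1 -> T N.+1 X = T N X - f N.+1 * T N (X %/ N.+1).
Proof.
move=> pp; suff e : T N X = T N.+1 X + f N.+1 * T N (X %/ N.+1) by rewrite e addrK.
rewrite {1}/T (bigID (fun n => (N.+1 %| n)%N))/= addrC.
have -> : \sum_(1 <= n < X.+1 | coprime n N`! && ~~ (N.+1 %| n)%N) f n = T N.+1 X.
  rewrite /T; apply: eq_bigl => n.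
  by rewrite factS coprimeMr [coprime n N.+1]coprime_sym (prime_coprime n pp) andbC.
congr (_ + _).
rewrite (eq_bigl (fun n => (N.+1 %| n)%N && coprime n N`!)); last by move=> n; rewrite andbC.
rewrite big_mkcondr/= (sum_multiples (fun n => if coprime n N`! then f n else 0))//.
rewrite /T mulr_sumr [RHS]big_mkcond.
apply: eq_big_nat => k /andP[k0 _].
rewrite coprimeMl.
have -> : coprime N.+1 N`!.
  rewrite prime_coprime//.
  have h M : (M <= N)%N -> ~~ (N.+1 %| M`!)%N.
    elim: M => [_|M IH MN].
      by rewrite fact0 dvdn1; apply/eqP => e; move: pp; rewrite e.
    by rewrite factS Euclid_dvdM// negb_or IH ?(ltnW MN)// andbT gtnNdvd.
  exact: h.
by rewrite andbT; case: ifP; rewrite ?fM// mulrC.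
Qed.

Let f_le1 n : (0 < n)%N -> cabs (f n) <= 1.
Proof.
by move=> n0; apply: le_trans (fw n0) _; rewrite pw_le1// addr_ge0// ltW.
Qed.

Let F X := \sum_(1 <= n < X.+1) f n.

Let euler_approx N x : 0 < x -> exists X0, forall X, (X0 <= X)%N ->
  cabs (F X * euler_prod N - T N X) <= x.
Proof.
elim: N x => [|N IH] x x0.
  exists 0%N => X _; rewrite /euler_prod big_geq// mulr1 /T /F.
  rewrite [X in _ - X](eq_bigl xpredT) => [|n]; last exact: coprimen1.
  by rewrite subrr cabs0 ltW.
have [pp|np] := boolP (prime N.+1); last first.
  have [X0 H] := IH x x0; exists X0 => X /H.
  by rewrite TS_comp// /euler_prod [in X in _ -> X]big_mkcond big_nat_recr//= (negbTE np) mulr1 -big_mkcond.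
(* The new factor 1 - f p has modulus at most 2 and f p at most 1, so two errors x / 4 become at
   most 3 x / 4. *)
have x4 : 0 < x / 4 by rewrite divr_gt0.
have [X0 H] := IH _ x4.
have dx : 0 < d * (x / 4) by rewrite mulr_gt0.
have [Y0 [Y00 HY]] := pw_small d0 dx.
exists (maxn X0 (Y0 * N.+1)) => X; rewrite geq_max => /andP[/H h1 h2].
have -> : euler_prod N.+1 = euler_prod N * (1 - f N.+1).
  by rewrite /euler_prod big_mkcond big_nat_recr//= pp -big_mkcond.
rewrite TS_prime//.
have -> : F X * (euler_prod N * (1 - f N.+1)) - (T N X - f N.+1 * T N (X %/ N.+1)) =
  (F X * euler_prod N - T N X) * (1 - f N.+1) - f N.+1 * (T N X - T N (X %/ N.+1)) by ring.
have Yd : (Y0 <= X %/ N.+1)%N by rewrite leq_divRL.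
have h3 := T_tail N (leq_trans Y00 Yd) (leq_div X N.+1).
have h4 : pw d (X %/ N.+1) / d <= x / 4 by rewrite ler_pdivrMr// mulrC HY.
have h5 : cabs (1 - f N.+1) <= 2.
  by apply: le_trans (cabsBD _ _) _; rewrite cabs1; have := f_le1 (ltn0Sn N); lra.
apply: le_trans (cabsBD _ _) _; rewrite !cabsM.
have h6 := ler_pM (cabs_ge0 _) (cabs_ge0 _) h1 h5.
have h7 := ler_pM (cabs_ge0 _) (cabs_ge0 _) (f_le1 (ltn0Sn N)) (le_trans h3 h4).
by lra.
Qed.

(** An integer coprime to N! is 1 or exceeds N. *)
Let T_1 N X : (0 < N)%N -> (0 < X)%N -> cabs (T N X - 1) <= pw d N / d.
Proof.
move=> N0 X0; rewrite /T big_mkcond big_ltn//= coprime1n f1 addrAC subrr add0r.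
apply: le_trans (cabs_sum _ _ _) _; apply: le_trans (pw_tail (maxn X.+1 N.+1) d0 N0).
have z n : (1 < n <= N)%N -> coprime n N`! = false.
  move=> /andP[n1 nN]; apply/negbTE/negP => co.
  have nf : (n %| N`!)%N by rewrite dvdn_fact// nN ltnW.
  by move: co; rewrite /coprime => /eqP; rewrite (gcdn_idPl nf); lia.
have [XN|NX] := leqP X N.
  rewrite big_nat big1 => [|n /andP[n1 nX]]; last by rewrite z ?cabs0//; lia.
  by apply: sumr_ge0 => n _; exact: pw_ge0.
rewrite (@big_cat_nat _ _ _ N.+1)//=; last by rewrite ltnW.
rewrite big_nat big1 ?add0r => [|n /andP[n1 nX]]; last by rewrite z ?cabs0//; lia.
have -> : maxn X.+1 N.+1 = X.+1 by apply/maxn_idPl; rewrite ltnW.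
rewrite big_nat [leRHS]big_nat; apply: ler_sum => n /andP[Yn _].
have n0 : (0 < n)%N by apply: leq_trans Yn.
by case: ifP => _; rewrite ?fw// cabs0 pw_ge0.
Qed.

(** Closeness to 1 within 1/2 is all that is needed: it converts upper bounds for the finite product
    into lower bounds for the series. *)
Lemma euler_product N : (0 < N)%N -> pw d N / d <= 4^-1 ->
  exists X0, forall X, (X0 <= X)%N -> cabs (F X * euler_prod N - 1) <= 2^-1.
Proof.
move=> N0 HN; have x4 : 0 < 4^-1 :> R by rewrite invr_gt0.
have [X0 H] := euler_approx N x4.
exists (maxn 1 X0) => X; rewrite geq_max => /andP[X1 /H h1].
have h2 := T_1 N0 X1.
have -> : F X * euler_prod N - 1 = (F X * euler_prod N - T N X) + (T N X - 1) by ring.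
by apply: le_trans (cabsD _ _) _; lra.
Qed.

End EulerProduct.

(** * The 3-4-1 inequality *)

Section Mertens.
Local Open Scope complex_scope.
Variable R : realType.

(* [x <= expR (x - 1)] for each squared factor; the linear terms in [r] add up to
   [- 2 r (3 + 4 Re z + Re (z ^+ 2)) <= 0]. *)
Lemma mertens_local (z : R[i]) (r : R) : cabs z <= 1 -> 0 <= r ->
  (cabs (1 - r%:C) ^+ 2) ^+ 3 * (cabs (1 - z * r%:C) ^+ 2) ^+ 4 * cabs (1 - z ^+ 2 * r%:C) ^+ 2
  <= expR (8 * r ^+ 2).
Proof.
move=> z1 r0.
have step (w : R[i]) : cabs w <= 1 ->
    cabs (1 - w * r%:C) ^+ 2 <= expR (- 2 * r * complex.Re w + r ^+ 2).
  move=> w1; have w2 : complex.Re w ^+ 2 + complex.Im w ^+ 2 <= 1.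
    by rewrite -cabs_sqr expr_le1// cabs_ge0.
  have -> : cabs (1 - w * r%:C) ^+ 2 =
      1 - 2 * r * complex.Re w + r ^+ 2 * (complex.Re w ^+ 2 + complex.Im w ^+ 2).
    rewrite cabs_sqr; case: (w) => a b /=; ring.
  apply: le_trans (expR_ge1Dx _).
  have := ler_wpM2l (sqr_ge0 r) w2; lra.
have h0 := step 1; rewrite cabs1 mul1r /= mulr1 in h0; have {}h0 := h0 (lexx _).
have h1 := step z z1.
have h2 := step (z ^+ 2); rewrite cabsX expr_le1 ?cabs_ge0// in h2; have {}h2 := h2 z1.
have c0 (w : R[i]) : 0 <= cabs w ^+ 2 by rewrite sqr_ge0.
have h01 : (cabs (1 - r%:C) ^+ 2) ^+ 3 <= expR (3 * (- 2 * r + r ^+ 2)).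
  by rewrite expRM_natl lerXn2r ?nnegrE ?expR_ge0.
have h11 : (cabs (1 - z * r%:C) ^+ 2) ^+ 4 <= expR (4 * (- 2 * r * complex.Re z + r ^+ 2)).
  by rewrite expRM_natl lerXn2r ?nnegrE ?expR_ge0.
apply: (@le_trans _ _ (expR (3 * (- 2 * r + r ^+ 2)) *
  expR (4 * (- 2 * r * complex.Re z + r ^+ 2)) * expR (- 2 * r * complex.Re (z ^+ 2) + r ^+ 2))).
  exact: (ler_pM (mulr_ge0 (exprn_ge0 _ (c0 _)) (exprn_ge0 _ (c0 _))) (c0 _)
    (ler_pM (exprn_ge0 _ (c0 _)) (exprn_ge0 _ (c0 _)) h01 h11) h2).
rewrite -!expRD ler_expR.
have z2 : complex.Re z ^+ 2 + complex.Im z ^+ 2 <= 1.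
  by rewrite -cabs_sqr expr_le1// cabs_ge0.
have -> : complex.Re (z ^+ 2) = complex.Re z ^+ 2 - complex.Im z ^+ 2.
  by rewrite [z ^+ 2]expr2; case: (z) => a b /=; rewrite !expr2.
move: z2; move: (complex.Re z) (complex.Im z) => a b z2.
have : 0 <= r * (3 + 4 * a + (a ^+ 2 - b ^+ 2)).
  by rewrite mulr_ge0//; have := sqr_ge0 (1 + a); nra.
by lra.
Qed.

Variables (chi : nat -> R[i]) (d : R).
Hypotheses (d0 : 0 < d) (chi_1 : chi 1%N = 1) (chi_M : forall a b, chi (a * b)%N = chi a * chi b).
Hypothesis chi_le1 : forall n, cabs (chi n) <= 1.

Let w (n : nat) := (pw (1 + d) n)%:C.
Let f0 n := w n.
Let f1 n := chi n * w n.
Let f2 n := chi n ^+ 2 * w n.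

Let wM a b : (0 < a)%N -> (0 < b)%N -> w (a * b)%N = w a * w b.
Proof. by move=> a0 b0; rewrite /w pwM// rmorphM. Qed.

Let cw n : cabs (w n) = pw (1 + d) n.
Proof. by rewrite cabs_real ger0_norm// pw_ge0. Qed.

Let prod_bound N :
  (cabs (euler_prod f0 N) ^+ 2) ^+ 3 * (cabs (euler_prod f1 N) ^+ 2) ^+ 4 * cabs (euler_prod f2 N) ^+ 2
  <= expR (8 * \sum_(1 <= p < N.+1) pw (1 + d) p ^+ 2).
Proof.
elim: N => [|N IH].
  by rewrite /euler_prod !big_geq// cabs1 !expr1n !mulr1 mulr0 expR0.
have E (f : nat -> R[i]) : euler_prod f N.+1 = euler_prod f N * (if prime N.+1 then 1 - f N.+1 else 1).
  by rewrite /euler_prod big_mkcond big_nat_recr//= -big_mkcond.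
rewrite !E !cabsM [X in expR (8 * X)]big_nat_recr//= mulrDr expRD.
set a0 := cabs (euler_prod f0 N); set a1 := cabs (euler_prod f1 N).
set a2 := cabs (euler_prod f2 N).
set b0 := cabs (if _ then 1 - f0 _ else _); set b1 := cabs (if _ then 1 - f1 _ else _).
set b2 := cabs (if _ then 1 - f2 _ else _).
have -> : ((a0 * b0) ^+ 2) ^+ 3 * ((a1 * b1) ^+ 2) ^+ 4 * (a2 * b2) ^+ 2 =
  ((a0 ^+ 2) ^+ 3 * (a1 ^+ 2) ^+ 4 * a2 ^+ 2) * ((b0 ^+ 2) ^+ 3 * (b1 ^+ 2) ^+ 4 * b2 ^+ 2) by ring.
have c0 (z : R[i]) : 0 <= cabs z by exact: cabs_ge0.
apply: ler_pM => //; try by rewrite !mulr_ge0 ?exprn_ge0 ?c0.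
rewrite /b0 /b1 /b2.
case: ifP => _; last by rewrite cabs1 !expr1n !mulr1 -[leLHS]expR0 ler_expR mulr_ge0// sqr_ge0.
exact: mertens_local (chi_le1 _) (pw_ge0 _ _).
Qed.

Let sum_sq N : \sum_(1 <= p < N.+1) pw (1 + d) p ^+ 2 <= 2.
Proof.
have h n : (0 < n)%N -> pw (1 + d) n ^+ 2 <= n%:R ^- 2.
  move=> n0; rewrite -exprVn lerXn2r ?nnegrE ?pw_ge0 ?invr_ge0//.
  by rewrite pwD pw_1// ler_piMr ?invr_ge0// pw_le1// ltW.
case: N => [|N]; first by rewrite big_geq.
rewrite big_ltn// pw_n1 expr1n.
have : \sum_(2 <= p < N.+2) pw (1 + d) p ^+ 2 <= 1.
  have := @sum_inv_sqr_tail R 1 N.+2 isT; rewrite invr1; apply: le_trans.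
  by rewrite big_nat [leRHS]big_nat; apply: ler_sum => n /andP[n1 _]; apply: h; lia.
lra.
Qed.

(** Each sum times its finite Euler product has modulus at least 1/2, whence 256 = 2^(3+4+1). The
    local inequality bounds the square of the combined product by exp(8 * 2), the squares of
    n^(-1-d) adding up to at most 2; its root is exp(8). *)
Lemma mertens_inequality : exists X0, forall X, (X0 <= X)%N ->
  1 <= 256 * expR 8 * cabs (\sum_(1 <= n < X.+1) (pw (1 + d) n)%:C) ^+ 3 *
    cabs (\sum_(1 <= n < X.+1) chi n * (pw (1 + d) n)%:C) ^+ 4 *
    cabs (\sum_(1 <= n < X.+1) chi n ^+ 2 * (pw (1 + d) n)%:C).
Proof.
have d4 : 0 < d * 4^-1 by rewrite mulr_gt0// invr_gt0.
have [N [N0 HN]] := pw_small d0 d4.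
have HN' : pw d N / d <= 4^-1 by rewrite ler_pdivrMr// mulrC HN.
have w1 : w 1 = 1 by rewrite /w pw_n1.
have [X0 H0] := @euler_product R f0 d d0 w1 wM (fun n _ => eq_ind_r (fun x => x <= _) (lexx _) (cw n)) N N0 HN'.
have [X1 H1] : exists X0, forall X, (X0 <= X)%N ->
    cabs ((\sum_(1 <= n < X.+1) f1 n) * euler_prod f1 N - 1) <= 2^-1.
  apply: (@euler_product R f1 d d0 _ _ _ N N0 HN').
  - by rewrite /f1 chi_1 w1 mulr1.
  - by move=> a b a0 b0; rewrite /f1 chi_M wM//; ring.
  - by move=> n n0; rewrite /f1 cabsM cw ler_piMl ?pw_ge0.
have [X2 H2] : exists X0, forall X, (X0 <= X)%N ->
    cabs ((\sum_(1 <= n < X.+1) f2 n) * euler_prod f2 N - 1) <= 2^-1.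
  apply: (@euler_product R f2 d d0 _ _ _ N N0 HN').
  - by rewrite /f2 chi_1 w1 mulr1 expr1n.
  - by move=> a b a0 b0; rewrite /f2 chi_M wM//; ring.
  - by move=> n n0; rewrite /f2 cabsM cw ler_piMl ?pw_ge0// cabsX expr_le1 ?cabs_ge0.
exists (maxn X0 (maxn X1 X2)) => X; rewrite !geq_max => /and3P[/H0 h0 /H1 h1 /H2 h2].
have half (F P : R[i]) : cabs (F * P - 1) <= 2^-1 -> 2^-1 <= cabs F * cabs P.
  move=> h; rewrite -cabsM; have := cabsBD (F * P) (F * P - 1).
  have -> : F * P - (F * P - 1) = 1 by ring.
  by rewrite cabs1; lra.
move: h0 h1 h2 => /half h0 /half h1 /half h2.
have := prod_bound N.
set p0 := cabs (euler_prod f0 N) in h0 *; set p1 := cabs (euler_prod f1 N) in h1 *.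
set p2 := cabs (euler_prod f2 N) in h2 *.
have p00 : 0 <= p0 by exact: cabs_ge0.
have p10 : 0 <= p1 by exact: cabs_ge0.
have p20 : 0 <= p2 by exact: cabs_ge0.
move=> hP.
have {}hP : p0 ^+ 3 * p1 ^+ 4 * p2 <= expR 8.
  have h : (p0 ^+ 3 * p1 ^+ 4 * p2) ^+ 2 <= expR 8 ^+ 2.
    have -> : (p0 ^+ 3 * p1 ^+ 4 * p2) ^+ 2 = (p0 ^+ 2) ^+ 3 * (p1 ^+ 2) ^+ 4 * p2 ^+ 2 by ring.
    apply: (le_trans hP); rewrite -expRM_natl ler_expR.
    by have := sum_sq N; lra.
  by move: h; rewrite ler_pXn2r ?nnegrE ?expR_ge0 ?mulr_ge0 ?exprn_ge0.
set F0 := cabs (\sum_(1 <= n < X.+1) f0 n) in h0 *; set F1 := cabs (\sum_(1 <= n < X.+1) f1 n) in h1 *.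
set F2 := cabs (\sum_(1 <= n < X.+1) f2 n) in h2 *.
have F00 : 0 <= F0 by exact: cabs_ge0.
have F10 : 0 <= F1 by exact: cabs_ge0.
have F20 : 0 <= F2 by exact: cabs_ge0.
have i0 : 0 <= 2^-1 :> R by rewrite invr_ge0.
have g0 : 2^-1 ^+ 3 <= (F0 * p0) ^+ 3 by rewrite lerXn2r ?nnegrE// mulr_ge0.
have g1 : 2^-1 ^+ 4 <= (F1 * p1) ^+ 4 by rewrite lerXn2r ?nnegrE// mulr_ge0.
have g : 2^-1 ^+ 3 * 2^-1 ^+ 4 * 2^-1 <= (F0 * p0) ^+ 3 * (F1 * p1) ^+ 4 * (F2 * p2).
  exact: (ler_pM (mulr_ge0 (exprn_ge0 _ i0) (exprn_ge0 _ i0)) i0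
    (ler_pM (exprn_ge0 _ i0) (exprn_ge0 _ i0) g0 g1) h2).
have e1 : (F0 * p0) ^+ 3 * (F1 * p1) ^+ 4 * (F2 * p2) =
  (F0 ^+ 3 * F1 ^+ 4 * F2) * (p0 ^+ 3 * p1 ^+ 4 * p2) by ring.
have FF : 0 <= F0 ^+ 3 * F1 ^+ 4 * F2 by rewrite !mulr_ge0 ?exprn_ge0.
rewrite e1 in g; have {}g := le_trans g (ler_wpM2l FF hP).
have -> : 256 * expR 8 * F0 ^+ 3 * F1 ^+ 4 * F2 = 256 * ((F0 ^+ 3 * F1 ^+ 4 * F2) * expR 8) by ring.
have : 2^-1 ^+ 3 * 2^-1 ^+ 4 * 2^-1 = 256^-1 :> R by field.
by move=> e; rewrite e in g; lra.
Qed.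

End Mertens.

(** * Lower bound at 1 for characters whose square is not principal *)

Section ComplexCharacter.
Local Open Scope complex_scope.
Variables (R : realType) (q : nat) (chi : nat -> R[i]).
Hypothesis chiP : dirichlet_char q chi.
Hypothesis chiN : ~ principal_char q chi.
Hypothesis chi2N : ~ principal_char q (fun n => chi n ^+ 2).

Lemma dirichlet_char_sqr : dirichlet_char q (fun n => chi n ^+ 2).
Proof.
case: chiP => q0 M P N; split => // [a b|n|n]; rewrite ?M ?P ?exprMn//.
by rewrite expf_eq0 /=; exact: N.
Qed.

(** The 3-4-1 inequality at 1 + d, with a cutoff [Y] beyond all others. The zeta sum is at most 1 +
    1/d; the chi^2 sum is cut at q, where its tail costs q / q = 1; the chi sum is cut at X and
    moved from 1 + d to 1 by 1 - n^(-d) <= d ln n. *)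
Lemma L1_lower_complex (d : R) (X : nat) : 0 < d -> (0 < X)%N ->
  1 <= 256 * expR 8 * (1 + d^-1) ^+ 3 *
    (cabs (\sum_(1 <= n < X.+1) chi n * (n%:R^-1)%:C) + q%:R / X%:R + d * ln X%:R * harm R X) ^+ 4 *
    (harm R q + 1).
Proof.
move=> d0 X0.
have q0 : (0 < q)%N by case: chiP.
have [X1 H] := mertens_inequality d0 (chi1 chiP) (chiM chiP) (cabs_chi_le1 chiP).
pose Y := maxn X1 (maxn X q).
have {}H := H Y (leq_maxl _ _).
have d1 : 0 <= 1 + d by rewrite addr_ge0// ltW.
have wdec m n : (m < n)%N -> pw (1 + d) n.+1 <= pw (1 + d) n.
  by move=> mn; apply: pw_le => //; apply: leq_trans mn.
have w_inv n : (0 < n)%N -> pw (1 + d) n <= n%:R^-1.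
  by move=> n0; rewrite pwD pw_1// ler_piMr ?invr_ge0// pw_le1// ltW.
apply: (le_trans H).
have B0 : cabs (\sum_(1 <= n < Y.+1) (pw (1 + d) n)%:C) <= 1 + d^-1.
  apply: le_trans (cabs_sum _ _ _) _.
  have -> : \sum_(1 <= n < Y.+1) cabs (pw (1 + d) n)%:C = \sum_(1 <= n < Y.+1) pw (1 + d) n.
    by apply: eq_bigr => n _; rewrite cabs_real ger0_norm// pw_ge0.
  rewrite big_ltn; last by rewrite ltnS (leq_trans X0)// /Y !leq_max leqnn !orbT.
  rewrite pw_n1 lerD2l; apply: le_trans (pw_tail Y.+1 d0 (isT : 0 < 1)%N) _.
  by rewrite pw_n1 mul1r.
have tail (c : nat -> R[i]) (m : nat) : dirichlet_char q c -> ~ principal_char q c -> (0 < m)%N ->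
    (m <= Y)%N -> cabs (\sum_(1 <= n < Y.+1) c n * (pw (1 + d) n)%:C) <=
    cabs (\sum_(1 <= n < m.+1) c n * (pw (1 + d) n)%:C) + q%:R / m%:R.
  move=> cP cN m0 mY; rewrite (@big_cat_nat _ _ _ m.+1)//=.
  apply: le_trans (cabsD _ _) _; rewrite lerD2l.
  apply: le_trans (chi_tail cP cN Y.+1 _ (fun n _ => pw_ge0 _ _)) _.
    by move=> n mn; apply: (wdec 0%N); apply: leq_trans mn.
  rewrite ler_wpM2l//; apply: le_trans (w_inv _ _) _ => //.
  by rewrite lef_pV2 ?posrE ?ltr0n// ler_nat.
have B2 : cabs (\sum_(1 <= n < Y.+1) chi n ^+ 2 * (pw (1 + d) n)%:C) <= harm R q + 1.
  have qY : (q <= Y)%N by rewrite /Y !leq_max leqnn !orbT.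
  apply: le_trans (tail (fun n => chi n ^+ 2) q dirichlet_char_sqr chi2N q0 qY) _.
  rewrite divff ?pnatr_eq0 -?lt0n// lerD2r.
  apply: le_trans (cabs_sum _ _ _) _; rewrite /harm big_nat [leRHS]big_nat.
  apply: ler_sum => n /andP[n0 _]; apply: le_trans (w_inv n n0).
  rewrite cabsM cabs_real ger0_norm ?pw_ge0// ler_piMl ?pw_ge0// cabsX.
  by rewrite expr_le1 ?cabs_ge0// (cabs_chi_le1 chiP).
have B1 : cabs (\sum_(1 <= n < Y.+1) chi n * (pw (1 + d) n)%:C) <=
  cabs (\sum_(1 <= n < X.+1) chi n * (n%:R^-1)%:C) + q%:R / X%:R + d * ln X%:R * harm R X.
  have XY : (X <= Y)%N by rewrite /Y !leq_max leqnn !orbT.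
  apply: le_trans (tail chi X chiP chiN X0 XY) _.
  rewrite addrAC lerD2r.
  have -> : \sum_(1 <= n < X.+1) chi n * (pw (1 + d) n)%:C =
     \sum_(1 <= n < X.+1) chi n * (n%:R^-1)%:C -
     \sum_(1 <= n < X.+1) chi n * (n%:R^-1 - pw (1 + d) n)%:C.
    rewrite -sumrB; apply: eq_bigr => n _; rewrite rmorphB/=; ring.
  apply: le_trans (cabsBD _ _) _; rewrite lerD2l.
  apply: le_trans (cabs_sum _ _ _) _.
  rewrite /harm mulr_sumr big_nat [leRHS]big_nat; apply: ler_sum => n /andP[n0 nX].
  rewrite cabsM cabs_real.
  apply: (@le_trans _ _ `|n%:R^-1 - pw (1 + d) n|).
    by rewrite ler_piMl ?(cabs_chi_le1 chiP).
  have i0 : 0 <= n%:R^-1 :> R by rewrite invr_ge0.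
  have e : n%:R^-1 - pw (1 + d) n = (1 - pw d n) * n%:R^-1 by rewrite pwD pw_1//; ring.
  rewrite e normrM [X in _ * X <= _]ger0_norm// ler_wpM2r//.
  rewrite ger0_norm ?subr_ge0 ?pw_le1//; last exact: ltW.
  have := expR_ge1Dx (- d * ln n%:R); rewrite -/(pw d n).
  have : d * ln n%:R <= d * ln X%:R.
    by rewrite ler_pM2l// ler_ln ?posrE ?ltr0n// ler_nat -ltnS.
  by rewrite mulNr; lra.
have h1 : cabs (\sum_(1 <= n < Y.+1) (pw (1 + d) n)%:C) ^+ 3 <= (1 + d^-1) ^+ 3.
  by rewrite lerXn2r ?nnegrE ?cabs_ge0// addr_ge0// invr_ge0 ltW.
set l := (_ + _ + _) in B1 *.
have l0 : 0 <= l by apply: le_trans B1; exact: cabs_ge0.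
have h2 : cabs (\sum_(1 <= n < Y.+1) chi n * (pw (1 + d) n)%:C) ^+ 4 <= l ^+ 4.
  by rewrite lerXn2r ?nnegrE ?cabs_ge0.
have e8 : 0 <= 256 * expR 8 :> R by rewrite mulr_ge0 ?expR_ge0.
apply: ler_pM; rewrite ?cabs_ge0//.
  by rewrite !mulr_ge0 ?exprn_ge0 ?cabs_ge0 ?expR_ge0.
apply: ler_pM; rewrite ?exprn_ge0 ?cabs_ge0//.
  by rewrite !mulr_ge0 ?exprn_ge0 ?cabs_ge0 ?expR_ge0.
by rewrite ler_wpM2l.
Qed.

End ComplexCharacter.

(** * Limits with an explicit rate *)

Section TailBoundedSequences.
Local Open Scope classical_set_scope.
Local Open Scope ring_scope.
Variables (R : realType) (u b : nat -> R) (M0 : nat).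
Hypothesis ub : forall M N, (M0 <= M)%N -> (M <= N)%N -> `|u N - u M| <= b M.
Hypothesis b0 : forall x, 0 < x -> exists M, (M0 <= M)%N /\ b M < x.

Lemma cvg_of_tail : cvgn u.
Proof.
apply/cauchy_cvgP; apply: cauchy_exP => x x0.
have [M [MM bM]] := b0 x0.
exists (u M); exists M => // N /= MN.
by rewrite -ball_normE /ball_ /= distrC (le_lt_trans (ub MM MN)).
Qed.

Lemma lim_of_tail M : (M0 <= M)%N -> `|limn u - u M| <= b M.
Proof.
move=> MM; have cu := cvg_of_tail.
have h1 : limn u <= u M + b M.
  apply: limr_le => //; exists M => // N /= MN.
  by have := ub MM MN; rewrite ler_norml => /andP[_]; lra.
have h2 : u M - b M <= limn u.
  apply: limr_ge => //; exists M => // N /= MN.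
  by have := ub MM MN; rewrite ler_norml => /andP[+ _]; lra.
by rewrite ler_norml; apply/andP; split; lra.
Qed.

End TailBoundedSequences.

(** * L-functions of real characters on the real axis *)

Section RealCharacter.
Local Open Scope complex_scope.
Local Open Scope classical_set_scope.
Local Open Scope ring_scope.
Variables (R : realType) (q : nat) (chi : nat -> R[i]).
Hypothesis chiP : dirichlet_char q chi.
Hypothesis chiN : ~ principal_char q chi.
Hypothesis chi_real : forall n, complex.Im (chi n) = 0.

Let a n := complex.Re (chi n).
Let chiE n : chi n = (a n)%:C.
Proof. by rewrite [LHS]complexE chi_real /= mulr0 addr0. Qed.

Let aM m n : a (m * n)%N = a m * a n.
Proof. by apply: (@complexI R); rewrite rmorphM/= -!chiE (chiM chiP). Qed.
Let a1 : a 1%N = 1.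
Proof. by apply: (@complexI R); rewrite -chiE (chi1 chiP). Qed.
Let a_le1 n : `|a n| <= 1.
Proof. by rewrite -cabs_real -chiE (cabs_chi_le1 chiP). Qed.

Definition Lsum (s : R) (N : nat) : R := \sum_(1 <= n < N.+1) a n * pw s n.

Let Lsum_tail (s : R) M N : 0 <= s -> (M <= N)%N ->
  `|Lsum s N - Lsum s M| <= q%:R * pw s M.+1.
Proof.
move=> s0 MN; rewrite -cabs_real.
have -> : (Lsum s N - Lsum s M)%:C = \sum_(M.+1 <= n < N.+1) chi n * (pw s n)%:C.
  rewrite /Lsum (@big_cat_nat _ _ _ M.+1)//= addrAC subrr add0r rmorph_sum/=.
  by apply: eq_bigr => n _; rewrite rmorphM/= chiE.
apply: (chi_tail chiP chiN) => n nM; last exact: pw_ge0.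
by apply: pw_le => //; apply: leq_trans nM.
Qed.

Let bnd_small (s x : R) : 0 < s -> 0 < x -> exists M, (0 <= M)%N /\ q%:R * pw s M.+1 < x.
Proof.
move=> s0 x0; have q0 : (0 < q)%N by case: chiP.
have q0' : 0 < q%:R :> R by rewrite ltr0n.
have y0 : 0 < x / (2 * q%:R) by rewrite divr_gt0// mulr_gt0.
have [Y [_ H]] := pw_small s0 y0; exists Y; split => //.
have := H Y.+1 (leqnSn _); rewrite ler_pdivlMr ?mulr_gt0// => h; lra.
Qed.

Definition Lfun (s : R) : R := limn (Lsum s).

Let Lsum_cvg (s : R) : 0 < s -> cvgn (Lsum s).
Proof.
move=> s0; apply: (@cvg_of_tail _ _ (fun M => q%:R * pw s M.+1) 0) => [M N _|x].
  exact: Lsum_tail (ltW s0).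
exact: bnd_small.
Qed.

Let Lfun_tail (s : R) M : 0 < s -> `|Lfun s - Lsum s M| <= q%:R * pw s M.+1.
Proof.
move=> s0; apply: (@lim_of_tail _ _ (fun M => q%:R * pw s M.+1) 0) => // [{}M N _|x].
  exact: Lsum_tail (ltW s0).
exact: bnd_small.
Qed.

Lemma Lfun_neq0_of_GRH (s : R) : GRH R -> 2^-1 < s < 1 -> Lfun s != 0.
Proof.
move=> [G _] s1; have /andP[s2 _] := s1.
have s0 : 0 < s by apply: lt_trans s2; rewrite invr_gt0.
have := G q chi chiP chiN (Complex s 0) s1 (Lfun s)%:C.
have e N : \sum_(1 <= n < N.+1) chi n * cpow_neg n (Complex s 0) = (Lsum s N)%:C.
  rewrite /Lsum rmorph_sum/=; apply: eq_bigr => n _; rewrite rmorphM/= -chiE.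
  by congr (_ * _); rewrite /cpow_neg /= mul0r cos0 sin0 mulr1 mulr0 oppr0.
have cv : cvgC (fun N => \sum_(1 <= n < N.+1) chi n * cpow_neg n (Complex s 0)) (Lfun s)%:C.
  split.
    under eq_fun do rewrite e; exact: Lsum_cvg.
  under eq_fun do rewrite e; exact: cvg_cst.
by move=> /(_ cv); apply: contraNneq => ->.
Qed.

Let Lsum_continuous N : continuous (fun s => Lsum s N).
Proof.
rewrite /Lsum; elim: N => [|N IH].
  rewrite (_ : (fun s => _) = cst 0); last by apply/funext => s; rewrite big_geq.
  exact: cst_continuous.
rewrite (_ : (fun s => _) = (fun s => \sum_(1 <= n < N.+1) a n * pw s n + a N.+1 * pw s N.+1)); last first.
  by apply/funext => s; rewrite big_nat_recr.
move=> s; apply: cvgD; first exact: IH.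
apply: cvgM; first exact: cvg_cst.
rewrite /pw; apply: continuous_cvg; first exact: continuous_expR.
by apply: cvgM; [apply: cvgN; exact: cvg_id|exact: cvg_cst].
Qed.

(** Uniform limit of continuous partial sums: to the right of 1/2 every tail is dominated by the
    tail bound at 1/2. *)
Let Lfun_continuous (s : R) : 2^-1 < s -> {for s, continuous Lfun}.
Proof.
move=> s2; apply/cvgrPdist_le => x x0.
have h0 : 0 < 2^-1 :> R by rewrite invr_gt0.
have x3 : 0 < x / 3 by rewrite divr_gt0.
have [M [_ HM]] := bnd_small h0 x3.
have mono t : 2^-1 < t -> q%:R * pw t M.+1 <= x / 3.
  move=> t2; apply: le_trans (ltW HM); rewrite ler_wpM2l//.
  have -> : t = 2^-1 + (t - 2^-1) by ring.
  by rewrite pwD ler_piMr ?pw_ge0// pw_le1// subr_ge0 ltW.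
have /cvgrPdist_le/(_ _ x3) cM := @Lsum_continuous M s.
near=> t.
have t2 : 2^-1 < t by near: t; exact: lt_nbhsr.
have c : `|Lsum s M - Lsum t M| <= x / 3 by near: t.
have h1 := le_trans (Lfun_tail M (lt_trans h0 s2)) (mono _ s2).
have h2 := le_trans (Lfun_tail M (lt_trans h0 t2)) (mono _ t2).
have -> : Lfun s - Lfun t = (Lfun s - Lsum s M) + (Lsum s M - Lsum t M) + (Lsum t M - Lfun t) by ring.
apply: le_trans (ler_normD _ _) _; apply: le_trans (lerD (ler_normD _ _) (lexx _)) _.
by rewrite [`|Lsum t M - _|]distrC; lra.
Unshelve. all: by end_near. Qed.

(** The finite Euler product [P] is a product of positive reals, so all long partial sums are at
    least 1 / (2 P), a bound that survives the limit. *)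
Let Lfun_gt0 (d : R) : 0 < d -> 0 < Lfun (1 + d).
Proof.
move=> d0; have d4 : 0 < d * 4^-1 by rewrite mulr_gt0// invr_gt0.
have [N [N0 HN]] := pw_small d0 d4.
have HN' : pw d N / d <= 4^-1 by rewrite ler_pdivrMr// mulrC HN.
have d1 : 0 <= 1 + d by rewrite addr_ge0// ltW.
pose f n := (a n * pw (1 + d) n)%:C.
have f1 : f 1%N = 1 by rewrite /f a1 pw_n1 mulr1.
have fM m n : (0 < m)%N -> (0 < n)%N -> f (m * n)%N = f m * f n.
  by move=> m0 n0; rewrite /f aM pwM// -rmorphM/=; congr (_%:C); ring.
have fw n : (0 < n)%N -> cabs (f n) <= pw (1 + d) n.
  by move=> n0; rewrite cabs_real normrM [`|pw _ _|]ger0_norm ?pw_ge0// ler_piMl ?pw_ge0.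
have [X0 H] := @euler_product R f d d0 f1 fM fw N N0 HN'.
pose P : R := \prod_(1 <= p < N.+1 | prime p) (1 - a p * pw (1 + d) p).
have EP : euler_prod f N = P%:C.
  rewrite /euler_prod /P rmorph_prod/=; apply: eq_bigr => p _.
  by rewrite rmorphB/= rmorph1.
have P0 : 0 < P.
  rewrite /P big_seq_cond; apply: prodr_gt0 => p /andP[_ pp].
  rewrite subr_gt0; apply: le_lt_trans (ler_norm _) _.
  rewrite normrM [`|pw _ _|]ger0_norm ?pw_ge0//.
  have p1 := prime_gt1 pp; have p0 := prime_gt0 pp.
  apply: (@le_lt_trans _ _ (p%:R^-1)); last by rewrite invf_lt1 ?ltr0n// ltr1n.
  rewrite -[leRHS]mul1r ler_pM ?pw_ge0//.
  by rewrite pwD pw_1// ler_piMr ?invr_ge0// pw_le1// ltW.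
have low X : (X0 <= X)%N -> 2^-1 / P <= Lsum (1 + d) X.
  move=> /H; have -> : \sum_(1 <= n < X.+1) f n = (Lsum (1 + d) X)%:C.
    by rewrite /Lsum rmorph_sum.
  rewrite EP -rmorphM/= -(rmorph1 (real_complex R)) -rmorphB/= cabs_real.
  rewrite ler_norml => /andP[h _]; rewrite ler_pdivrMr//.
  by move: h; move: (Lsum _ _ * P) => y; lra.
apply: (@lt_le_trans _ _ (2^-1 / P)); first by rewrite divr_gt0// invr_gt0.
apply: limr_ge; first by apply: Lsum_cvg; rewrite addr_gt0.
by exists X0 => // X /= /low.
Qed.

(** Intermediate values on [s, 2]: a negative value at s would create a zero, which is excluded by
    GRH left of 1, by hypothesis at 1, and by the Euler product right of 1. *)
Lemma Lfun_ge0_of_GRH (s : R) : GRH R -> Lfun 1 != 0 -> 2^-1 < s < 1 -> 0 <= Lfun s.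
Proof.
move=> G L1 s1; have /andP[s2 s3] := s1; rewrite leNgt; apply/negP => neg.
have pos : 0 < Lfun (1 + 1) by exact: Lfun_gt0.
have cont : {within `[s, 1 + 1], continuous Lfun}.
  apply: continuous_in_subspaceT => t; rewrite inE/= in_itv/= => /andP[st _].
  by apply: Lfun_continuous; apply: lt_le_trans st.
have le2 : s <= 1 + 1 by lra.
have [|c ci c0] := @IVT R Lfun s (1 + 1) 0 le2 cont.
  by rewrite ge_min (ltW neg) le_max (ltW pos) orbT.
move: ci; rewrite in_itv/= => /andP[sc c2].
have [c1|c1|c1] := ltgtP c 1.
- have := @Lfun_neq0_of_GRH c G; rewrite (lt_le_trans s2 sc) c1 => /(_ isT).
  by rewrite c0 eqxx.
- have := @Lfun_gt0 (c - 1); rewrite subr_gt0 => /(_ c1).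
  by rewrite addrC subrK c0 ltxx.
- by move: L1; rewrite -c1 c0 eqxx.
Qed.

Lemma cabs_L1_sum N :
  cabs (\sum_(1 <= n < N.+1) chi n * (n%:R^-1)%:C) = `|\sum_(1 <= n < N.+1) a n * n%:R^-1|.
Proof.
rewrite -cabs_real rmorph_sum/=; congr cabs.
by apply: eq_bigr => n _; rewrite rmorphM/= -chiE.
Qed.

(** To be used with c = |log_sum| / sqrt(q), whose positivity is supplied by the dual basis; this
    replaces an analytic proof that L(1, chi) is nonzero. *)
Lemma Lfun1_neq0 (c : R) : 0 < c ->
  (forall N, `|cabs (\sum_(1 <= n < N.+1) chi n * (n%:R^-1)%:C) - c| <= q%:R / N.+1%:R) ->
  Lfun 1 != 0.
Proof.
move=> c0 H; apply/eqP => L1.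
suff : c <= 0 by rewrite leNgt c0.
apply: (@le_add_inv_nat _ _ _ (2 * q%:R) 0) => N _.
have := H N; rewrite cabs_L1_sum ler_norml => /andP[h1 _].
have := Lfun_tail N ltr01; rewrite L1 sub0r normrN pw_1//.
have -> : Lsum 1 N = \sum_(1 <= n < N.+1) a n * n%:R^-1.
  by apply: eq_big_nat => n /andP[n0 _]; rewrite pw_1.
rewrite -mulrA; move: h1; move: (`|_|) (_ / _) => y z h1 h2; lra.
Qed.

(** * The lower bound at 1 for real characters *)

Section Hecke.
Variables (e : R) (D : nat).
Hypotheses (e0 : 0 < e) (e2 : e < 2^-1) (D0 : (0 < D)%N).
Let s := 1 - e.
Let x := (D * D)%N.
Let e01 : 0 < e < 1. Proof. by rewrite e0 (lt_trans e2)// invf_lt1// ltr1n. Qed.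
Let s0 : 0 < s. Proof. by rewrite /s subr_gt0; case/andP: e01. Qed.
Let x0 : (0 < x)%N. Proof. by rewrite muln_gt0 D0. Qed.

(* [u n] increases to [- zeta(s)], so that [Z >= 0] replaces [- zeta(s)]. *)
Let u n : R := pw (- e) n / e - \sum_(1 <= m < n.+1) pw s m.
Let Z := u x.

Let u_step n : (0 < n)%N -> 0 <= u n.+1 - u n <= pw s n - pw s n.+1.
Proof.
move=> n0; have /andP[h1 h2] := pw_incr e01 n0.
have -> : u n.+1 - u n = (pw (- e) n.+1 - pw (- e) n) / e - pw s n.+1.
  by rewrite /u big_nat_recr//=; ring.
apply/andP; split.
  by rewrite subr_ge0 ler_pdivlMr// mulrC.
by rewrite lerD2r ler_pdivrMr// mulrC.
Qed.

Let u_diff n k : (0 < n)%N -> (n <= k)%N -> 0 <= u k - u n <= pw s n - pw s k.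
Proof.
move=> n0 nk; rewrite -(subnKC nk); elim: (k - n)%N => [|j /andP[i1 i2]].
  by rewrite addn0 !subrr lexx.
have nj : (0 < n + j)%N by rewrite addn_gt0 n0.
have /andP[j1 j2] := u_step nj; rewrite addnS.
by apply/andP; split; lra.
Qed.

Let Z_ge0 : 0 <= Z.
Proof.
have /andP[h _] := u_diff (isT : 0 < 1)%N x0.
have : 0 <= u 1.
  rewrite /u big_nat1 !pw_n1 mul1r subr_ge0 -[leLHS]invr1 lef_pV2 ?posrE//.
  by case/andP: e01 => _ /ltW.
by rewrite /Z; lra.
Qed.

Let Z_le : Z <= pw (- e) x / e.
Proof. by rewrite gerBl; apply: sumr_ge0 => n _; exact: pw_ge0. Qed.

Let mono_e m n : (0 < m)%N -> (m <= n)%N -> pw (- e) m <= pw (- e) n.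
Proof.
move=> m0 mn; rewrite !pwN lef_pV2 ?posrE ?pw_gt0//.
by apply: pw_le => //; exact: ltW.
Qed.

(** Main term (x / d)^e / e with the constant -Z in the role of zeta(s). The two errors, from Z and
    from rounding x / d to n, both lie in [0, n^(-s)] and enter with opposite signs, so their
    difference is at most n^(-s) <= D^(-s). *)
Let inner d : (0 < d <= D)%N ->
  `|\sum_(1 <= m < (x %/ d).+1) pw s m - (pw (- e) x * pw e d / e - Z)| <= pw s D.
Proof.
move=> /andP[d0 dD]; set n := (x %/ d)%N.
have nD : (D <= n)%N by rewrite leq_divRL// leq_mul2l dD orbT.
have n0 : (0 < n)%N by apply: leq_trans nD.
have nx : (n <= x)%N by exact: leq_div.
have /andP[h1 h2] := u_diff n0 nx.
have pd : pw (- e) d * pw e d = 1 by rewrite pwN mulVf// gt_eqF// pw_gt0.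
have y1 : pw (- e) n <= pw (- e) x * pw e d.
  have le : pw (- e) (n * d) <= pw (- e) x.
    by apply: mono_e; rewrite ?muln_gt0 ?n0// leq_divM.
  rewrite pwM// in le; have := ler_wpM2r (pw_ge0 e d) le.
  by rewrite -mulrA pd mulr1.
have y2 : pw (- e) x * pw e d <= pw (- e) n.+1.
  have le : pw (- e) x <= pw (- e) (n.+1 * d).
    by apply: mono_e => //; rewrite ltnW// ltn_ceil.
  rewrite pwM// in le; have := ler_wpM2r (pw_ge0 e d) le.
  by rewrite -mulrA pd mulr1.
have /andP[_ h3] := pw_incr e01 n0.
have sD : pw s n <= pw s D by apply: pw_le => //; exact: ltW.
have -> : \sum_(1 <= m < n.+1) pw s m = pw (- e) n / e - u n by rewrite /u; ring.
have -> : pw (- e) n / e - u n - (pw (- e) x * pw e d / e - Z) =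
   (Z - u n) - (pw (- e) x * pw e d - pw (- e) n) / e by rewrite /Z; ring.
set t := _ / e.
have t0 : 0 <= t by rewrite divr_ge0 ?subr_ge0// ltW.
have t1 : t <= pw s n.
  rewrite ler_pdivrMr// [leRHS]mulrC; apply: le_trans h3.
  by rewrite lerD2r.
have sx := pw_ge0 s x.
rewrite -/Z in h1 h2.
by rewrite ler_norml; apply/andP; split; lra.
Qed.

(* Hyperbola method for the sum of [(1 * chi)(n) n ^ (- s)] over [n <= D ^ 2], which is at
   least its first term [1] as [1 * chi >= 0]; the term [- Z L(s)] has the good sign. *)
Lemma hecke_lower : 0 <= Lfun s ->
  1 <= pw (- e) D ^+ 2 / e * cabs (\sum_(1 <= n < D.+1) chi n * (n%:R^-1)%:C) +
     4 * q%:R * pw (- e) D ^+ 3 / (e * D%:R).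
Proof.
rewrite cabs_L1_sum => Ls0; have q0 : (0 < q)%N by case: chiP.
have q1 : 1 <= q%:R :> R by rewrite ler1n.
pose E := pw (- e) D.
have E1 : 1 <= E by rewrite /E -(pw_n1 (- e)); apply: mono_e.
have xE : pw (- e) x = E ^+ 2 by rewrite /x pwM.
have sDE : pw s D = E / D%:R by rewrite /s addrC pwD pw_1.
have ie0 : 0 < e^-1 by rewrite invr_gt0.
have Dp : 0 < D%:R^-1 :> R by rewrite invr_gt0 ltr0n.
have sumD : \sum_(1 <= n < D.+1) pw s n <= E / e by exact: pw_sum_le.
pose G d m := (a d * pw s d) * pw s m.
pose A := \sum_(1 <= d < x.+1) \sum_(1 <= m < (x %/ d).+1) G d m.
have A1 : 1 <= A.
  rewrite /A -(sum_sum_divisors G).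
  have t n : (0 < n)%N -> \sum_(d <- divisors n) G d (n %/ d)%N =
      pw s n * \sum_(d <- divisors n) a d.
    move=> n0; rewrite mulr_sumr big_seq [RHS]big_seq; apply: eq_bigr => d.
    rewrite -dvdn_divisors// => dn; rewrite /G -mulrA -pwM ?(dvdn_gt0 n0 dn)//.
      by rewrite mulnC divnK// mulrC.
    by rewrite divn_gt0 ?(dvdn_gt0 n0 dn)// dvdn_leq.
  rewrite big_ltn// t// pw_n1 mul1r (_ : divisors 1 = [:: 1%N])// big_seq1 a1.
  rewrite lerDl big_nat; apply: sumr_ge0 => n /andP[n1 _].
  have n0 : (0 < n)%N by apply: leq_trans n1.
  by rewrite t// mulr_ge0 ?pw_ge0// (sum_divisors_ge0 aM a1 a_le1).
have Dx : (D <= x)%N by rewrite leq_pmulr.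
have split : A = \sum_(1 <= d < D.+1) \sum_(1 <= m < (x %/ d).+1) G d m +
   \sum_(D.+1 <= d < x.+1) \sum_(1 <= m < (x %/ d).+1) G d m.
  by rewrite /A (@big_cat_nat _ _ _ D.+1).
(* For d <= D the sum over m is evaluated by [inner]: d^(-s) d^(-e) = 1 / d turns its main term into
   the partial sum at 1, and -Z multiplies the truncated L(s). *)
have B1 : \sum_(1 <= d < D.+1) \sum_(1 <= m < (x %/ d).+1) G d m <=
    E ^+ 2 / e * (\sum_(1 <= n < D.+1) a n * n%:R^-1) - Z * Lsum s D + E / D%:R * (E / e).
  rewrite -subr_ge0.
  have -> : E ^+ 2 / e * (\sum_(1 <= n < D.+1) a n * n%:R^-1) - Z * Lsum s D + E / D%:R * (E / e)
    - \sum_(1 <= d < D.+1) \sum_(1 <= m < (x %/ d).+1) G d m =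
    E / D%:R * (E / e) - \sum_(1 <= d < D.+1) (a d * pw s d) *
      (\sum_(1 <= m < (x %/ d).+1) pw s m - (pw (- e) x * pw e d / e - Z)).
    rewrite /Lsum !mulr_sumr -sumrB addrAC -sumrB [RHS]addrC -sumrN.
    congr (_ + _); rewrite big_nat [RHS]big_nat; apply: eq_bigr => d /andP[d0 _].
    rewrite /G -mulr_sumr xE.
    have -> : d%:R^-1 = pw s d * pw e d by rewrite -pwD /s subrK pw_1.
    by ring.
  rewrite subr_ge0; apply: le_trans (ler_norm _) _; apply: le_trans (ler_norm_sum _ _ _) _.
  rewrite -sDE; apply: le_trans (ler_wpM2l (pw_ge0 _ _) sumD).
  rewrite mulr_sumr big_nat [leRHS]big_nat; apply: ler_sum => d dD.
  rewrite normrM mulrC ler_pM//; first exact: inner.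
  by rewrite normrM [`|pw _ _|]ger0_norm ?pw_ge0// ler_piMl ?pw_ge0.
(* The nonnegativity of L(s) enters here: its partial sum can be negative only by the size of the
   tail. *)
have Ltail : - Lsum s D <= q%:R * (E / D%:R).
  have := Lfun_tail D s0; rewrite ler_norml => /andP[_ h].
  have : q%:R * pw s D.+1 <= q%:R * pw s D.
    by rewrite ler_wpM2l//; apply: pw_le => //; exact: ltW.
  by rewrite sDE; lra.
(* For d > D one has m <= D, and after exchanging the sums each sum over d is a character tail
   starting at D + 1. *)
have B2 : \sum_(D.+1 <= d < x.+1) \sum_(1 <= m < (x %/ d).+1) G d m <= q%:R * (E / D%:R) * (E / e).
  have ex : \sum_(D.+1 <= d < x.+1) \sum_(1 <= m < (x %/ d).+1) G d m =
      \sum_(1 <= m < D.+1) \sum_(D.+1 <= d < (x %/ m).+1) G d m.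
    transitivity (\sum_(D.+1 <= d < x.+1) \sum_(1 <= m < D.+1) (if (d * m <= x)%N then G d m else 0)).
      rewrite big_nat [RHS]big_nat; apply: eq_bigr => d /andP[dD _].
      have d0 : (0 < d)%N by apply: leq_trans dD.
      have le : ((x %/ d).+1 <= D.+1)%N.
        by rewrite ltnS -[leqRHS](mulnK D D0) leq_div2l// ltnW.
      rewrite [RHS](big_cat_nat _ le)//= [X in _ = _ + X]big_nat [X in _ = _ + X]big1 ?addr0.
        by apply: eq_big_nat => m /andP[_ mx]; rewrite mulnC -leq_divRL// -ltnS mx.
      by move=> m /andP[mx _]; rewrite mulnC -leq_divRL// leqNgt mx.
    rewrite exchange_big_nat/=; apply: eq_big_nat => m /andP[m0 mD]; rewrite ltnS in mD.
    have le1 : (D.+1 <= (x %/ m).+1)%N by rewrite ltnS leq_divRL// leq_mul2l mD orbT.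
    have le2 : ((x %/ m).+1 <= x.+1)%N by rewrite ltnS leq_div.
    rewrite [LHS](big_cat_nat le1 le2)/= [X in _ + X = _]big_nat [X in _ + X = _]big1 ?addr0.
      by apply: eq_big_nat => d /andP[_ dx]; rewrite -leq_divRL// -ltnS dx.
    by move=> d /andP[dx _]; rewrite -leq_divRL// leqNgt dx.
  rewrite ex; apply: le_trans (ler_norm _) _; apply: le_trans (ler_norm_sum _ _ _) _.
  have c0 : 0 <= q%:R * (E / D%:R) by rewrite mulr_ge0// divr_ge0// (le_trans ler01).
  apply: le_trans (ler_wpM2l c0 sumD); rewrite mulr_sumr.
  rewrite big_nat [leRHS]big_nat; apply: ler_sum => m /andP[m0 mD]; rewrite ltnS in mD.
  rewrite /G -mulr_suml normrM [`|pw s m|]ger0_norm ?pw_ge0// ler_wpM2r ?pw_ge0//.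
  have le1 : (D <= x %/ m)%N by rewrite leq_divRL// leq_mul2l mD orbT.
  have := Lsum_tail (ltW s0) le1.
  rewrite /Lsum (@big_cat_nat _ _ _ D.+1 1 (x %/ m).+1)//= addrAC subrr add0r => h.
  apply: (le_trans h); rewrite -sDE ler_wpM2l//; apply: pw_le => //; exact: ltW.
set S := \sum_(1 <= n < D.+1) a n * n%:R^-1 in B1 *.
have f1 : E ^+ 2 / e * S <= E ^+ 2 / e * `|S|.
  by rewrite ler_wpM2l ?ler_norm// divr_ge0 ?sqr_ge0// ltW.
have f2 : - (Z * Lsum s D) <= E ^+ 2 / e * (q%:R * (E / D%:R)).
  rewrite -mulrN; apply: le_trans (ler_wpM2l Z_ge0 Ltail) _.
  apply: ler_wpM2r; last by rewrite -xE; exact: Z_le.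
  by rewrite !mulr_ge0 ?invr_ge0// (le_trans ler01).
have t0 : 0 <= E ^+ 2 / e / D%:R by rewrite divr_ge0 ?divr_ge0 ?sqr_ge0 ?ler0n ?(ltW e0).
have g1 : E / D%:R * (E / e) <= q%:R * E ^+ 3 / (e * D%:R).
  have -> : E / D%:R * (E / e) = (E ^+ 2 / e / D%:R) * 1 by ring.
  have -> : q%:R * E ^+ 3 / (e * D%:R) = (E ^+ 2 / e / D%:R) * (q%:R * E) by rewrite invfM; ring.
  by rewrite ler_wpM2l// -[leLHS]mulr1 ler_pM.
have g2 : q%:R * (E / D%:R) * (E / e) <= q%:R * E ^+ 3 / (e * D%:R).
  have -> : q%:R * (E / D%:R) * (E / e) = (E ^+ 2 / e / D%:R) * q%:R by ring.
  have -> : q%:R * E ^+ 3 / (e * D%:R) = (E ^+ 2 / e / D%:R) * (q%:R * E) by rewrite invfM; ring.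
  by rewrite ler_wpM2l// ler_peMr.
have g3 : E ^+ 2 / e * (q%:R * (E / D%:R)) = q%:R * E ^+ 3 / (e * D%:R).
  by rewrite invfM; ring.
have g4 : 0 <= q%:R * E ^+ 3 / (e * D%:R).
  have E0 : 0 <= E := le_trans ler01 E1.
  by rewrite divr_ge0 ?mulr_ge0 ?exprn_ge0 ?ler0n ?(ltW e0).
have -> : 4 * q%:R * E ^+ 3 / (e * D%:R) = 4 * (q%:R * E ^+ 3 / (e * D%:R)) by ring.
rewrite g3 in f2; move: f2 g1 g2 g4 B1 B2 A1 f1; rewrite split.
move: (q%:R * E ^+ 3 / (e * D%:R)) (E / D%:R * (E / e)) (q%:R * (E / D%:R) * (E / e)) (Z * Lsum s D) (E ^+ 2 / e * S) (E ^+ 2 / e * `|S|).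
move=> *; lra.
Qed.



End Hecke.
End RealCharacter.

(** * Fourier coefficients of the dual basis *)

Section Duality.
Local Open Scope complex_scope.
Variables (R : realType) (q : nat) (G : {set 'I_q}) (bv : 'I_q -> 'I_q -> R).
Hypotheses (q_prime : prime q) (q_gt2 : (2 < q)%N) (GP : rep_set G) (bvP : dual_basis G bv).

Let q0 : (0 < q)%N. Proof. exact: prime_gt0. Qed.

Let G_gt0 k : k \in G -> (0 < k)%N. Proof. by case: GP => h _ _ _; exact: h. Qed.

Lemma sum_rep_set (V : zmodType) (F : nat -> V) :
  (forall k, (0 < k < q)%N -> F (q - k)%N = F k) ->
  \sum_(1 <= k < q) F k = (\sum_(k in G) F k) *+ 2.
Proof.
move=> Fe; pose r (k : 'I_q) : 'I_q := Ordinal (ltn_pmod (q - k) q0).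
have rE (k : 'I_q) : (0 < k)%N -> val (r k) = (q - k)%N.
  by move=> k0 /=; rewrite modn_small// ltn_subrL k0 q0.
have rK : involutive r.
  move=> k; apply: val_inj; have [k0|k0] := posnP k.
    by rewrite /= k0 subn0 modnn subn0 modnn.
  rewrite rE; first by rewrite rE// subKn// ltnW.
  by rewrite rE// subn_gt0.
have -> : \sum_(1 <= k < q) F k = \sum_(k < q | (0 < k)%N) F k.
  rewrite -(big_mkord (fun k => (0 < k)%N)) [RHS]big_mkcond [RHS]big_ltn//= add0r.
  by apply: eq_big_nat => k /andP[-> _].
rewrite (bigID (mem G))/= mulr2n; congr (_ + _).
  apply: eq_bigl => k; case kG: (k \in G); rewrite ?andbF// andbT; exact: G_gt0.
rewrite (reindex_inj (inv_inj rK))/=.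
have -> : \sum_(k in G) F k = \sum_(k in G) F (r k).
  apply: eq_bigr => k kG; have k0 := G_gt0 kG.
  by rewrite rE// Fe// k0 ltn_ord.
apply: eq_bigl => k; apply/andP/idP => [[rk nG]|kG].
  case: GP => _ _ /(_ (r k) rk)[rG|[l lG e] _]; first by rewrite rG in nG.
  have k0 : (0 < k)%N.
    by rewrite lt0n; apply: contraTneq rk => k0; rewrite /= k0 subn0 modnn.
  rewrite rE// in e; suff -> : k = l by [].
  by apply: val_inj => /=; have := ltn_ord k; lia.
have k0 := G_gt0 kG; have rk := rE k k0.
have kq := ltn_ord k.
split; first by rewrite -[X in (0 < X)%N]/(val (r k)) rk subn_gt0.
apply/negP => rG; case: GP => _ /(_ k (r k) kG rG) + _ _.
by rewrite -[nat_of_ord (r k)]/(val (r k)) rk subnKC ?eqxx// ltnW.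
Qed.

Let coG k : (k : 'I_q) \in G -> coprime k q.
Proof.
move=> kG; rewrite coprime_sym prime_coprime// gtnNdvd ?G_gt0//.
Qed.

Let ell (n : nat) : R := ln (cabs (zetaq R q ^+ n - 1)).

Let ell_modn n : ell (n %% q)%N = ell n.
Proof. by rewrite /ell -zetaqX_modn. Qed.

Let ell_even i m : (m <= q)%N -> ell (i * (q - m))%N = ell (i * m)%N.
Proof.
move=> mq; rewrite /ell [(i * _)%N]mulnC exprM -zetaq_conjX// -rmorphXn/= -exprM.
have -> z : z^* - 1 = (z - 1)^* :> R[i] by case: z => a b; apply/eqP; rewrite eq_complex /= !oppr0 !addr0 !eqxx.
by rewrite cabs_conj mulnC.
Qed.

Let zX1_neq0 n : coprime n q -> zetaq R q ^+ n - 1 != 0.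
Proof.
move=> co; rewrite subr_eq0 zetaqX_eq1//.
by move: co; rewrite coprime_sym prime_coprime.
Qed.

Let logbE (j k : 'I_q) : j \in G -> k \in G -> logb R j k = ell (k * j)%N - ell k.
Proof.
move=> jG kG; rewrite /logb /sigma_b cabsM cabsV ln_div ?posrE ?cabs_gt0//.
  by rewrite zX1_neq0// coprimeMl !coG.
by rewrite zX1_neq0// coG.
Qed.

Let Gm1_in j : j \in Gm1 G -> j \in G. Proof. by rewrite inE => /andP[]. Qed.

(** Multiplication by j permutes the residues, so the coordinates of the logarithm of a cyclotomic
    unit sum to 0. The dual vectors, lying in the same span, inherit this, which kills their
    coefficient at the trivial character. *)
Let sum_ell_mul j : j \in G -> \sum_(i in G) (ell (i * j)%N - ell i) = 0.
Proof.
move=> jG.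
have e1 : \sum_(0 <= i < q) ell (i * j)%N = \sum_(0 <= i < q) ell i.
  rewrite -[RHS](sum_residues_mul ell q0 (coG jG)); apply: eq_bigr => i _.
  by rewrite ell_modn mulnC.
have e2 : \sum_(1 <= i < q) (ell (i * j)%N - ell i) = 0.
  rewrite sumrB; apply/eqP; rewrite subr_eq0; apply/eqP.
  by move: e1; rewrite big_ltn// [RHS]big_ltn// mul0n => /addrI.
move: e2; rewrite (sum_rep_set (F := fun i => ell (i * j)%N - ell i)).
  by move/eqP; rewrite mulrn_eq0/= => /eqP.
move=> k /andP[_ kq]; rewrite ![(_ * j)%N]mulnC ell_even ?(ltnW kq)//; congr (_ - _).
by rewrite -[RHS](congr1 ell (mul1n k)) -ell_even ?(ltnW kq)// mul1n.
Qed.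

Variable j : 'I_q.
Hypothesis jP : j \in Gm1 G.
Let v := bv j.

Let sum_v : \sum_(i in G) v i = 0.
Proof.
have [[c cE] _] := bvP jP.
rewrite (eq_bigr (fun i => \sum_(j' in Gm1 G) c j' * logb R j' i)); last by move=> i /cE.
rewrite exchange_big/=; apply: big1 => j' /Gm1_in j'G; rewrite -mulr_sumr.
rewrite (eq_bigr (fun i : 'I_q => ell (i * j')%N - ell i)); last by move=> i iG; exact: logbE.
by rewrite sum_ell_mul// mulr0.
Qed.

Let W m := \sum_(i in G) v i * ell (i * m)%N.

(** The difference W m - W 1 is the inner product of v with b_m. At m = 1 both sides agree because j
    differs from 1, so the formula holds on all of [G] and can be summed against a character. *)
Let WE (m : 'I_q) : m \in G -> W m = W 1%N + (j == m)%:R.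
Proof.
move=> mG; have [m1|m1] := eqVneq (val m) 1%N.
  have -> : (j == m) = false.
    by apply/negbTE; move: jP; rewrite inE => /andP[_]; apply: contra => /eqP->; apply/eqP.
  by rewrite addr0 -m1.
have mP : m \in Gm1 G by rewrite inE mG.
have [_ /(_ m mP)] := bvP jP; rewrite /dotG => <-.
rewrite /W -big_split/=; apply: eq_bigr => i iG.
by rewrite logbE// muln1 /v; ring.
Qed.

Section OneCharacter.
Variable chi : nat -> R[i].
Hypotheses (chiP : dirichlet_char q chi) (chiN : ~ principal_char q chi).
Hypothesis chi_even : forall k, (k <= q)%N -> chi (q - k)%N = chi k.

Let vhat := \sum_(i in G) (v i)%:C * (chi i)^*.

Let chi0 : chi 0%N = 0.
Proof.
apply: (chi_ncoprime chiP); rewrite /coprime gcd0n; apply/eqP => h.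
by move: q_prime; rewrite h.
Qed.

Let two_neq0 (x : R[i]) : x *+ 2 = 0 -> x = 0.
Proof. by move/eqP; rewrite mulrn_eq0 /= => /eqP. Qed.

Let sum_chi_G : \sum_(m in G) chi m = 0.
Proof.
apply: two_neq0; rewrite -(sum_rep_set (F := chi)) => [|k /andP[_ kq]]; last first.
  by rewrite chi_even// ltnW.
by move: (sum_chi_period chiP chiN); rewrite big_ltn// chi0 add0r.
Qed.

Let sum_chi_ell i : i \in G ->
  (\sum_(m in G) chi m * (ell (i * m)%N)%:C) *+ 2 = (chi i)^* * log_sum q chi.
Proof.
move=> iG; rewrite -(sum_rep_set (F := fun m => chi m * (ell (i * m)%N)%:C)); last first.
  by move=> k /andP[_ kq]; rewrite chi_even ?(ltnW kq)// ell_even ?(ltnW kq).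
pose g m := chi m * (ell m)%:C.
have -> : \sum_(1 <= m < q) chi m * (ell (i * m)%N)%:C = \sum_(0 <= m < q) chi m * (ell (i * m)%N)%:C.
  by rewrite [RHS]big_ltn// chi0 mul0r add0r.
have -> : log_sum q chi = \sum_(0 <= m < q) g m.
  by rewrite /log_sum [RHS]big_ltn// /g chi0 mul0r add0r.
rewrite -(sum_residues_mul g q0 (coG iG)) mulr_sumr; apply: eq_bigr => m _.
rewrite /g ell_modn (chi_modn chiP) (chiM chiP) !mulrA [_^* * _]mulrC.
by rewrite (chi_mul_conj chiP (coG iG)) mul1r.
Qed.

(** The transform of [W] computed twice: by [WE] the constant W 1 is annihilated and chi(j) remains;
    as a multiplicative correlation of v and ell it is a product of transforms. The 2 appears
    because [log_sum] runs over all units, not over representatives. *)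
Lemma vhat_log_sum : vhat * log_sum q chi = (chi j) *+ 2.
Proof.
have e1 : \sum_(m in G) chi m * (W m)%:C = chi j.
  rewrite (eq_bigr (fun m : 'I_q => (W 1%N)%:C * chi m + chi m * ((j == m)%:R)%:C)); last first.
    by move=> m mG; rewrite WE// rmorphD/=; ring.
  rewrite big_split/= -mulr_sumr sum_chi_G mulr0 add0r (bigD1 j) ?Gm1_in//= eqxx.
  rewrite mulr1 big1 ?addr0// => m /andP[_ mj].
  by rewrite eq_sym (negbTE mj) mulr0.
rewrite -e1 /vhat mulr_suml -sumrMnl.
transitivity (\sum_(i in G) (v i)%:C * ((\sum_(m in G) chi m * (ell (i * m)%N)%:C) *+ 2)).
  by apply: eq_bigr => i iG; rewrite sum_chi_ell// mulrA.
under eq_bigr do rewrite mulrnAr mulr_sumr.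
rewrite [LHS]sumrMnl [RHS]sumrMnl exchange_big/=; congr (_ *+ 2).
apply: eq_bigr => m _; rewrite /W rmorph_sum/= mulr_sumr.
by apply: eq_bigr => i _; rewrite rmorphM/=; ring.
Qed.

(** Non-vanishing of L(1, chi) in disguise: a product equal to 2 chi(j) has no zero factor. *)
Lemma log_sum_neq0 : log_sum q chi != 0.
Proof.
apply/eqP => e; have := vhat_log_sum; rewrite e mulr0 => /esym/two_neq0.
by apply/eqP; apply: (chi_neq0 chiP); apply: coG; exact: Gm1_in.
Qed.

Lemma cabs_vhat : cabs vhat ^+ 2 = 4 / cabs (log_sum q chi) ^+ 2.
Proof.
have l0 : 0 < cabs (log_sum q chi) by rewrite cabs_gt0 log_sum_neq0.
have : cabs vhat * cabs (log_sum q chi) = 2.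
  rewrite -cabsM vhat_log_sum -[chi j *+ 2]mulr_natl cabsM (cabs_chi chiP) ?coG ?Gm1_in// mulr1.
  by rewrite -(rmorph_nat (real_complex R)) cabs_real normr_nat.
move=> e; have -> : cabs vhat = 2 / cabs (log_sum q chi) by rewrite -e mulfK// gt_eqF.
by rewrite exprMn exprVn; congr (_ * _); ring.
Qed.

End OneCharacter.

(** Parseval on a group of order h = q./2. The right-hand side no longer involves j, which already
    gives the equality of all norms. *)
Lemma dual_norm_eq (chi : nat -> nat -> R[i]) :
  (forall b, dirichlet_char q (chi b)) ->
  (forall b k, (k <= q)%N -> chi b (q - k)%N = chi b k) ->
  (forall n, coprime n q -> chi 0%N n = 1) ->
  (forall b, (0 < b < q./2)%N -> ~ principal_char q (chi b)) ->
  (forall m n, coprime m q -> coprime n q ->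
    (m != n %[mod q])%N -> ~~ (q %| m + n)%N ->
    \sum_(0 <= b < q./2) chi b m * (chi b n)^* = 0) ->
  (q./2)%:R * normG G (bv j) ^+ 2 =
  \sum_(1 <= b < q./2) 4 / cabs (log_sum q (chi b)) ^+ 2.
Proof.
move=> chiP chi_even chi0 chiN orth.
pose vhat b := \sum_(i in G) (v i)%:C * (chi b i)^*.
have h0 : (0 < q./2)%N by rewrite half_gt0 ltnW.
have -> : normG G (bv j) ^+ 2 = dotG G v v.
  rewrite /normG sqr_sqrtr// /dotG; apply: sumr_ge0 => i _.
  by rewrite -expr2 sqr_ge0.
have -> : \sum_(1 <= b < q./2) 4 / cabs (log_sum q (chi b)) ^+ 2 =
    \sum_(0 <= b < q./2) cabs (vhat b) ^+ 2.
  rewrite [RHS]big_ltn//.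
  have -> : vhat 0%N = 0.
    rewrite /vhat (eq_bigr (fun i => (v i)%:C)) => [|i iG].
      by rewrite -rmorph_sum/= sum_v.
    by rewrite chi0 ?coG// conjc1 mulr1.
  rewrite cabs0 expr0n add0r; apply: eq_big_nat => b b0.
  by rewrite (cabs_vhat (chiP b) (chiN b b0) (chi_even b)).
apply: (@complexI R); rewrite rmorph_sum/=.
transitivity (\sum_(0 <= b < q./2) \sum_(i in G) \sum_(k in G)
    ((v i)%:C * (v k)%:C) * (chi b k * (chi b i)^*)); last first.
  apply: eq_bigr => b _; rewrite sqr_cabs /vhat conj_sum mulr_suml; apply: eq_bigr => i _.
  rewrite mulr_sumr; apply: eq_bigr => k _.
  by rewrite conjM conjcK conjc_real; ring.
rewrite exchange_big/= /dotG mulr_sumr rmorph_sum/=; apply: eq_bigr => i iG.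
rewrite exchange_big/= (bigD1 i)//= [X in _ + X]big1 ?addr0 => [|k /andP[kG ki]].
  rewrite -mulr_sumr (eq_bigr (fun=> 1)) => [|b _]; last by rewrite (chi_mul_conj (chiP b)) ?coG.
  by rewrite sumr_const_nat subn0 !rmorphM/= rmorph_nat; ring.
rewrite -mulr_sumr orth ?mulr0 ?coG//.
  by rewrite !modn_small//.
apply/negP => /dvdnP[c e]; case: GP => _ /(_ k i kG iG) + _ _; apply/negP; rewrite negbK.
have := ltn_ord i; have := ltn_ord k; have := G_gt0 kG; have := G_gt0 iG.
move: e; case: c => [|[|c]]; rewrite ?mul0n ?mul1n; [lia|move=> -> *; exact: eqxx|].
by rewrite !mulSn; lia.
Qed.

End Duality.

(** * The sum of mu(n)^2 / n^2 *)

Section ZetaRatio.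
Local Open Scope classical_set_scope.
Local Open Scope ring_scope.
Variable R : realType.

Let z (k N : nat) : R := \sum_(1 <= n < N.+1) n%:R ^- k.
Local Notation mu := (@mu R).

Lemma mu_sqr01 n : mu n ^+ 2 = 0 \/ mu n ^+ 2 = 1.
Proof. by rewrite sqr_mu; case: squarefree; [right|left]. Qed.

Let mu_ge0 n : 0 <= mu n ^+ 2. Proof. exact: sqr_ge0. Qed.

(** Writing n = m d^2 with m squarefree factors the series of n^(-2) as the series of mu(m)^2 m^(-2)
    times that of d^(-4); this is the origin of zeta(2) / zeta(4). *)
Lemma squarefree_decomposition n : (0 < n)%N ->
  exists m d, [/\ mu m ^+ 2 = 1, (0 < m)%N, (0 < d)%N & (m * d ^ 2 = n)%N].
Proof.
move: n; apply: pfactor_ind => [|p k n pp pn n0 [m [d [m1 m0 d0 e]]]].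
  by exists 1%N, 1%N; rewrite mu1 expr1n.
have p0 := prime_gt0 pp.
have pm : ~~ (p %| m)%N by apply: contra pn => pm; rewrite -e dvdn_mulr.
have eh := odd_double_half k.+1; rewrite -mul2n in eh.
have dp : (0 < p ^ (k.+1)./2 * d)%N by rewrite muln_gt0 expn_gt0 p0.
have [ok|ok] := boolP (odd k.+1).
  exists (p * m)%N, (p ^ (k.+1)./2 * d)%N; split => //.
  - by rewrite -[p in (p * _)%N]expn1 (mu_pfactor R 0 pp pm m0) eqxx mulN1r sqrrN.
  - by rewrite muln_gt0 p0.
  have -> : (p ^ k.+1 = p * (p ^ (k.+1)./2 * p ^ (k.+1)./2))%N.
    by rewrite -[in LHS]eh ok expnD expn1 -expnD addnn mul2n.
  by rewrite -e -!mulnn; move: (p ^ _)%N => y; lia.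
exists m, (p ^ (k.+1)./2 * d)%N; split => //.
have -> : (p ^ k.+1 = p ^ (k.+1)./2 * p ^ (k.+1)./2)%N.
  by rewrite -[in LHS]eh (negbTE ok) add0n -expnD addnn mul2n.
by rewrite -e -!mulnn; move: (p ^ _)%N => y; lia.
Qed.

Lemma squarefree_logn m p : mu m ^+ 2 != 0 -> (logn p m <= 1)%N.
Proof.
rewrite sqr_mu pnatr_eq0 eqb0 negbK => /allP h.
have [pm|] := boolP (p \in primes m); first by rewrite (eqP (h p pm)).
rewrite -logn_gt0 lt0n negbK => /eqP->; by [].
Qed.

(** The valuations of m are 0 or 1, hence the parities of those of m d^2. *)
Lemma squarefree_decomposition_unique m d m' d' :
  mu m ^+ 2 != 0 -> mu m' ^+ 2 != 0 -> (0 < m)%N -> (0 < d)%N -> (0 < m')%N -> (0 < d')%N ->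
  (m * d ^ 2 = m' * d' ^ 2)%N -> m = m' /\ d = d'.
Proof.
move=> s s' m0 d0 m0' d0' e.
have L p : (logn p m + 2 * logn p d = logn p m' + 2 * logn p d')%N.
  by rewrite -!lognX -!lognM ?expn_gt0 ?d0 ?d0'// e.
split; apply: eqn_from_log => // p.
  by have := L p; have := squarefree_logn p s; have := squarefree_logn p s'; lia.
by have := L p; have := squarefree_logn p s; have := squarefree_logn p s'; lia.
Qed.

Let sum_delta (a m k : nat) (g : nat -> R) : (m <= a < k)%N ->
  \sum_(m <= n < k) (a == n)%:R * g n = g a.
Proof.
move=> ak; have ai : a \in index_iota m k by rewrite mem_index_iota.
rewrite (bigD1_seq a ai (iota_uniq _ _))/= eqxx mul1r big1 ?addr0// => n na.
by rewrite eq_sym (negbTE na) mul0r.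
Qed.

Let sum_delta_le1 (a m k : nat) : \sum_(m <= n < k) (a == n)%:R <= 1 :> R.
Proof.
have [ak|ak] := boolP (m <= a < k)%N.
  have := sum_delta (fun=> 1) ak; under eq_bigr do rewrite mulr1.
  by move->.
rewrite big_nat big1 ?ler01// => n nk; case: eqVneq => // e.
by rewrite e nk in ak.
Qed.

Let T N K : R := \sum_(1 <= m < N.+1) \sum_(1 <= d < K.+1) mu m ^+ 2 * (m * d ^ 2)%N%:R ^- 2.

Let TE N K : T N K = (\sum_(1 <= m < N.+1) mu m ^+ 2 / m%:R ^+ 2) * z 4 K.
Proof.
rewrite mulr_suml; apply: eq_bigr => m _; rewrite mulr_sumr; apply: eq_bigr => d _.
by rewrite natrM natrX exprMn -exprM invfM mulrA.
Qed.

(** Number of ways to write n as m d^2 with m squarefree, m <= N and d <= K. It is 0 or 1, and it is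
    1 for 0 < n <= N when K = N; this sandwiches the product of truncated series between truncations
    of zeta(2). *)
Let c N K n : R := \sum_(1 <= m < N.+1) \sum_(1 <= d < K.+1) (m * d ^ 2 == n)%N%:R * mu m ^+ 2.

Let c_exchange N K M : (N * K ^ 2 <= M)%N ->
  T N K = \sum_(1 <= n < M.+1) c N K n * n%:R ^- 2.
Proof.
move=> NK; under [RHS]eq_bigr do (rewrite mulr_suml; under eq_bigr do rewrite mulr_suml).
rewrite exchange_big_nat/=; apply: eq_big_nat => m /andP[m0 mN].
rewrite exchange_big_nat/=; apply: eq_big_nat => d /andP[d0 dK].
rewrite -(sum_delta (a := (m * d ^ 2)%N) (m := 1) (k := M.+1) (fun n => mu m ^+ 2 * n%:R ^- 2)).
  by apply: eq_bigr => n _; rewrite mulrA.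
rewrite muln_gt0 m0 expn_gt0 d0 ltnS (leq_trans _ NK)// leq_mul//.
by rewrite leq_exp2r.
Qed.

Let c_le1 N K n : c N K n <= 1.
Proof.
rewrite /c; have [[m0 [d0 [h1 h2 h3 h4]]]|H] := pselect (exists m0 d0,
    [/\ (0 < m0)%N, (0 < d0)%N, (m0 * d0 ^ 2 = n)%N & mu m0 ^+ 2 != 0]).
  apply: (@le_trans _ _ (\sum_(1 <= m < N.+1) \sum_(1 <= d < K.+1) ((m0 == m)%:R * (d0 == d)%:R : R))).
    rewrite big_nat [leRHS]big_nat; apply: ler_sum => m /andP[m1 _].
    rewrite big_nat [leRHS]big_nat; apply: ler_sum => d /andP[d1 _].
    have [e|_] := eqVneq (m * d ^ 2)%N n; last by rewrite mul0r mulr_ge0.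
    have [->|mm] := eqVneq (mu m ^+ 2) 0; first by rewrite mulr0 mulr_ge0.
    have [<- <-] := squarefree_decomposition_unique h4 mm h1 h2 m1 d1 (etrans h3 (esym e)).
    by rewrite !eqxx !mul1r; case: (mu_sqr01 m0) => ->.
  under eq_bigr do rewrite -mulr_sumr.
  rewrite -mulr_suml -[leRHS]mulr1 ler_pM ?sum_delta_le1//; apply: sumr_ge0 => ? _; exact: ler0n.
rewrite big_nat big1 ?ler01// => m /andP[m1 _]; rewrite big_nat big1// => d /andP[d1 _].
have [e|_] := eqVneq (m * d ^ 2)%N n; last by rewrite mul0r.
have [->|mm] := eqVneq (mu m ^+ 2) 0; first by rewrite mulr0.
by exfalso; apply: H; exists m, d.
Qed.

Let c_ge0 N K n : 0 <= c N K n.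
Proof. by apply: sumr_ge0 => m _; apply: sumr_ge0 => d _; rewrite mulr_ge0 ?ler0n ?mu_ge0. Qed.

Let c_ge1 N n : (0 < n <= N)%N -> 1 <= c N N n.
Proof.
move=> /andP[n0 nN]; have [m [d [m1 m0 d0 e]]] := squarefree_decomposition n0.
have mn : (m <= n)%N by rewrite -e leq_pmulr// expn_gt0 d0.
have dn : (d <= n)%N by rewrite -e; nia.
have mi : m \in index_iota 1 N.+1 by rewrite mem_index_iota m0 ltnS (leq_trans mn).
have di : d \in index_iota 1 N.+1 by rewrite mem_index_iota d0 ltnS (leq_trans dn).
rewrite /c (bigD1_seq m mi (iota_uniq _ _))/= (bigD1_seq d di (iota_uniq _ _))/= e eqxx m1 mulr1.
rewrite -addrA lerDl addr_ge0//; first by apply: sumr_ge0 => ? _; rewrite mulr_ge0 ?ler0n ?mu_ge0.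
by apply: sumr_ge0 => ? _; apply: sumr_ge0 => ? _; rewrite mulr_ge0 ?ler0n ?mu_ge0.
Qed.

Let z_lower N : z 2 N <= (\sum_(1 <= m < N.+1) mu m ^+ 2 / m%:R ^+ 2) * z 4 N.
Proof.
have NM : (N <= N * N ^ 2)%N by case: (posnP N) => [->//|N0]; rewrite leq_pmulr// expn_gt0 N0.
rewrite -TE (c_exchange (leqnn _)) (@big_cat_nat _ _ _ N.+1 1)//=.
apply: ler_wpDr; first by apply: sumr_ge0 => n _; rewrite mulr_ge0 ?c_ge0// invr_ge0 exprn_ge0.
rewrite /z [leLHS]big_nat [leRHS]big_nat; apply: ler_sum => n /andP[n0 nN].
by rewrite ler_peMl ?invr_ge0 ?exprn_ge0// c_ge1// n0.
Qed.

Let z_upper N K : (\sum_(1 <= m < N.+1) mu m ^+ 2 / m%:R ^+ 2) * z 4 K <= z 2 (N * K ^ 2).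
Proof.
rewrite -TE (c_exchange (leqnn _)) /z; apply: ler_sum => n _.
by rewrite ler_piMl ?c_le1// invr_ge0 exprn_ge0.
Qed.

Let zeta_natE k : zeta_nat R k = limn (z k).
Proof.
rewrite /zeta_nat; congr (limn _); apply/funext => N.
by rewrite /z big_add1.
Qed.

Let z_tail k M N : (1 < k)%N -> (1 <= M)%N -> (M <= N)%N -> `|z k N - z k M| <= M%:R^-1.
Proof.
move=> k1 M1 MN; rewrite /z (@big_cat_nat _ _ _ M.+1)//= addrAC subrr add0r.
rewrite ger0_norm; last by apply: sumr_ge0 => n _; rewrite invr_ge0 exprn_ge0.
apply: le_trans (@sum_inv_sqr_tail R M N.+1 M1).
rewrite big_nat [leRHS]big_nat; apply: ler_sum => n /andP[n0 _].
have n1 : (0 < n)%N by apply: leq_trans n0.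
by rewrite lef_pV2 ?posrE ?exprn_gt0 ?ltr0n// ler_weXn2l// ler1n.
Qed.

Let inv_small (x : R) : 0 < x -> exists M, (1 <= M)%N /\ M%:R^-1 < x.
Proof.
move=> x0; exists (Num.truncn x^-1).+1; split => //.
by rewrite invf_plt ?posrE ?ltr0n// truncnS_gt.
Qed.

Let zeta_tail k M : (1 < k)%N -> (1 <= M)%N -> `|zeta_nat R k - z k M| <= M%:R^-1.
Proof.
move=> k1 M1; rewrite zeta_natE.
by apply: (@lim_of_tail _ _ (fun M => M%:R^-1) 1) => // A B; exact: z_tail.
Qed.

Let z_le_zeta k M : (1 < k)%N -> z k M <= zeta_nat R k.
Proof.
move=> k1; rewrite zeta_natE; apply: limr_ge.
  by apply: (@cvg_of_tail _ _ (fun M => M%:R^-1) 1) => [A B|]; [exact: z_tail|exact: inv_small].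
exists M => // N /= MN; rewrite /z (@big_cat_nat _ _ _ M.+1 1 N.+1)//= lerDl.
by apply: sumr_ge0 => n _; rewrite invr_ge0 exprn_ge0.
Qed.

Lemma zeta_nat_ge1 k : (1 < k)%N -> 1 <= zeta_nat R k.
Proof.
move=> k1; apply: le_trans (z_le_zeta 1 k1).
by rewrite /z big_nat1 expr1n invr1.
Qed.

Lemma sum_sqr_mu_zeta N : (0 < N)%N ->
  `|\sum_(1 <= n < N.+1) mu n ^+ 2 / n%:R ^+ 2 - zeta_nat R 2 / zeta_nat R 4| <= N%:R^-1.
Proof.
move=> N0; set S := \sum_(1 <= n < _) _.
have z41 := zeta_nat_ge1 (isT : (1 < 4)%N).
have z40 : 0 < zeta_nat R 4 by apply: lt_le_trans z41.
have S0 : 0 <= S by apply: sumr_ge0 => n _; rewrite divr_ge0 ?mu_ge0 ?exprn_ge0.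
have lo : zeta_nat R 2 - N%:R^-1 <= S * zeta_nat R 4.
  have := zeta_tail (isT : (1 < 2)%N) N0; rewrite ler_norml => /andP[_ h].
  have h2 := z_lower N; rewrite -/S in h2.
  have h3 := ler_wpM2l S0 (z_le_zeta N (isT : (1 < 4)%N)).
  by lra.
(* N stays fixed while K grows; the factor 2 comes from 1 / K <= 2 / (K + 1). *)
have hi : S * zeta_nat R 4 <= zeta_nat R 2.
  apply: (@le_add_inv_nat _ _ _ (2 * S) 1) => K K1.
  have := zeta_tail (isT : (1 < 4)%N) K1; rewrite ler_norml => /andP[_ h].
  have h2 := z_upper N K; rewrite -/S in h2.
  have h3 := z_le_zeta (N * K ^ 2) (isT : (1 < 2)%N).
  have h4 : S * zeta_nat R 4 <= S * (z 4 K + K%:R^-1) by rewrite ler_wpM2l//; lra.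
  have h5 : S * K%:R^-1 <= 2 * S / K.+1%:R.
    rewrite [2 * S]mulrC -mulrA ler_wpM2l//.
    rewrite ler_pdivlMr ?ltr0n// mulrC ler_pdivrMr ?ltr0n//.
    by rewrite -natrM ler_nat; lia.
  by apply: (le_trans h4); rewrite mulrDr lerD// (le_trans h2).
have e : S - zeta_nat R 2 / zeta_nat R 4 = (S * zeta_nat R 4 - zeta_nat R 2) / zeta_nat R 4.
  by field; rewrite gt_eqF.
rewrite e normrM normfV (gtr0_norm z40) ler_pdivrMr//.
have iN : 0 <= N%:R^-1 :> R by rewrite invr_ge0.
have : N%:R^-1 * 1 <= N%:R^-1 * zeta_nat R 4 by rewrite ler_wpM2l.
rewrite mulr1 ler_norml => h; move: lo hi iN h.
move: (S * zeta_nat R 4) (N%:R^-1 * zeta_nat R 4) (N%:R^-1) => a b i lo hi iN h.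
by apply/andP; split; lra.
Qed.

End ZetaRatio.

(** * The mollified second moment *)

Section Mollifier.
Local Open Scope complex_scope.
Variables (R : realType) (q : nat) (chi : nat -> nat -> R[i]).
Hypotheses (q0 : (0 < q)%N).
Local Notation h := (q./2).
Hypothesis chi_le1 : forall b n, cabs (chi b n) <= 1.
Hypothesis chi_ncop : forall b n, ~~ coprime n q -> chi b n = 0.
Hypothesis chi_unit : forall b n, coprime n q -> cabs (chi b n) = 1.
Hypothesis chi_orth : forall m n, coprime m q -> coprime n q ->
  (m != n %[mod q])%N -> ~~ (q %| m + n)%N ->
  \sum_(0 <= b < h) chi b m * (chi b n)^* = 0.
Hypothesis chi_mul : forall b m n, chi b (m * n)%N = chi b m * chi b n.
Hypothesis chi_one : forall b, chi b 1%N = 1.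
Local Notation dpoly := (dpoly chi).

Lemma dpoly_ext (f : nat -> R) (N N' b : nat) : (forall n, (N < n)%N -> f n = 0) -> (N <= N')%N ->
  dpoly f N' b = dpoly f N b.
Proof.
move=> f0 NN; rewrite [LHS](@big_cat_nat _ _ _ N.+1 1 N'.+1)//= [X in _ + X]big_nat [X in _ + X]big1 ?addr0//.
by move=> n /andP[Nn _]; rewrite f0// mul0r.
Qed.

Lemma dpoly_mul (f g : nat -> R) (N M b : nat) :
  (forall n, (N < n)%N -> f n = 0) -> (forall n, (M < n)%N -> g n = 0) ->
  dpoly (dconv f g) (N * M) b = dpoly f N b * dpoly g M b.
Proof.
move=> fN gM; pose F n := (f n)%:C; pose G n := (g n)%:C.
have FN n : (N < n)%N -> F n = 0 by move=> Nn; rewrite /F fN.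
have GM n : (M < n)%N -> G n = 0 by move=> Mn; rewrite /G gM.
have hM m n : chi b (m * n)%N * ((m * n)%N%:R^-1)%:C =
    (chi b m * (m%:R^-1)%:C) * (chi b n * (n%:R^-1)%:C) :> R[i].
  by rewrite chi_mul natrM invfM rmorphM/=; ring.
rewrite -(sum_dconv (f := F) (g := G) (h := fun n => chi b n * (n%:R^-1)%:C) hM FN GM).
apply: eq_bigr => n _; congr (_ * _); rewrite /dconv rmorph_sum/=.
by apply: eq_bigr => d _; rewrite rmorphM.
Qed.

Variables (X : nat) (B U : R).
Hypotheses (X0 : (0 < X)%N) (B1 : 1 <= B) (U0 : 0 <= U).
Hypothesis divB : forall n, (0 < n <= X * (X * X))%N -> (size (divisors n))%:R <= B.
Let H := harm R (2 * (X * (X * X))).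
Let S b := \sum_(1 <= n < X.+1) chi b n * (n%:R^-1)%:C.
Hypothesis S_lower : forall b, (0 < b < h)%N -> S b != 0 /\ (cabs (S b))^-1 <= U.

(** Length of the product M D, the longest polynomial in use; taking it as common length lets one
    mean value estimate serve all products. *)
Let N3 := (X * (X * X))%N.
Let XN3 : (X <= N3)%N. Proof. by rewrite leq_pmulr// muln_gt0 X0. Qed.
Let X2N3 : (X * X <= N3)%N. Proof. by rewrite leq_pmull. Qed.

(* [M] and [S] have coefficients [fM] and [f1], and [fD] are those of [D = 1 - M S]: they
   vanish up to [X] by Moebius inversion. *)
Let fM n : R := if (n <= X)%N then mu R n else 0.
Let f1 n : R := if (n <= X)%N then 1 else 0.
Let fD n : R := (n == 1)%N%:R - dconv fM f1 n.
Let fMD := dconv fM fD.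

Let fM_le n : `|fM n| <= 1.
Proof. by rewrite /fM; case: ifP => _; rewrite ?norm_mu_le1// normr0. Qed.

Let f1_le n : `|f1 n| <= 1.
Proof. by rewrite /f1; case: ifP => _; rewrite ?normr1// normr0. Qed.

Let fM_supp n : (X < n)%N -> fM n = 0.
Proof. by move=> Xn; rewrite /fM leqNgt Xn. Qed.

Let f1_supp n : (X < n)%N -> f1 n = 0.
Proof. by move=> Xn; rewrite /f1 leqNgt Xn. Qed.

Let conv_supp (f g : nat -> R) N M n : (forall n, (N < n)%N -> f n = 0) ->
  (forall n, (M < n)%N -> g n = 0) -> (N * M < n)%N -> dconv f g n = 0.
Proof.
move=> fN gM NM; have n0 : (0 < n)%N by apply: leq_trans NM.
rewrite /dconv big_seq big1// => d; rewrite -dvdn_divisors// => dn.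
have [Nd|dN] := ltnP N d; first by rewrite fN// mul0r.
rewrite gM ?mulr0// ltnNge; apply: contraL NM => le.
by rewrite -leqNgt -(divnK dn) mulnC leq_mul.
Qed.

Let fD_small n : (0 < n <= X)%N -> fD n = 0.
Proof.
move=> /andP[n0 nX]; rewrite /fD -(sum_mu_divisors R n0); apply/eqP; rewrite subr_eq0; apply/eqP.
rewrite /dconv big_seq [RHS]big_seq; apply: eq_bigr => d; rewrite -dvdn_divisors// => dn.
rewrite /fM /f1 (leq_trans (dvdn_leq n0 dn) nX) (leq_trans _ nX) ?mulr1//.
exact: leq_div.
Qed.

Let fD_supp n : (X * X < n)%N -> fD n = 0.
Proof.
move=> Xn; rewrite /fD (conv_supp fM_supp f1_supp Xn) subr0.
have -> : (n == 1)%N = false by apply/negbTE; rewrite gtn_eqF// (leq_ltn_trans _ Xn)// muln_gt0 X0.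
by [].
Qed.

Let sz_sum (n : nat) : (size (divisors n))%:R = \sum_(d <- divisors n) 1 :> R.
Proof. by rewrite big_const_seq count_predT iter_addr_0. Qed.

Let fD_le n : (0 < n <= N3)%N -> `|fD n| <= B.
Proof.
move=> nN; have /andP[n0 _] := nN.
have [nX|Xn] := leqP n X; first by rewrite fD_small ?n0// normr0 (le_trans ler01).
have -> : fD n = - dconv fM f1 n.
  by rewrite /fD gtn_eqF ?sub0r// (leq_ltn_trans X0).
rewrite normrN; apply: le_trans (divB nN); rewrite sz_sum.
apply: le_trans (ler_norm_sum _ _ _) _; apply: ler_sum => d _.
by rewrite normrM -[leRHS]mulr1 ler_pM.
Qed.

Let fMD_le n : (0 < n <= N3)%N -> `|fMD n| <= B ^+ 2.
Proof.
move=> nN; have /andP[n0 nN3] := nN; have B0 : 0 <= B := le_trans ler01 B1.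
apply: (@le_trans _ _ ((size (divisors n))%:R * B)); last by rewrite expr2 ler_wpM2r// divB.
rewrite sz_sum mulr_suml /fMD /dconv; apply: le_trans (ler_norm_sum _ _ _) _.
rewrite big_seq [leRHS]big_seq; apply: ler_sum => d; rewrite -dvdn_divisors// => dn.
rewrite normrM ler_pM ?fM_le// fD_le// divn_gt0 ?(dvdn_gt0 n0 dn)//.
by rewrite dvdn_leq// (leq_trans (leq_div _ _)).
Qed.

Let fMD_small n : (0 < n <= X)%N -> fMD n = 0.
Proof.
move=> /andP[n0 nX]; rewrite /fMD /dconv big_seq big1// => d; rewrite -dvdn_divisors// => dn.
rewrite fD_small ?mulr0// divn_gt0 ?(dvdn_gt0 n0 dn)// dvdn_leq//=.
exact: leq_trans (leq_div _ _) nX.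
Qed.

Let M b := dpoly fM N3 b.
Let D b := dpoly fD N3 b.
Let MD b := dpoly fMD N3 b.

Let MDE b : MD b = M b * D b.
Proof.
rewrite /M (dpoly_ext b fM_supp XN3) /D (dpoly_ext b fD_supp X2N3).
by rewrite -(dpoly_mul b fM_supp fD_supp).
Qed.

Let DE b : D b = 1 - M b * S b.
Proof.
rewrite /M (dpoly_ext b fM_supp XN3) /D (dpoly_ext b fD_supp X2N3).
have -> : S b = dpoly f1 X b.
  by apply: eq_big_nat => n /andP[_ nX]; rewrite /f1 -ltnS nX rmorph1 mul1r.
rewrite -(dpoly_mul b fM_supp f1_supp).
have XX : (0 < X * X)%N by rewrite muln_gt0 X0.
have -> : (1 : R[i]) = dpoly (fun n => (n == 1)%N%:R) (X * X) b.
  rewrite /dpoly big_ltn// eqxx chi_one invr1 !rmorph1 !mulr1 big_nat big1 ?addr0//.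
  by move=> n /andP[n1 _]; rewrite gtn_eqF// rmorph0 mul0r.
rewrite -sumrB; apply: eq_bigr => n _; rewrite -mulrBl; congr (_ * _).
by rewrite /fD rmorphB.
Qed.

(** For coefficients of size at most [B ^+ 2], [err] is the off-diagonal contribution per character
    and [tail] the diagonal one from n > X. *)
Let err := 6 * B ^+ 4 * H ^+ 2 / q%:R.
Let tail := B ^+ 4 / X%:R.

Let B0 : 0 <= B. Proof. exact: le_trans ler01 B1. Qed.
Let B2 : 1 <= B ^+ 2. Proof. by rewrite exprn_ege1. Qed.
Let q0' : 0 < q%:R :> R. Proof. by rewrite ltr0n. Qed.

Let mv (f g : nat -> R) (Bf Bg : R) :
  (forall n, (0 < n <= N3)%N -> `|f n| <= Bf) -> (forall n, (0 < n <= N3)%N -> `|g n| <= Bg) ->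
  0 <= Bf -> 0 <= Bg -> Bf <= B ^+ 2 -> Bg <= B ^+ 2 ->
  cabs (\sum_(0 <= b < h) dpoly f N3 b * (dpoly g N3 b)^* -
    (h%:R * \sum_(1 <= n < N3.+1 | coprime n q) f n * g n / n%:R ^+ 2)%:C)
  <= h%:R * err.
Proof.
move=> fB gB f0 g0 fB2 gB2.
apply: le_trans (mean_value q0 chi_le1 chi_ncop chi_unit chi_orth fB gB f0 g0) _.
rewrite ler_wpM2l// /err -/H.
have -> : 6 * B ^+ 4 * H ^+ 2 / q%:R = (B ^+ 2 * B ^+ 2) * (6 * H ^+ 2 / q%:R) by ring.
by rewrite ler_wpM2r ?ler_pM// divr_ge0// mulr_ge0// sqr_ge0.
Qed.

Let ms (f : nat -> R) (Bf : R) :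
  (forall n, (0 < n <= N3)%N -> `|f n| <= Bf) -> 0 <= Bf -> Bf <= B ^+ 2 ->
  `|\sum_(0 <= b < h) cabs (dpoly f N3 b) ^+ 2 -
     h%:R * \sum_(1 <= n < N3.+1 | coprime n q) f n * f n / n%:R ^+ 2| <= h%:R * err.
Proof.
move=> fB f0 fB2; apply: le_trans (mv fB fB f0 f0 fB2 fB2).
rewrite -cabs_real rmorphB/= rmorph_sum/=.
by under eq_bigr do rewrite sqr_cabs.
Qed.

Let ms_small (f : nat -> R) (Bf : R) :
  (forall n, (0 < n <= N3)%N -> `|f n| <= Bf) -> 0 <= Bf -> Bf <= B ^+ 2 ->
  (forall n, (0 < n <= X)%N -> f n = 0) ->
  \sum_(0 <= b < h) cabs (dpoly f N3 b) ^+ 2 <= h%:R * (err + tail).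
Proof.
move=> fB f0 fB2 fs; have := ms fB f0 fB2; rewrite ler_norml => /andP[_ h1].
suff h2 : \sum_(1 <= n < N3.+1 | coprime n q) f n * f n / n%:R ^+ 2 <= tail.
  rewrite lerBlDr in h1; apply: (le_trans h1); rewrite mulrDr lerD2l.
  by rewrite ler_wpM2l.
rewrite big_mkcond (@big_cat_nat _ _ _ X.+1)//= [X in X + _]big_nat [X in X + _]big1 ?add0r; last first.
  by move=> n nX; rewrite fs// !mul0r if_same.
apply: (@le_trans _ _ (\sum_(X.+1 <= n < N3.+1) B ^+ 4 * n%:R ^- 2)); last first.
  by rewrite -mulr_sumr ler_wpM2l ?exprn_ge0// sum_inv_sqr_tail.
rewrite big_nat [leRHS]big_nat; apply: ler_sum => n /andP[Xn nN].
have i0 : 0 <= n%:R ^- 2 :> R by rewrite invr_ge0 exprn_ge0.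
case: ifP => _; last by rewrite mulr_ge0// exprn_ge0.
rewrite ler_wpM2r//; apply: le_trans (ler_norm _) _; rewrite normrM.
have -> : B ^+ 4 = B ^+ 2 * B ^+ 2 by ring.
have fn : `|f n| <= B ^+ 2.
  by apply: le_trans fB2; apply: fB; rewrite (leq_ltn_trans _ Xn).
by rewrite ler_pM.
Qed.

Let w b := (S b)^-1.

(* From [w = M + D w]: [|w|^2 = |M|^2 + 2 Re (M^* D w) + |D w|^2], and substituting once
   more, [M^* D w = |M|^2 D + M^* D^2 w], whose last term is bounded by [|M D| |D| |w|]. *)
Let w_expand b : (0 < b < h)%N ->
  `|cabs (w b) ^+ 2 - cabs (M b) ^+ 2 - 2 * complex.Re (MD b * (M b)^*)| <=
  U * (cabs (MD b) ^+ 2 + cabs (D b) ^+ 2) + U ^+ 2 * cabs (D b) ^+ 2.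
Proof.
move=> bh; have [Sn SU] := S_lower bh.
have wU : cabs (w b) <= U by rewrite /w cabsV.
have we : w b = M b + D b * w b.
  by rewrite DE /w mulrBl mul1r mulfK//; ring.
have MDb := MDE b.
have e : cabs (w b) ^+ 2 = cabs (M b) ^+ 2 + 2 * complex.Re (MD b * (M b)^*) +
    2 * complex.Re ((M b)^* * D b ^+ 2 * w b) + cabs (D b * w b) ^+ 2.
  have e1 : cabs (w b) ^+ 2 = cabs (M b) ^+ 2 + 2 * complex.Re ((M b)^* * (D b * w b)) +
     cabs (D b * w b) ^+ 2.
    rewrite [in LHS]we !cabs_sqr; case: (M b) => x y; case: (D b * w b) => u v /=; ring.
  rewrite e1; congr (_ + _); rewrite -addrA; congr (_ + _).
  rewrite -mulrDr -ReD; congr (2 * complex.Re _).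
  rewrite [in LHS]we MDb; ring.
rewrite e.
have -> (x y z t : R) : x + y + z + t - x - y = z + t by ring.
apply: le_trans (ler_normD _ _) _; apply: lerD.
  have -> : (M b)^* * D b ^+ 2 * w b = ((M b)^* * D b) * (D b * w b) by ring.
  rewrite normrM ger0_norm//.
  apply: (@le_trans _ _ (2 * (cabs (MD b) * (cabs (D b) * U)))).
    rewrite ler_wpM2l//; apply: le_trans (Re_le_cabs _) _.
    rewrite !cabsM cabs_conj -cabsM -MDb ler_wpM2l ?cabs_ge0//.
    by rewrite ler_wpM2l ?cabs_ge0.
  have := mulr_ge0 U0 (sqr_ge0 (cabs (MD b) - cabs (D b))).
  by rewrite -subr_ge0 => t; rewrite -subr_ge0; apply: le_trans t _; rewrite le_eqVlt; apply/orP; left; apply/eqP; ring.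
rewrite ger0_norm ?sqr_ge0// cabsM exprMn mulrC ler_wpM2r ?sqr_ge0//.
by rewrite lerXn2r ?nnegrE ?cabs_ge0.
Qed.

(** Trivial bound, meant for the principal character b = 0: it has no place in the moment of 1 / S
    but is needed to complete the orthogonality relations. *)
Let dpoly_le (f : nat -> R) (Bf : R) b : 0 <= Bf ->
  (forall n, (0 < n <= N3)%N -> `|f n| <= Bf) -> cabs (dpoly f N3 b) <= Bf * H.
Proof.
move=> Bf0 fB; apply: le_trans (cabs_sum _ _ _) _.
apply: (@le_trans _ _ (Bf * harm R N3)); last first.
  by rewrite ler_wpM2l// /H harm_le// leq_pmull.
rewrite /harm mulr_sumr big_nat [leRHS]big_nat; apply: ler_sum => n nN.
rewrite !cabsM cabs_real cabs_real [`|n%:R^-1|]ger0_norm ?invr_ge0//.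
rewrite ler_pM ?mulr_ge0 ?cabs_ge0 ?invr_ge0 ?fB//.
by rewrite ler_piMl ?invr_ge0.
Qed.

(** The bound lists the mean values of |M|^2 and of the doubled cross term (3 = 1 + 2), the
    principal character, and the remainder of [w_expand], in which M D and D have mean square at
    most [err + tail]. *)
Lemma mollified_second_moment : (0 < h)%N ->
  `|\sum_(1 <= b < h) cabs (S b) ^- 2 -
    h%:R * \sum_(1 <= n < X.+1 | coprime n q) mu R n ^+ 2 / n%:R ^+ 2|
  <= 3 * h%:R * err + 3 * B ^+ 4 * H ^+ 2 + (2 * U + U ^+ 2) * (h%:R * (err + tail)).
Proof.
move=> h0.
have H0 : 0 <= H by exact: harm_ge0.
have B4 : 1 <= B ^+ 4 by rewrite exprn_ege1.
have BB : B <= B ^+ 2 by rewrite expr2 ler_peMl.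
have M1 : forall n, (0 < n <= N3)%N -> `|fM n| <= 1 by move=> n _; exact: fM_le.
have diag : \sum_(1 <= n < N3.+1 | coprime n q) fM n * fM n / n%:R ^+ 2 =
    \sum_(1 <= n < X.+1 | coprime n q) mu R n ^+ 2 / n%:R ^+ 2.
  rewrite big_mkcond (@big_cat_nat _ _ _ X.+1)//= [X in _ + X]big_nat [X in _ + X]big1 ?addr0.
    rewrite [RHS]big_mkcond; apply: eq_big_nat => n /andP[_ nX].
    by rewrite /fM -ltnS nX expr2.
  by move=> n /andP[Xn _]; rewrite fM_supp// !mul0r if_same.
have cM := ms M1 ler01 B2; rewrite diag in cM.
(* No diagonal contribution: the coefficients of M live on n <= X, those of M D on n > X. *)
have cMD : cabs (\sum_(0 <= b < h) MD b * (M b)^*) <= h%:R * err.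
  have := mv fMD_le M1 (sqr_ge0 _) ler01 (lexx _) B2.
  rewrite [X in h%:R * X]big1_seq ?mulr0 ?subr0// => n; rewrite mem_index_iota => /andP[_ /andP[n0 _]].
  have [nX|Xn] := leqP n X; first by rewrite fMD_small ?n0// !mul0r.
  by rewrite fM_supp// mulr0 mul0r.
have sD := ms_small fD_le B0 BB fD_small.
have sMD := ms_small fMD_le (sqr_ge0 _) (lexx _) fMD_small.
pose A b := cabs (M b) ^+ 2 + 2 * complex.Re (MD b * (M b)^*).
pose Y b := U * (cabs (MD b) ^+ 2 + cabs (D b) ^+ 2) + U ^+ 2 * cabs (D b) ^+ 2.
have Y0 b : 0 <= Y b.
  by apply: addr_ge0; apply: mulr_ge0; rewrite ?addr_ge0 ?sqr_ge0.
have s1 : `|\sum_(1 <= b < h) cabs (S b) ^- 2 - \sum_(1 <= b < h) A b| <= \sum_(0 <= b < h) Y b.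
  rewrite -sumrB [leRHS]big_ltn//; apply: ler_wpDl => //.
  apply: le_trans (ler_norm_sum _ _ _) _; rewrite [leLHS]big_nat [leRHS]big_nat.
  apply: ler_sum => b bh; apply: le_trans (w_expand bh).
  by rewrite /A /w cabsV exprVn opprD addrA.
have s2 : \sum_(0 <= b < h) Y b <= (2 * U + U ^+ 2) * (h%:R * (err + tail)).
  rewrite /Y big_split/= -!mulr_sumr big_split/=.
  have t1 := ler_wpM2l U0 (lerD sMD sD).
  have t2 := ler_wpM2l (sqr_ge0 U) sD.
  apply: le_trans (lerD t1 t2) _; rewrite le_eqVlt; apply/orP; left; apply/eqP; ring.
have s3 : `|A 0%N| <= 3 * B ^+ 4 * H ^+ 2.
  have m0 := dpoly_le 0 ler01 M1; rewrite mul1r -/(M 0%N) in m0.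
  have md0 := dpoly_le 0 (sqr_ge0 B) fMD_le; rewrite -/(MD 0%N) in md0.
  apply: le_trans (ler_normD _ _) _.
  have t1 : `|cabs (M 0%N) ^+ 2| <= B ^+ 4 * H ^+ 2.
    rewrite ger0_norm ?sqr_ge0// -[leLHS]mul1r ler_pM ?sqr_ge0//.
    by rewrite lerXn2r ?nnegrE ?cabs_ge0.
  have t2 : `|complex.Re (MD 0%N * (M 0%N)^*)| <= B ^+ 4 * H ^+ 2.
    apply: le_trans (Re_le_cabs _) _; rewrite cabsM cabs_conj.
    apply: le_trans (ler_pM (cabs_ge0 _) (cabs_ge0 _) md0 m0) _.
    have -> : B ^+ 2 * H * H = B ^+ 2 * H ^+ 2 by ring.
    by rewrite ler_wpM2r ?sqr_ge0// ler_weXn2l.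
  have -> x : `|2 * x| = 2 * `|x| :> R by rewrite normrM (ger0_norm (ler0n R 2)).
  by rewrite -[3 * _ * _]mulrA; lra.
have s4 : \sum_(0 <= b < h) A b = A 0%N + \sum_(1 <= b < h) A b by rewrite big_ltn.
have s5 : \sum_(0 <= b < h) A b = \sum_(0 <= b < h) cabs (M b) ^+ 2 +
    2 * complex.Re (\sum_(0 <= b < h) MD b * (M b)^*).
  by rewrite /A big_split/= -mulr_sumr Re_sum.
have s6 := le_trans (Re_le_cabs _) cMD.
move: s1 s3 s6 cM; rewrite !ler_norml => /andP[a1 a2] /andP[b1 b2] /andP[c1 c2] /andP[d1 d2].
rewrite -/(M _) in d1 d2.
move: s4 s5 a1 a2 b1 b2 c1 c2 d1 d2 s2.
have -> : 3 * h%:R * err = 3 * (h%:R * err) by ring.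
move: (\sum_(1 <= b < h) cabs (S b) ^- 2) (\sum_(1 <= b < h) A b) (\sum_(0 <= b < h) Y b)
  (\sum_(0 <= b < h) A b) (A 0%N) (3 * B ^+ 4 * H ^+ 2) (h%:R * err)
  ((2 * U + U ^+ 2) * (h%:R * (err + tail))) (complex.Re _) => x1 x2 x3 x4 x5 x6 x7 x8 x9.
move: (\sum_(0 <= b < h) cabs (M b) ^+ 2) (h%:R * _) => x10 x11 *.
by apply/andP; split; lra.
Qed.

End Mollifier.

(** * A uniform lower bound for the truncated L(1, chi) *)

Section LowerBound.
Local Open Scope complex_scope.
Variable R : realType.

Lemma pwNE (a : R) (q : nat) : pw (- a) q = expR (a * ln q%:R).
Proof. by rewrite /pw opprK. Qed.

Lemma pwNX (a : R) (q k : nat) : pw (- a) q ^+ k = pw (- (k%:R * a)) q.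
Proof. by rewrite !pwNE -expRM_natl mulrA. Qed.

Lemma pwN_ge1 (a : R) (q : nat) : 0 < a -> (0 < q)%N -> 1 <= pw (- a) q.
Proof.
move=> a0 q0; rewrite pwNE -[leLHS]expR0 ler_expR mulr_ge0//; first exact: ltW.
by rewrite ln_ge0// ler1n.
Qed.

Lemma pwN_le_q (a : R) (q : nat) : a <= 1 -> (0 < q)%N -> pw (- a) q <= q%:R.
Proof.
move=> a1 q0; rewrite pwNE -[leRHS]lnK ?posrE ?ltr0n// ler_expR.
by rewrite ler_piMl// ln_ge0// ler1n.
Qed.

Lemma ln_le_pwN (a : R) (q : nat) : 0 < a -> ln q%:R <= pw (- a) q / a.
Proof.
move=> a0; rewrite ler_pdivlMr// mulrC pwNE.
by have := expR_ge1Dx (a * ln q%:R); lra.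
Qed.

Lemma real_of_principal_sqr (q : nat) (chi : nat -> R[i]) : dirichlet_char q chi ->
  principal_char q (fun n => chi n ^+ 2) -> forall n, complex.Im (chi n) = 0.
Proof.
move=> chiP P n; have [co|nc] := boolP (coprime n q).
  have /eqP := P n co; rewrite -[1](expr1n _ 2) eqf_sqr.
  by move=> /orP[] /eqP -> /=; rewrite ?oppr0.
by rewrite (chi_ncoprime chiP nc).
Qed.

(** Let T = q^a; a <= 1/9 gives T^9 <= q. Assume |S| < T^(-8). For non-real [chi] and d = T^(-10),
    the zeta factor costs T^30, the fourth power gains T^(-32) as d times two logarithms is
    O(T^(-8)), and the chi^2 factor costs T: in total C / T, absurd once T > C. For real [chi], T^6
    |S| / a and the error of [hecke_lower] are at most T^(-2) / a and 4 T^(-2) / a, absurd once T >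
    5 / a. *)
Lemma L1_lower_bound (a : R) : GRH R -> 0 < a -> a <= 9^-1 ->
  exists T0 : R, forall (q : nat) (chi : nat -> R[i]), prime q ->
    dirichlet_char q chi -> ~ principal_char q chi ->
    (forall k, (k <= q)%N -> chi (q - k)%N = chi k) -> log_sum q chi != 0 ->
    T0 <= pw (- a) q ->
    pw (- a) q ^- 8 <= cabs (\sum_(1 <= n < (q ^ 3).+1) chi n * (n%:R^-1)%:C).
Proof.
move=> G a0 a9; pose K : R := 2 + 3 / a.
have ia0 : 0 < a^-1 by rewrite invr_gt0.
have K2 : 2 <= K by rewrite lerDl divr_ge0// ltW.
have K0 : 0 <= K by lra.
have [c c0 cE] : exists2 c : R, 0 <= c & 256 * expR 8 = c.
  exists (256 * expR 8); last reflexivity.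
  exact: (mulr_ge0 (ler0n _ _) (expR_ge0 _)).
pose C : R := c * (8 * ((2 + K ^+ 2) ^+ 4 * K)).
have C0 : 0 <= C.
  apply: (mulr_ge0 c0 (mulr_ge0 (ler0n _ _) (mulr_ge0 (exprn_ge0 _ _) K0))).
  by rewrite addr_ge0 ?ler0n ?sqr_ge0.
(* For non-real [chi] the argument is run at [1 + T ^ (- 10)], for real [chi] at [1 - a]. *)
exists (C + 5 / a + 1) => q chi qp chiP chiN chi_even lsn; set T := pw (- a) q => TT.
have q0 := prime_gt0 qp.
have q0' : 0 < q%:R :> R by rewrite ltr0n.
have T1 : 1 <= T by exact: pwN_ge1.
have T0 : 0 < T by apply: lt_le_trans T1.
have T9 : T ^+ 9 <= q%:R.
  rewrite /T pwNX; apply: pwN_le_q => //.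
  by rewrite -(@ler_pM2r _ 9^-1) ?invr_gt0// mul1r mulrAC divff ?mul1r// pnatr_eq0.
have lq : ln q%:R <= T / a by exact: ln_le_pwN.
have iT n : 0 < T ^- n by rewrite invr_gt0 exprn_gt0.
set D := (q ^ 3)%N; have D0 : (0 < D)%N by rewrite expn_gt0 q0.
set S := \sum_(1 <= n < _) _.
rewrite leNgt; apply/negP => small.
have Sl := ltW small.
have a5 : 0 <= 5 / a by rewrite divr_ge0// ltW.
have TC : C < T by lra.
have Ta : 5 / a < T by lra.
have [P|P] := pselect (principal_char q (fun n => chi n ^+ 2)).
  have chi_real := real_of_principal_sqr chiP P.
  have l0 : 0 < cabs (log_sum q chi) / Num.sqrt q%:R.
    by rewrite divr_gt0 ?cabs_gt0// sqrtr_gt0.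
  have L1 := Lfun1_neq0 chiP chiN chi_real l0 (log_sum_cabs_approx qp chiP chiN chi_even).
  have a2 : a < 2^-1 by apply: le_lt_trans a9 _; rewrite ltf_pV2 ?posrE// ltr_nat.
  have s1 : 2^-1 < 1 - a < 1 by apply/andP; split; lra.
  have Ls := Lfun_ge0_of_GRH chiP chiN chi_real G L1 s1.
  have := hecke_lower chiP chiN chi_real a0 a2 D0 Ls.
  have -> : pw (- a) D = T ^+ 3.
    rewrite /T !pwNE -expRM_natl /D natrX lnXn//; congr expR.
    by rewrite -mulr_natr; ring.
  rewrite -/S => H.
  have h1 : (T ^+ 3) ^+ 2 / a * cabs S <= T ^- 2 / a.
    apply: (@le_trans _ _ ((T ^+ 3) ^+ 2 / a * T ^- 8)).
      by rewrite ler_wpM2l// divr_ge0 ?sqr_ge0// ltW.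
    rewrite le_eqVlt; apply/orP; left; apply/eqP; field.
    by rewrite !gt_eqF.
  have h2 : 4 * q%:R * (T ^+ 3) ^+ 3 / (a * D%:R) <= 4 * (T ^- 2 / a).
    have -> : 4 * q%:R * (T ^+ 3) ^+ 3 / (a * D%:R) = (4 / a) * (T ^+ 9 / q%:R ^+ 2).
      by rewrite /D natrX; field; rewrite !gt_eqF.
    have -> : 4 * (T ^- 2 / a) = (4 / a) * T ^- 2 by ring.
    rewrite ler_wpM2l//; first by rewrite divr_ge0// ltW.
    rewrite ler_pdivrMr ?exprn_gt0// mulrC ler_pdivlMr ?exprn_gt0//.
    have t2 : T ^+ 2 <= q%:R by apply: le_trans T9; rewrite ler_weXn2l.
    by rewrite [leRHS]expr2; apply: ler_pM T9 t2; exact: exprn_ge0 (ltW T0).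
  have h3 : T ^- 2 / a * 5 < 1.
    have -> : T ^- 2 / a * 5 = (5 / a) / T ^+ 2 by ring.
    rewrite ltr_pdivrMr ?exprn_gt0// mul1r; apply: lt_le_trans Ta _.
    by rewrite expr2 ler_peMl// ltW.
  by lra.
have iT10 : 0 < T ^- 10 by [].
have := L1_lower_complex chiP chiN P iT10 D0.
rewrite -/S invrK cE => H.
have hq3 : ln D%:R <= K * T.
  rewrite /D natrX lnXn// -[ln _ *+ 3]mulr_natl /K.
  have -> : (2 + 3 / a) * T = 2 * T + 3 * (T / a) by ring.
  by have T0' := ltW T0; lra.
have hX : harm R D <= K * T.
  apply: le_trans (harm_ln R D0) _; rewrite /D natrX lnXn// -[ln _ *+ 3]mulr_natl /K.
  have -> : (2 + 3 / a) * T = 2 * T + 3 * (T / a) by ring.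
  by lra.
have hq : harm R q + 1 <= K * T.
  apply: le_trans (lerD (harm_ln R q0) (lexx _)) _; rewrite /K.
  have -> : (2 + 3 / a) * T = 2 * T + 3 * (T / a) by ring.
  have Ta0 : 0 <= T / a by rewrite divr_ge0// ltW.
  by lra.
have hl0 : 0 <= ln D%:R :> R by rewrite ln_ge0// ler1n.
have b1 : (1 + T ^+ 10) ^+ 3 <= 8 * T ^+ 30.
  have t1 : 1 <= T ^+ 10 by rewrite exprn_ege1.
  have -> : 8 * T ^+ 30 = (T ^+ 10 + T ^+ 10) ^+ 3.
    by rewrite -[30%N]/(10 * 3)%N exprM; ring.
  have le : 1 + T ^+ 10 <= T ^+ 10 + T ^+ 10 by rewrite lerD2r.
  by apply: lerXn2r le; rewrite nnegrE addr_ge0// (le_trans ler01).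
have b2 : q%:R / D%:R <= T ^- 8.
  rewrite /D natrX ler_pdivrMr ?exprn_gt0// mulrC ler_pdivlMr ?exprn_gt0//.
  rewrite [leRHS]exprS ler_wpM2l ?(ltW q0')//.
  have t8 : T ^+ 8 <= q%:R by apply: le_trans T9; rewrite ler_weXn2l.
  by apply: (le_trans t8); rewrite expr2; apply: ler_peMl; rewrite ?(ltW q0') ?ler1n.
have b3 : T ^- 10 * ln D%:R * harm R D <= K ^+ 2 * T ^- 8.
  apply: (@le_trans _ _ (T ^- 10 * (K * T) * (K * T))).
    rewrite ler_pM ?harm_ge0//; first by rewrite mulr_ge0// ltW.
    by rewrite ler_wpM2l// ltW.
  by rewrite le_eqVlt; apply/orP; left; apply/eqP; field; rewrite gt_eqF.
have b4 : (cabs S + q%:R / D%:R + T ^- 10 * ln D%:R * harm R D) ^+ 4 <= ((2 + K ^+ 2) * T ^- 8) ^+ 4.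
  have p0 : 0 <= cabs S + q%:R / D%:R + T ^- 10 * ln D%:R * harm R D.
    apply: addr_ge0; first by rewrite addr_ge0 ?cabs_ge0// divr_ge0.
    by rewrite mulr_ge0 ?harm_ge0// mulr_ge0// ltW.
  have -> : (2 + K ^+ 2) * T ^- 8 = T ^- 8 + T ^- 8 + K ^+ 2 * T ^- 8 by ring.
  have le3 := lerD (lerD Sl b2) b3.
  by rewrite lerXn2r ?nnegrE// (le_trans p0).
have p1 : 0 <= 1 + T ^+ 10 by rewrite addr_ge0// exprn_ge0// ltW.
have p4 (x : R) : 0 <= x ^+ 4 by rewrite (_ : x ^+ 4 = (x ^+ 2) ^+ 2) ?sqr_ge0//; ring.
have F : 1 <= c * (8 * T ^+ 30) * ((2 + K ^+ 2) * T ^- 8) ^+ 4 * (K * T).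
  apply: (le_trans H).
  have n1 : 0 <= c * (1 + T ^+ 10) ^+ 3 by rewrite mulr_ge0 ?exprn_ge0.
  have n2 : 0 <= harm R q + 1 by rewrite addr_ge0 ?harm_ge0.
  exact: (ler_pM (mulr_ge0 n1 (p4 _)) n2 (ler_pM n1 (p4 _) (ler_wpM2l c0 b1) b4) hq).
have e : c * (8 * T ^+ 30) * ((2 + K ^+ 2) * T ^- 8) ^+ 4 * (K * T) = C / T.
  rewrite /C exprMn; move: ((2 + K ^+ 2) ^+ 4) => k4.
  have -> : T ^+ 30 = T ^+ 8 ^+ 4 / (T * T) by field; rewrite gt_eqF.
  have t8 : (T ^- 8) ^+ 4 * T ^+ 8 ^+ 4 = 1.
    by rewrite -exprMn mulVf ?expr1n// gt_eqF// exprn_gt0.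
  transitivity (((T ^- 8) ^+ 4 * T ^+ 8 ^+ 4) * (c * (8 * (k4 * K)) * (T / (T * T)))).
    by move: ((T ^- 8) ^+ 4) (T ^+ 8 ^+ 4) => x y; ring.
  by rewrite t8 mul1r; congr (_ * _); field; rewrite gt_eqF.
by move: F; rewrite e ler_pdivlMr// mul1r => ?; lra.
Qed.

End LowerBound.

Lemma leq_mul3_half (q : nat) : (2 < q)%N -> (q <= 3 * q./2)%N.
Proof. by have := odd_double_half q; have := leq_b1 (odd q); rewrite -mul2n; lia. Qed.

(** * Asymptotics of the second moment *)

Section Asymptotics.
Local Open Scope complex_scope.
Variable R : realType.

(** Passes from truncated sums to |L(1, chi)|. As L >= u / 2, the two terms of the factored
    difference contribute 4 / u^3 and 2 / u^3. *)
Lemma inv_sqr_close (s L u d : R) : 0 < u -> u <= s -> `|s - L| <= d -> d <= u / 2 ->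
  `|L ^- 2 - s ^- 2| <= 6 * d / u ^+ 3.
Proof.
move=> u0 us sL du.
have s0 : 0 < s by apply: lt_le_trans us.
have Lu : u / 2 <= L by move: sL; rewrite ler_norml => /andP[_]; lra.
have u2 : 0 < u / 2 by rewrite divr_gt0.
have L0 : 0 < L by apply: lt_le_trans Lu.
have -> : L ^- 2 - s ^- 2 = (s - L) * ((s * L ^+ 2)^-1 + (s ^+ 2 * L)^-1).
  by field; rewrite !gt_eqF.
have i1 : (s * L ^+ 2)^-1 <= 4 / u ^+ 3.
  have -> : 4 / u ^+ 3 = (u * (u / 2) ^+ 2)^-1 by field; rewrite gt_eqF.
  rewrite lef_pV2 ?posrE ?mulr_gt0 ?exprn_gt0//.
  by rewrite ler_pM ?exprn_ge0 ?(ltW u0) ?(ltW u2)// lerXn2r ?nnegrE ?(ltW u2) ?(ltW L0).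
have i2 : (s ^+ 2 * L)^-1 <= 2 / u ^+ 3.
  have -> : 2 / u ^+ 3 = (u ^+ 2 * (u / 2))^-1 by field; rewrite gt_eqF.
  rewrite lef_pV2 ?posrE ?mulr_gt0 ?exprn_gt0//.
  by rewrite ler_pM ?exprn_ge0 ?(ltW u0) ?(ltW u2)// lerXn2r ?nnegrE ?(ltW u0) ?(ltW s0).
have p : 0 <= (s * L ^+ 2)^-1 + (s ^+ 2 * L)^-1.
  by rewrite addr_ge0 ?invr_ge0 ?mulr_ge0 ?exprn_ge0 ?ltW.
rewrite normrM (ger0_norm p).
have -> : 6 * d / u ^+ 3 = d * (4 / u ^+ 3 + 2 / u ^+ 3) by ring.
by rewrite ler_pM// lerD.
Qed.

(** The truncation at q^3 costs at most 1 / q; the multiples of q cost at most 1 / q times a partial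
    sum of zeta(2), which is at most 2. *)
Lemma coprime_sum_sqr_mu_zeta (q : nat) : prime q ->
  `|\sum_(1 <= n < (q ^ 3).+1 | coprime n q) mu R n ^+ 2 / n%:R ^+ 2 -
    zeta_nat R 2 / zeta_nat R 4| <= 3 / q%:R.
Proof.
move=> qp; have q0 := prime_gt0 qp; have q0' : 0 < q%:R :> R by rewrite ltr0n.
have q1 : 1 <= q%:R :> R by rewrite ler1n.
set X := (q ^ 3)%N; have X0 : (0 < X)%N by rewrite expn_gt0 q0.
have h1 := sum_sqr_mu_zeta R X0.
have iX : X%:R^-1 <= q%:R^-1 :> R.
  by rewrite lef_pV2 ?posrE ?ltr0n// ler_nat /X expnS leq_pmulr// expn_gt0 q0.
have split : \sum_(1 <= n < X.+1) mu R n ^+ 2 / n%:R ^+ 2 =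
    \sum_(1 <= n < X.+1 | coprime n q) mu R n ^+ 2 / n%:R ^+ 2 +
    \sum_(1 <= n < X.+1 | (q %| n)%N) mu R n ^+ 2 / n%:R ^+ 2.
  rewrite (bigID (fun n => coprime n q))/=; congr (_ + _).
  by apply: eq_bigl => n; rewrite coprime_sym prime_coprime// negbK.
have small : 0 <= \sum_(1 <= n < X.+1 | (q %| n)%N) mu R n ^+ 2 / n%:R ^+ 2 <= 2 / q%:R.
  apply/andP; split; first by apply: sumr_ge0 => n _; rewrite divr_ge0 ?sqr_ge0.
  rewrite sum_multiples//.
  apply: (@le_trans _ _ (q%:R^-1 * \sum_(1 <= k < (X %/ q).+1) k%:R ^- 2)).
    rewrite mulr_sumr; apply: ler_sum => k _.
    have i0 : 0 <= k%:R ^- 2 :> R by rewrite invr_ge0 sqr_ge0.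
    have m1 : mu R (k * q) ^+ 2 <= 1 by rewrite sqr_mu lern1 leq_b1.
    rewrite natrM exprMn invfM -[leRHS]mul1r ler_pM ?sqr_ge0 ?mulr_ge0 ?invr_ge0 ?sqr_ge0//.
    rewrite mulrC ler_wpM2r// lef_pV2 ?posrE ?exprn_gt0//.
    by rewrite expr2 ler_peMl// ltW.
  rewrite mulrC ler_wpM2r ?invr_ge0 ?(ltW q0')//.
  have X1 : (1 < (X %/ q).+1)%N by rewrite ltnS divn_gt0// /X expnS leq_pmulr// expn_gt0 q0.
  rewrite big_ltn// expr1n invr1.
  have := @sum_inv_sqr_tail R 1 (X %/ q).+1 isT; rewrite invr1; lra.
have -> : 3 / q%:R = q%:R^-1 + 2 / q%:R :> R by ring.
move: h1 small split iX.
move: (\sum_(1 <= n < X.+1 | coprime n q) mu R n ^+ 2 / n%:R ^+ 2)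
  (\sum_(1 <= n < X.+1 | (q %| n)%N) mu R n ^+ 2 / n%:R ^+ 2) => x y.
move: (zeta_nat R 2 / zeta_nat R 4) (q%:R^-1) (2 / q%:R) (X%:R^-1) => z i t j.
rewrite !ler_norml => /andP[h1 h2] /andP[h3 h4] h5 h6; rewrite h5 in h1 h2.
by apply/andP; split; lra.
Qed.

Lemma L1_second_moment (eps : R) : GRH R -> 0 < eps ->
  exists (C : R) (Q0 : nat), 0 <= C /\
  forall (q : nat) (chi : nat -> nat -> R[i]), prime q -> (2 < q)%N -> (Q0 <= q)%N ->
  (forall b, dirichlet_char q (chi b)) ->
  (forall b k, (k <= q)%N -> chi b (q - k)%N = chi b k) ->
  (forall b, (0 < b < q./2)%N -> ~ principal_char q (chi b)) ->
  (forall m n, coprime m q -> coprime n q -> (m != n %[mod q])%N -> ~~ (q %| m + n)%N ->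
    \sum_(0 <= b < q./2) chi b m * (chi b n)^* = 0) ->
  (forall b, (0 < b < q./2)%N -> log_sum q (chi b) != 0) ->
  `|\sum_(1 <= b < q./2) (cabs (log_sum q (chi b)) / Num.sqrt q%:R) ^- 2 -
    (q./2)%:R * (zeta_nat R 2 / zeta_nat R 4)| <= (q./2)%:R * (C * powR q%:R (eps - 1)).
Proof.
(* All logarithms, divisor bounds and lower bounds for [L(1, chi)] are powers of [T = q ^ a],
   and at most [T ^ 24 <= q ^ eps] is lost in total. *)
move=> G e0; pose a : R := Num.min eps 1 / 24.
have m0 : 0 < Num.min eps 1 by rewrite lt_min e0 ltr01.
have m1 : Num.min eps 1 <= 1 by rewrite ge_min lexx orbT.
have me : Num.min eps 1 <= eps by rewrite ge_min lexx.
have a0 : 0 < a by rewrite divr_gt0.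
have a24 : 24 * a = Num.min eps 1 by rewrite /a mulrC divfK.
have a9 : a <= 9^-1 by move: a24 m1; move: (Num.min eps 1) => m *; lra.
have [T0 HT0] := L1_lower_bound G a0 a9.
(* The divisor bound is applied up to X^3 = q^9, where n^(a / 9) is at most q^a = T. *)
have a9' : 0 < a / 9 by rewrite divr_gt0.
have [Cd [Cd0 HCd]] := divisors_bound a9'.
pose Ck := 1 + Cd; have Ck1 : 1 <= Ck by rewrite lerDl ltW.
pose K := 2 + 9 / a; have K1 : 1 <= K.
  by have : 0 <= 9 / a by [rewrite divr_ge0// ltW]; rewrite /K; lra.
(* Makes T at least |T0| + 2: above the threshold T0, and at least 2 so that 2 T^8 <= T^9 <= q, as
   [inv_sqr_close] requires. *)
have x0 : 0 < (`|T0| + 2)^-1 by rewrite invr_gt0 ltr_wpDl.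
have [Q0 [_ HQ0]] := pw_small a0 x0.
pose ck := Ck ^+ 4 * K ^+ 2.
have ck0 : 0 <= ck by rewrite mulr_ge0 ?sqr_ge0// exprn_ge0// (le_trans ler01).
(* 48 = 18 + 9 + 21 collects the three terms of the mollified moment, of size T^(16 + 6) / q at
   most, with T^16 from U^2 and T^6 from B^4 H^2. 9 = 6 + 3 comes from passing to L(1, chi), which
   costs (T^8)^3 / q, and from the coprime sum. *)
exists (48 * ck + 9), Q0; split; first by rewrite addr_ge0// mulr_ge0.
move=> q chi qp q2 qQ chiP chi_even chiN orth lsn.
have q0 := prime_gt0 qp; have q0' : 0 < q%:R :> R by rewrite ltr0n.
have q1 : 1 <= q%:R :> R by rewrite ler1n.
pose T := pw (- a) q.
have TT : `|T0| + 2 <= T.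
  by rewrite /T pwN -[leLHS]invrK lef_pV2 ?posrE ?pw_gt0// HQ0.
have T2 : 2 <= T by apply: le_trans TT; rewrite lerDr.
have T00 : T0 <= T by apply: le_trans TT; have := ler_norm T0; lra.
have T1 : 1 <= T by lra.
have Tp : 0 < T by lra.
have T9 : T ^+ 9 <= q%:R.
  rewrite /T pwNX; apply: pwN_le_q => //; lra.
pose Z := T ^+ 24 / q%:R.
have ZE : Z <= powR q%:R (eps - 1).
  rewrite /Z /T pwNX a24 /powR gt_eqF// pwNE.
  have -> : q%:R^-1 = expR (- ln q%:R) :> R by rewrite expRN lnK// posrE.
  rewrite -expRD ler_expR mulrBl mul1r lerD2r ler_wpM2r//.
  by rewrite ln_ge0.
set h := q./2.
have h0 : (0 < h)%N by rewrite half_gt0 ltnW.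
have h0' : 0 < h%:R :> R by rewrite ltr0n.
have qh : q%:R <= 3 * h%:R :> R.
  have qh := leq_mul3_half q2.
  by rewrite -(natrM R 3 h) ler_nat.
set X := (q ^ 3)%N; have X0 : (0 < X)%N by rewrite expn_gt0 q0.
have X3 : (X * (X * X) = q ^ 9)%N by rewrite /X -!expnD.
pose S b := \sum_(1 <= n < X.+1) chi b n * (n%:R^-1)%:C.
have Slow b : (0 < b < h)%N -> T ^- 8 <= cabs (S b).
  move=> bh; exact: (HT0 q (chi b) qp (chiP b) (chiN b bh) (chi_even b) (lsn b bh) T00).
have iT8 : 0 < T ^- 8 by rewrite invr_gt0 exprn_gt0.
have SU b : (0 < b < h)%N -> S b != 0 /\ (cabs (S b))^-1 <= T ^+ 8.
  move=> /Slow sl; have sp := lt_le_trans iT8 sl; split; first by rewrite -cabs_gt0.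
  by rewrite -[leRHS]invrK lef_pV2 ?posrE.
have divB n : (0 < n <= X * (X * X))%N -> (size (divisors n))%:R <= Ck * T.
  rewrite X3 => /andP[n0 n9]; apply: le_trans (HCd n n0) _.
  rewrite ler_pM ?powR_ge0 ?(ltW Cd0)//; first by rewrite /Ck lerDr.
  rewrite /powR pnatr_eq0 gtn_eqF// /T pwNE ler_expR.
  have ln9 : ln n%:R <= 9 * ln q%:R :> R.
    rewrite mulr_natl -lnXn// -natrX ler_ln ?posrE ?ltr0n ?expn_gt0 ?q0//.
    by rewrite ler_nat.
  by apply: le_trans (ler_wpM2l (ltW a9') ln9) _; rewrite mulrA divfK.
have B1 : 1 <= Ck * T by rewrite -[leLHS]mulr1 ler_pM.
have M := mollified_second_moment q0 (fun b => cabs_chi_le1 (chiP b)) (fun b => chi_ncoprime (chiP b))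
  (fun b => cabs_chi (chiP b)) orth (fun b => chiM (chiP b)) (fun b => chi1 (chiP b))
  X0 B1 (exprn_ge0 8 (ltW Tp)) divB SU h0.
set H := harm R (2 * (X * (X * X))) in M.
have HK : H <= K * T.
  rewrite /H X3; apply: le_trans (harm_ln R _) _; first by rewrite muln_gt0 expn_gt0 q0.
  have ln2 : ln 2 <= 1 :> R by have := @le_ln1Dx R 1; rewrite (_ : 1 + 1 = 2)//; apply; lra.
  rewrite natrM natrX lnM ?posrE ?exprn_gt0// lnXn// -[ln _ *+ 9]mulr_natl /K.
  have -> : (2 + 9 / a) * T = 2 * T + 9 * (T / a) by ring.
  have := @ln_le_pwN R a q a0; rewrite -/T; move: (T / a) (ln q%:R) => y z; lra.
have H0 : 0 <= H by exact: harm_ge0.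
pose g := ck * T ^+ 6.
have g0 : 0 <= g by rewrite mulr_ge0// exprn_ge0// ltW.
have hg1 : (Ck * T) ^+ 4 * H ^+ 2 <= g.
  apply: (@le_trans _ _ ((Ck * T) ^+ 4 * (K * T) ^+ 2)).
    rewrite ler_wpM2l//; first by rewrite exprn_ge0// (le_trans ler01).
    by rewrite lerXn2r// nnegrE (le_trans H0).
  by rewrite /g /ck le_eqVlt; apply/orP; left; apply/eqP; ring.
have hg2 : (Ck * T) ^+ 4 <= g.
  have -> : g = (Ck * T) ^+ 4 * (K * T) ^+ 2 by rewrite /g /ck; ring.
  rewrite ler_peMr ?exprn_ge0 ?(le_trans ler01)// exprn_ege1//.
  by rewrite -[leLHS]mulr1 ler_pM.
have e1 : 6 * (Ck * T) ^+ 4 * H ^+ 2 / q%:R <= 6 * (g / q%:R).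
  have -> : 6 * (Ck * T) ^+ 4 * H ^+ 2 / q%:R = 6 * ((Ck * T) ^+ 4 * H ^+ 2 / q%:R) by ring.
  by rewrite ler_wpM2l// ler_wpM2r// invr_ge0 ltW.
have qX : q%:R <= X%:R :> R by rewrite ler_nat /X expnS leq_pmulr// expn_gt0 q0.
have e2 : (Ck * T) ^+ 4 / X%:R <= g / q%:R.
  by rewrite ler_pM ?invr_ge0 ?ler0n ?exprn_ge0 ?(le_trans ler01)// lef_pV2 ?posrE// ltr0n.
(* The principal character is one out of h, and q <= 3 h makes its bounded power of T relatively
   small. *)
have e3 : 3 * (Ck * T) ^+ 4 * H ^+ 2 <= 9 * (h%:R * (g / q%:R)).
  have -> : 9 * (h%:R * (g / q%:R)) = 3 * (g * (3 * h%:R / q%:R)) by ring.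
  rewrite -mulrA ler_wpM2l//; apply: (le_trans hg1); rewrite ler_peMr//.
  by rewrite ler_pdivlMr// mul1r.
set err := 6 * (Ck * T) ^+ 4 * H ^+ 2 / q%:R in M e1.
set tail := (Ck * T) ^+ 4 / X%:R in M e2.
have gq0 : 0 <= g / q%:R by rewrite divr_ge0// ltW.
have T8 : 1 <= T ^+ 8 by rewrite exprn_ege1.
have U3 : 2 * T ^+ 8 + (T ^+ 8) ^+ 2 <= 3 * T ^+ 16.
  have -> : T ^+ 16 = T ^+ 8 * T ^+ 8 by rewrite -exprD.
  by nra.
have M' : `|\sum_(1 <= b < h) cabs (S b) ^- 2 -
    h%:R * \sum_(1 <= n < X.+1 | coprime n q) mu R n ^+ 2 / n%:R ^+ 2| <= h%:R * (48 * ck * Z).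
  apply: (le_trans M).
  have r1 : 3 * h%:R * err <= 18 * (h%:R * (g / q%:R)).
    have -> : 18 * (h%:R * (g / q%:R)) = 3 * h%:R * (6 * (g / q%:R)) by ring.
    by rewrite ler_wpM2l// mulr_ge0.
  have r2 : (2 * T ^+ 8 + (T ^+ 8) ^+ 2) * (h%:R * (err + tail)) <=
      3 * T ^+ 16 * (h%:R * (7 * (g / q%:R))).
    apply: ler_pM => //.
    - by rewrite addr_ge0 ?sqr_ge0// mulr_ge0// (le_trans ler01).
    - rewrite mulr_ge0// addr_ge0 /err /tail//; apply: divr_ge0; rewrite ?ler0n//.
        by rewrite -mulrA mulr_ge0// mulr_ge0 ?sqr_ge0// exprn_ge0// (le_trans ler01).
      by rewrite exprn_ge0// (le_trans ler01).
    - by rewrite ler_wpM2l//; lra.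
  apply: (le_trans (lerD (lerD r1 e3) r2)).
  have T16 : 1 <= T ^+ 16 by rewrite exprn_ege1.
  have y0 : 0 <= h%:R * (g / q%:R) by rewrite mulr_ge0.
  apply: (@le_trans _ _ (48 * (T ^+ 16 * (h%:R * (g / q%:R))))).
    have := ler_wpM2r y0 T16; rewrite mul1r.
    have -> : 3 * T ^+ 16 * (h%:R * (7 * (g / q%:R))) = 21 * (T ^+ 16 * (h%:R * (g / q%:R))) by ring.
    by move: (h%:R * (g / q%:R)) => z; move: (T ^+ 16 * z) => y; lra.
  have -> : 48 * (T ^+ 16 * (h%:R * (g / q%:R))) = h%:R * (48 * ck * (T ^+ 22 / q%:R)).
    by rewrite /g -[22%N]/(16 + 6)%N exprD; ring.
  rewrite ler_wpM2l// ler_wpM2l//; first by rewrite mulr_ge0.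
  by rewrite /Z ler_wpM2r ?invr_ge0 ?(ltW q0')// ler_weXn2l.
have Zq : q%:R^-1 <= Z by rewrite /Z ler_peMl ?invr_ge0 ?(ltW q0')// exprn_ege1.
have P1 : h%:R * `|\sum_(1 <= n < X.+1 | coprime n q) mu R n ^+ 2 / n%:R ^+ 2 -
    zeta_nat R 2 / zeta_nat R 4| <= h%:R * (3 * Z).
  rewrite ler_wpM2l//; apply: le_trans (coprime_sum_sqr_mu_zeta qp) _.
  by rewrite ler_wpM2l.
have P2 : `|\sum_(1 <= b < h) (cabs (log_sum q (chi b)) / Num.sqrt q%:R) ^- 2 -
    \sum_(1 <= b < h) cabs (S b) ^- 2| <= h%:R * (6 * Z).
  rewrite -sumrB; apply: le_trans (ler_norm_sum _ _ _) _.
  apply: (@le_trans _ _ (\sum_(1 <= b < h) 6 * Z)); last first.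
    rewrite sumr_const_nat -[leLHS]mulr_natl ler_wpM2r ?ler_nat ?leq_subr//.
    by rewrite mulr_ge0// (le_trans _ Zq)// invr_ge0 ltW.
  rewrite [leLHS]big_nat [leRHS]big_nat; apply: ler_sum => b bh.
  have -> : 6 * Z = 6 * q%:R^-1 / (T ^- 8) ^+ 3.
    rewrite /Z -[24%N]/(8 * 3)%N exprM; move: (T ^+ 8) Tp (exprn_gt0 8 Tp) => t _ t0.
    by field; rewrite !gt_eqF.
  apply: (inv_sqr_close iT8 (Slow b bh)).
    apply: le_trans (log_sum_cabs_approx qp (chiP b) (chiN b bh) (chi_even b) X) _.
    rewrite ler_pdivrMr ?ltr0n// mulrC ler_pdivlMr//.
    rewrite -natrM ler_nat; apply: leq_trans (leqnSn _).
    by rewrite /X mulnn leq_pexp2l.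
  rewrite -[leRHS]invrK lef_pV2 ?posrE ?invr_gt0 ?divr_gt0//.
  rewrite invfM !invrK; apply: le_trans T9; rewrite [leRHS]exprSr ler_wpM2l//.
  by rewrite exprn_ge0// ltW.
have fin : `|\sum_(1 <= b < h) (cabs (log_sum q (chi b)) / Num.sqrt q%:R) ^- 2 -
    h%:R * (zeta_nat R 2 / zeta_nat R 4)| <= h%:R * ((48 * ck + 9) * Z).
  have -> : h%:R * ((48 * ck + 9) * Z) =
      h%:R * (6 * Z) + h%:R * (48 * ck * Z) + h%:R * (3 * Z) by ring.
  move: P2 M' P1.
  move: (\sum_(1 <= b < h) (cabs (log_sum q (chi b)) / Num.sqrt q%:R) ^- 2) => A1.
  move: (\sum_(1 <= b < h) cabs (S b) ^- 2) => A2.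
  move: (\sum_(1 <= n < X.+1 | coprime n q) mu R n ^+ 2 / n%:R ^+ 2) (_ / zeta_nat R 4) => A3 r P2 M' P1.
  have -> : A1 - h%:R * r = (A1 - A2) + (A2 - h%:R * A3) + h%:R * (A3 - r) by ring.
  apply: le_trans (ler_normD _ _) _; apply: lerD; last by rewrite normrM ger0_norm.
  exact: le_trans (ler_normD _ _) (lerD P2 M').
apply: (le_trans fin); rewrite ler_wpM2l// ler_wpM2l//.
by rewrite addr_ge0// mulr_ge0.
Qed.

End Asymptotics.

Theorem theorem3p1 (R : realType) :
  (forall (q : nat) (G : {set 'I_q}) (bv : 'I_q -> 'I_q -> R),
     prime q -> (2 < q)%N -> rep_set G -> dual_basis G bv ->
     forall j j', j \in Gm1 G -> j' \in Gm1 G -> normG G (bv j) = normG G (bv j'))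
  /\
  (GRH R ->
   forall eps : R, 0 < eps ->
   exists (C : R) (Q0 : nat), forall (q : nat) (G : {set 'I_q}) (bv : 'I_q -> 'I_q -> R),
     prime q -> (2 < q)%N -> (Q0 <= q)%N -> rep_set G -> dual_basis G bv ->
     forall j, j \in Gm1 G ->
       let main := 4 * zeta_nat R 2 / zeta_nat R 4 * (q%:R)^-1 in
       `| normG G (bv j) ^+ 2 - main | <= C * main * powR (q%:R) (eps - 1)).
Proof.
have odd_bounds q : (2 < q)%N -> 0 < (q./2)%:R :> R.
  by move=> q2; rewrite ltr0n half_gt0 ltnW.
split.
  move=> q G bv qp q2 GP bvP j j' jG j'G.
  have [chi [c1 c2 c3 c4 c5]] := even_characters R qp q2.
  have e := dual_norm_eq qp q2 GP bvP jG c1 c2 c3 c4 c5.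
  rewrite -(dual_norm_eq qp q2 GP bvP j'G c1 c2 c3 c4 c5) in e.
  have := mulfI (lt0r_neq0 (odd_bounds q q2)) e => /eqP.
  by rewrite eqrXn2 ?sqrtr_ge0// => /eqP.
move=> G eps e0; have [C [Q0 [C0 H]]] := L1_second_moment G e0.
have z2 := @zeta_nat_ge1 R 2 isT; have z4 := @zeta_nat_ge1 R 4 isT.
have z20 : 0 < zeta_nat R 2 by apply: lt_le_trans z2.
have z40 : 0 < zeta_nat R 4 by apply: lt_le_trans z4.
(* The error is measured relative to [main], which contains the zeta ratio. *)
exists (C / (zeta_nat R 2 / zeta_nat R 4)), Q0 => q GG bv qp q2 qQ GP bvP j jG.
cbv zeta; set main := 4 * zeta_nat R 2 / zeta_nat R 4 * q%:R^-1.
have q0 : 0 < q%:R :> R by rewrite ltr0n prime_gt0.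
have s0 : 0 < Num.sqrt q%:R :> R by rewrite sqrtr_gt0.
have h0 := odd_bounds q q2.
have [chi [c1 c2 c3 c4 c5]] := even_characters R qp q2.
have ls b (bh : (0 < b < q./2)%N) : log_sum q (chi b) != 0 :=
  log_sum_neq0 qp q2 GP bvP jG (c1 b) (c4 b bh) (c2 b).
have := H q chi qp q2 qQ c1 c2 c4 c5 ls.
have := dual_norm_eq qp q2 GP bvP jG c1 c2 c3 c4 c5.
have -> : \sum_(1 <= b < q./2) 4 / cabs (log_sum q (chi b)) ^+ 2 =
    4 / q%:R * \sum_(1 <= b < q./2) (cabs (log_sum q (chi b)) / Num.sqrt q%:R) ^- 2.
  rewrite mulr_sumr; apply: eq_big_nat => b bh.
  have l0 : 0 < cabs (log_sum q (chi b)) by rewrite cabs_gt0 ls.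
  rewrite expr_div_n (sqr_sqrtr (ltW q0)).
  by field; rewrite !gt_eqF.
set A := \sum_(1 <= b < q./2) _; set N := normG GG (bv j) ^+ 2 => eN.
have f0 : 0 < 4 / q%:R :> R by rewrite divr_gt0.
move=> hA; have := ler_wpM2l (ltW f0) hA.
rewrite -[X in X * `|_|](gtr0_norm f0) -normrM mulrBr -eN.
have -> : (q./2)%:R * N - 4 / q%:R * ((q./2)%:R * (zeta_nat R 2 / zeta_nat R 4)) =
    (q./2)%:R * (N - main) by rewrite /main; ring.
have -> : 4 / q%:R * ((q./2)%:R * (C * powR q%:R (eps - 1))) =
    (q./2)%:R * (C / (zeta_nat R 2 / zeta_nat R 4) * main * powR q%:R (eps - 1)).
  by rewrite /main; field; rewrite !gt_eqF.
by rewrite normrM (gtr0_norm h0) ler_pM2l.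
Qed.
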